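(* Let $G$ be a cyclic $p$-group with $p$ a prime. (i) If $G$ is trivial, then $B_\circ(G,G)\cong C_2$. (ii) If $G=C_2$, then $B_\circ(G,G)\cong C_2\times D_8$. (iii) If $p$ is odd and $|G|=p^n$ with $n\geq 1$, then \[B_\circ(G,G)\cong C_2^{\,n+2}\times\prod_{i=1}^n\mathrm{Out}(C_{p^i})\quad\text{if } p=3,\] \[B_\circ(G,G)\cong C_2^{\,n+1}\times\prod_{i=1}^n\mathrm{Out}(C_{p^i})\quad\text{if } p>3.\]
   Context: For finite groups $G,H$, a $(G,H)$-biset is a set with commuting left $G$-action and right $H$-action. $B(G,H)$ denotes the Grothendieck group of isomorphism classes of finite $(G,H)$-bisets with respect to disjoint union, and $[X]$ is the class of $X$. For a $(G,H)$-biset $X$ and an $(H,K)$-biset $Y$, $X\times_H Y$ is the set of $H$-orbits of $X\times Y$ under $h\cdot(x,y)=(xh^{-1},hy)$, with its natural $(G,K)$-biset structure; this induces associative bilinear maps $\circ:B(G,H)\times B(H,K)\to B(G,K)$. The double Burnside ring of $G$ is $B(G,G)$ with multiplication $\circ$; its identity is $\mathrm{Id}_G=[G]$ ($G$ acting on itself by left and right multiplication). The opposite of a $(G,H)$-biset $X$ is the $(H,G)$-biset $X^\circ$ with underlying set $X$ and action $h\cdot x\cdot g=g^{-1}xh^{-1}$; this induces an additive map $(-)^\circ:B(G,H)\to B(H,G)$, which for $G=H$ is an anti-involution of the ring $B(G,G)$. The group of orthogonal units is $B_\circ(G,G)=\{u\in B(G,G)^\times : uu^\circ=u^\circ u=\mathrm{Id}_G\}$.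 $C_m$ is the cyclic group of order $m$, $D_8$ is the dihedral group of order $8$, and $\mathrm{Out}$ denotes the outer automorphism group. *)

(* Defs.v *)
From HB Require Import structures.
From mathcomp Require Import all_boot all_order all_algebra.
From mathcomp Require Import all_fingroup all_solvable.
From mathcomp Require Import boolp generic_quotient.

Set Implicit Arguments.
Unset Strict Implicit.
Unset Printing Implicit Defensive.

Import GRing.Theory.

Section Grothendieck.
Local Open Scope ring_scope.
Variable M : nmodType.

Definition groth_rel (u v : M * M) : bool :=
  `[< exists z, u.1 + v.2 + z = v.1 + u.2 + z >].

Lemma groth_refl : reflexive groth_rel.
Proof. by move=> u; apply/asboolP; exists 0. Qed.

Lemma groth_sym : symmetric groth_rel.
Proof.
by move=> u v; apply/asboolP/asboolP => -[z e]; exists z; rewrite e.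
Qed.

Lemma groth_trans : transitive groth_rel.
Proof.
move=> v u w /asboolP[z e] /asboolP[t f]; apply/asboolP.
exists (v.1 + v.2 + z + t).
transitivity ((u.1 + v.2 + z) + (v.1 + w.2 + t)).
  by rewrite !addrA [LHS](ACl (1*4*5*3*2*6)).
by rewrite e f !addrA [LHS](ACl (4*2*1*5*3*6)).
Qed.

Canonical groth_equiv := EquivRel groth_rel groth_refl groth_sym groth_trans.

Definition groth : Type := {eq_quot groth_rel}%qT.
HB.instance Definition _ := Choice.on groth.
HB.instance Definition _ := EqQuotient.on groth.

(* gdiff x y is the formal difference [x] - [y] *)
Definition gdiff (x y : M) : groth := (\pi_groth (x, y))%qT.

Lemma gdiff_eq x y x' y' :
  gdiff x y = gdiff x' y' <-> exists z, x + y' + z = x' + y + z.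
Proof.
rewrite /gdiff; split=> [/eqmodP/asboolP //|e].
by apply/eqmodP/asboolP.
Qed.

Lemma gdiffP u : exists x y, u = gdiff x y.
Proof.
exists (repr u).1, (repr u).2; rewrite /gdiff -surjective_pairing.
by rewrite reprK.
Qed.

Definition gadd (u v : groth) : groth :=
  gdiff ((repr u).1 + (repr v).1) ((repr u).2 + (repr v).2).
Definition gopp (u : groth) : groth := gdiff (repr u).2 (repr u).1.

Lemma repr_gdiff x y :
  exists z, (repr (gdiff x y)).1 + y + z = x + (repr (gdiff x y)).2 + z.
Proof.
apply/gdiff_eq; rewrite {1}/gdiff -surjective_pairing.
by rewrite reprK.
Qed.

Lemma gaddE x y x' y' :
  gadd (gdiff x y) (gdiff x' y') = gdiff (x + x') (y + y').
Proof.
apply/gdiff_eq; have [z e] := repr_gdiff x y; have [t f] := repr_gdiff x' y'.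
exists (z + t); set a := repr _ in e *; set b := repr _ in f *.
transitivity ((a.1 + y + z) + (b.1 + y' + t)).
  by rewrite !addrA [LHS](ACl (1*3*5*2*4*6)).
by rewrite e f !addrA [LHS](ACl (1*4*2*5*3*6)).
Qed.

Lemma goppE x y : gopp (gdiff x y) = gdiff y x.
Proof.
apply/gdiff_eq; have [z e] := repr_gdiff x y; exists z.
by rewrite -(addrC x) -e (addrC y).
Qed.

Lemma gaddA : associative gadd.
Proof.
move=> u v w; have [a [b ->]] := gdiffP u; have [c [d ->]] := gdiffP v.
by have [e [f ->]] := gdiffP w; rewrite !gaddE !addrA.
Qed.

Lemma gaddC : commutative gadd.
Proof.
move=> u v; have [a [b ->]] := gdiffP u; have [c [d ->]] := gdiffP v.
by rewrite !gaddE (addrC a) (addrC b).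
Qed.

Lemma gadd0 : left_id (gdiff 0 0) gadd.
Proof. by move=> u; have [a [b ->]] := gdiffP u; rewrite gaddE !add0r. Qed.

Lemma gaddN : left_inverse (gdiff 0 0) gopp gadd.
Proof.
move=> u; have [a [b ->]] := gdiffP u; rewrite goppE gaddE.
by apply/gdiff_eq; exists 0; rewrite !addr0 add0r addrC.
Qed.

HB.instance Definition _ := GRing.isZmodule.Build groth gaddA gaddC gadd0 gaddN.

Definition gclass (x : M) : groth := gdiff x 0.

Lemma gclassD : {morph gclass : x y / x + y}.
Proof. by move=> x y; rewrite [RHS](gaddE x 0 y 0) addr0. Qed.

Lemma gclassB u : exists x y, u = gclass x - gclass y.
Proof.
have [x [y ->]] := gdiffP u; exists x, y; rewrite [- _]goppE.
by rewrite [RHS](gaddE x 0 0 y) addr0 add0r.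
Qed.

(* The extension of an additive map on M to the Grothendieck group; it sends *)
(* [x] - [y] to f x - f y when f is additive (glift_class and gliftD).       *)
Definition glift (V : zmodType) (f : M -> V) (u : groth) : V :=
  f (repr u).1 - f (repr u).2.

Section Lift.
Variables (V : zmodType) (f : M -> V).
Hypothesis fD : {morph f : x y / x + y}.

Lemma glift_diff x y : glift f (gdiff x y) = f x - f y.
Proof.
rewrite /glift; have [z e] := repr_gdiff x y; set a := repr _ in e *.
have /addIr {}e : f a.1 + f y + f z = f x + f a.2 + f z by rewrite -!fD e.
by apply/eqP; rewrite subr_eq addrAC eq_sym subr_eq e.
Qed.

Lemma gliftD : {morph glift f : u v / u + v}.
Proof.
move=> u v; have [a [b ->]] := gdiffP u; have [c [d ->]] := gdiffP v.
by rewrite [gdiff a b + _]gaddE !glift_diff !fD opprD addrACA.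
Qed.

Lemma glift_class x : glift f (gclass x) = f x.
Proof.
have f0 : f 0 = 0 by apply: (addIr (f 0)); rewrite -fD !add0r.
by rewrite glift_diff f0 subr0.
Qed.

Lemma gliftB : {morph glift f : u v / u - v}.
Proof.
move=> u v; apply: (addIr (glift f v)).
by rewrite -gliftD !subrK.
Qed.
End Lift.

End Grothendieck.

Section Bisets.
Local Open Scope group_scope.
Variables G H : finGroupType.

Record biset_on (T : finType) := BisetOn {
  lact_on : G -> T -> T;
  ract_on : T -> H -> T;
  lact_on1 : forall x, lact_on 1 x = x;
  lact_onM : forall g g' x, lact_on (g * g') x = lact_on g (lact_on g' x);
  ract_on1 : forall x, ract_on x 1 = x;
  ract_onM : forall x h h', ract_on x (h * h') = ract_on (ract_on x h) h';
  lract_on : forall g x h, ract_on (lact_on g x) h = lact_on g (ract_on x h)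
}.

Record biset := Biset { bset :> finType; bstr : biset_on bset }.

Definition lact (X : biset) : G -> X -> X := lact_on (bstr X).
Definition ract (X : biset) : X -> H -> X := ract_on (bstr X).

Section Laws.
Variable X : biset.
Implicit Types x : X.
Lemma lact1 x : lact 1 x = x. Proof. exact: lact_on1. Qed.
Lemma lactM g g' x : lact (g * g') x = lact g (lact g' x).
Proof. exact: lact_onM. Qed.
Lemma ract1 x : ract x 1 = x. Proof. exact: ract_on1. Qed.
Lemma ractM x h h' : ract x (h * h') = ract (ract x h) h'.
Proof. exact: ract_onM. Qed.
Lemma lract g x h : ract (lact g x) h = lact g (ract x h).
Proof. exact: lract_on. Qed.
Lemma ractK h : cancel (fun x => ract x h) (fun x => ract x h^-1).
Proof. by move=> x; rewrite -ractM mulgV ract1. Qed.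
Lemma ractVK h : cancel (fun x => ract x h^-1) (fun x => ract x h).
Proof. by move=> x; rewrite -ractM mulVg ract1. Qed.
Lemma lactK g : cancel (@lact X g) (lact g^-1).
Proof. by move=> x; rewrite -lactM mulVg lact1. Qed.
Lemma lactVK g : cancel (@lact X g^-1) (lact g).
Proof. by move=> x; rewrite -lactM mulgV lact1. Qed.
End Laws.

Definition biso (X Y : biset) : Prop := exists f : X -> Y,
  [/\ bijective f, forall g x, f (lact g x) = lact g (f x)
    & forall x h, f (ract x h) = ract (f x) h].

Lemma biso_refl X : biso X X.
Proof. by exists id; split=> //; exists id. Qed.

Lemma biso_sym X Y : biso X Y -> biso Y X.
Proof.
case=> f [[f' fK f'K] fl fr]; exists f'; split; first by exists f.
  by move=> g y; apply: (can_inj fK); rewrite fl !f'K.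
by move=> y h; apply: (can_inj fK); rewrite fr !f'K.
Qed.

Lemma biso_trans X Y Z : biso X Y -> biso Y Z -> biso X Z.
Proof.
case=> f [fb fl fr] [f' [fb' fl' fr']]; exists (f' \o f); split.
- exact: bij_comp.
- by move=> g x /=; rewrite fl fl'.
- by move=> x h /=; rewrite fr fr'.
Qed.

Lemma biso_surj (T : Type) (la : G -> T -> T) (ra : T -> H -> T)
    (X Y : biset) (a : T -> X) (b : T -> Y) :
  (forall x, exists t, a t = x) -> (forall y, exists t, b t = y) ->
  (forall s t, a s = a t <-> b s = b t) ->
  (forall g t, a (la g t) = lact g (a t)) ->
  (forall t h, a (ra t h) = ract (a t) h) ->
  (forall g t, b (la g t) = lact g (b t)) ->
  (forall t h, b (ra t h) = ract (b t) h) -> biso X Y.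
Proof.
move=> sa sb ab al ar bl br.
pose f x := b (sval (cid (sa x))); pose f' y := a (sval (cid (sb y))).
have fE t : f (a t) = b t by rewrite /f; case: cid => s /= /ab.
have f'E t : f' (b t) = a t by rewrite /f'; case: cid => s /= /ab.
exists f; split.
- exists f'; first by move=> x; have [t <-] := sa x; rewrite fE f'E.
  by move=> y; have [t <-] := sb y; rewrite f'E fE.
- by move=> g x; have [t <-] := sa x; rewrite -al !fE bl.
- by move=> x h; have [t <-] := sa x; rewrite -ar !fE br.
Qed.

(* To keep the type of isomorphism classes in a small universe, the quotient *)
(* is taken on bisets carried by ordinals; skel X is a copy of X in this     *)
(* type (skel_iso), so that every finite biset has a class.                  *)
Definition sbiset : Type := {n : nat & biset_on 'I_n}.
HB.instance Definition _ := gen_eqMixin sbiset.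
HB.instance Definition _ := gen_choiceMixin sbiset.

Definition unskel (s : sbiset) : biset := Biset (projT2 s).

Program Definition skel_on (X : biset) : biset_on 'I_#|X| :=
  @BisetOn 'I_#|X| (fun g i => enum_rank (lact g (enum_val i)))
    (fun i h => enum_rank (ract (enum_val i) h)) _ _ _ _ _.
Next Obligation. by rewrite lact1 enum_valK. Qed.
Next Obligation. by rewrite enum_rankK lactM. Qed.
Next Obligation. by rewrite ract1 enum_valK. Qed.
Next Obligation. by rewrite enum_rankK ractM. Qed.
Next Obligation. by rewrite !enum_rankK lract. Qed.

Definition skel (X : biset) : sbiset := existT _ #|X| (skel_on X).

Lemma skel_iso X : biso X (unskel (skel X)).
Proof.
exists (@enum_rank X); split; first exact: enum_rank_bij.
  by move=> g x; rewrite {2}/lact /= enum_rankK.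
by move=> x h; rewrite {2}/ract /= enum_rankK.
Qed.

Program Definition bempty : biset :=
  @Biset void (@BisetOn void (fun _ x => x) (fun x _ => x) _ _ _ _ _).

Definition sum_lact (X Y : biset) (g : G) (z : X + Y) : X + Y :=
  match z with inl x => inl (lact g x) | inr y => inr (lact g y) end.
Definition sum_ract (X Y : biset) (z : X + Y) (h : H) : X + Y :=
  match z with inl x => inl (ract x h) | inr y => inr (ract y h) end.

Program Definition bsum (X Y : biset) : biset :=
  @Biset (X + Y)%type
    (@BisetOn (X + Y)%type (@sum_lact X Y) (@sum_ract X Y) _ _ _ _ _).
Next Obligation. by case: x => x /=; rewrite lact1. Qed.
Next Obligation. by case: x => x /=; rewrite lactM. Qed.
Next Obligation. by case: x => x /=; rewrite ract1. Qed.
Next Obligation. by case: x => x /=; rewrite ractM. Qed.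
Next Obligation. by case: x => x /=; rewrite lract. Qed.

Lemma bsum_iso X X' Y Y' : biso X X' -> biso Y Y' -> biso (bsum X Y) (bsum X' Y').
Proof.
case=> f [[f' fK f'K] fl fr] [k [[k' kK k'K] kl kr]].
exists (fun z : X + Y => match z with inl x => inl (f x) | inr y => inr (k y) end
        : bsum X' Y').
split; last 2 first.
- by move=> g [x|y]; rewrite /lact /= ?fl ?kl.
- by move=> [x|y] h; rewrite /ract /= ?fr ?kr.
exists (fun z : X' + Y' =>
          match z with inl x => inl (f' x) | inr y => inr (k' y) end).
  by case=> z; rewrite ?fK ?kK.
by case=> z; rewrite ?f'K ?k'K.
Qed.

Lemma bsumC X Y : biso (bsum X Y) (bsum Y X).
Proof.
exists (fun z : X + Y => match z with inl x => inr x | inr y => inl y end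
        : bsum Y X).
split; [|by move=> g []|by move=> []].
by exists (fun z : Y + X => match z with inl x => inr x | inr y => inl y end);
   case.
Qed.

Lemma bsumA X Y Z : biso (bsum X (bsum Y Z)) (bsum (bsum X Y) Z).
Proof.
exists (fun z : X + (Y + Z) => match z with
   inl x => inl (inl x) | inr (inl y) => inl (inr y) | inr (inr z) => inr z end
        : bsum (bsum X Y) Z).
split; [|by move=> g [|[]]|by move=> [|[]]].
exists (fun z : X + Y + Z => match z with
   inl (inl x) => inl x | inl (inr y) => inr (inl y) | inr z => inr (inr z) end).
  by case=> [|[]].
by case=> [[]|].
Qed.

Lemma bsum0 X : biso (bsum bempty X) X.
Proof.
exists (fun z : void + X => match z with inl x => of_void _ x | inr y => y end).
split; [|by move=> g [[]|]|by move=> [[]|]].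
by exists inr => // -[[]|].
Qed.

End Bisets.

Arguments lact {G H X}.
Arguments ract {G H X}.

Program Definition bid (G : finGroupType) : biset G G :=
  @Biset G G G (@BisetOn G G G (fun g x => g * x)%g (fun x h => x * h)%g _ _ _ _ _).
Next Obligation. by rewrite mul1g. Qed.
Next Obligation. by rewrite mulgA. Qed.
Next Obligation. by rewrite mulg1. Qed.
Next Obligation. by rewrite mulgA. Qed.
Next Obligation. by rewrite mulgA. Qed.

Section Opposite.
Local Open Scope group_scope.
Variables G H : finGroupType.

Program Definition bopp (X : biset G H) : biset H G :=
  @Biset H G X (@BisetOn H G X (fun h x => ract x h^-1) (fun x g => lact g^-1 x)
                 _ _ _ _ _).
Next Obligation. by rewrite invg1 ract1. Qed.
Next Obligation. by rewrite invMg ractM. Qed.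
Next Obligation. by rewrite invg1 lact1. Qed.
Next Obligation. by rewrite invMg lactM. Qed.
Next Obligation. by rewrite lract. Qed.

Lemma bopp_iso X Y : biso X Y -> biso (bopp X) (bopp Y).
Proof. by case=> f [fb fl fr]; exists f; split=> // *; [apply: fr|apply: fl]. Qed.

Lemma bopp_sum X Y : biso (bopp (bsum X Y)) (bsum (bopp X) (bopp Y)).
Proof. by exists id; split; [exists id|move=> g []|case]. Qed.
End Opposite.

Lemma boppK G H (X : biset G H) : biso (bopp (bopp X)) X.
Proof.
exists id; split; first by exists id.
  by move=> g x; rewrite {1}/lact /= {1}/ract /= invgK.
by move=> x h; rewrite {1}/ract /= {1}/lact /= invgK.
Qed.

Lemma bopp_id (G : finGroupType) : biso (bopp (bid G)) (bid G).
Proof.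
exists (fun x : G => x^-1 : bid G)%g; split.
- by exists (fun x : G => x^-1)%g; apply: invgK.
- by move=> g x; rewrite /lact /= /ract /= invMg invgK.
- by move=> g x; rewrite /lact /= /ract /= invMg invgK.
Qed.

Section Tensor.
Local Open Scope group_scope.
Variables G H K : finGroupType.
Variables (X : biset G H) (Y : biset H K).

(* The H-orbits of X * Y for h . (x, y) = (x h^-1, h y). *)
Definition torbit (p : X * Y) : {set X * Y} :=
  [set (ract p.1 h^-1, lact h p.2) | h : H].
Definition torbits : {set {set X * Y}} := [set torbit p | p : X * Y].
Definition tensor_set : finType := {A : {set X * Y} | A \in torbits}.

Lemma torbit_eqP p q :
  torbit p = torbit q <-> exists h, q = (ract p.1 h^-1, lact h p.2).
Proof.
split=> [e|[h ->]].
  have /imsetP[h _ ->]: q \in torbit p; last by exists h.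
  by rewrite e; apply/imsetP; exists 1 => //; rewrite invg1 ract1 lact1 -surjective_pairing.
apply/setP=> r; apply/imsetP/imsetP=> -[k _ ->] /=.
  by exists (k * h^-1) => //; rewrite invMg invgK -ractM mulKg -lactM mulgKV.
by exists (k * h) => //; rewrite invMg ractM lactM.
Qed.

Definition tlact (g : G) (A : {set X * Y}) := [set (lact g p.1, p.2) | p in A].
Definition tract (A : {set X * Y}) (k : K) := [set (p.1, ract p.2 k) | p in A].

Lemma tlact_orbit g p : tlact g (torbit p) = torbit (lact g p.1, p.2).
Proof.
rewrite /tlact /torbit -imset_comp; apply: eq_imset => h /=.
by rewrite lract.
Qed.

Lemma tract_orbit p k : tract (torbit p) k = torbit (p.1, ract p.2 k).
Proof.
rewrite /tract /torbit -imset_comp; apply: eq_imset => h /=.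
by rewrite lract.
Qed.

Lemma tlact_in g A : A \in torbits -> tlact g A \in torbits.
Proof. by case/imsetP=> p _ ->; rewrite tlact_orbit imset_f. Qed.
Lemma tract_in A k : A \in torbits -> tract A k \in torbits.
Proof. by case/imsetP=> p _ ->; rewrite tract_orbit imset_f. Qed.

Lemma torbit_in p : torbit p \in torbits. Proof. exact: imset_f. Qed.

Definition tensor_lact g (A : tensor_set) : tensor_set :=
  exist _ (tlact g (val A)) (tlact_in g (valP A)).
Definition tensor_ract (A : tensor_set) k : tensor_set :=
  exist _ (tract (val A) k) (tract_in k (valP A)).
Definition tpair (x : X) (y : Y) : tensor_set :=
  exist _ (torbit (x, y)) (torbit_in (x, y)).

Lemma tpair_lact g x y : tensor_lact g (tpair x y) = tpair (lact g x) y.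
Proof. by apply: val_inj; rewrite /= tlact_orbit. Qed.
Lemma tpair_ract x y k : tensor_ract (tpair x y) k = tpair x (ract y k).
Proof. by apply: val_inj; rewrite /= tract_orbit. Qed.
Lemma tpair_surj t : exists p : X * Y, tpair p.1 p.2 = t.
Proof.
case: t => A AO; case/imsetP: (AO) => -[x y] _ e; exists (x, y).
by apply: val_inj.
Qed.
Lemma tpair_eq x y x' y' :
  tpair x y = tpair x' y' <-> exists h, x' = ract x h^-1 /\ y' = lact h y.
Proof.
split=> [/(congr1 val) /torbit_eqP[h [-> ->]]|[h [-> ->]]]; first by exists h.
by apply: val_inj; apply/torbit_eqP; exists h.
Qed.

Local Obligation Tactic := intros.
Program Definition btensor : biset G K :=
  @Biset G K tensor_set
    (@BisetOn G K tensor_set tensor_lact tensor_ract _ _ _ _ _).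
Next Obligation. by have [p <-] := tpair_surj x; rewrite tpair_lact lact1. Qed.
Next Obligation. by have [p <-] := tpair_surj x; rewrite !tpair_lact lactM. Qed.
Next Obligation. by have [p <-] := tpair_surj x; rewrite tpair_ract ract1. Qed.
Next Obligation. by have [p <-] := tpair_surj x; rewrite !tpair_ract ractM. Qed.
Next Obligation.
by have [p <-] := tpair_surj x; rewrite tpair_ract !tpair_lact tpair_ract.
Qed.

Lemma btensor_lact g x y :
  lact g (tpair x y : btensor) = tpair (lact g x) y :> btensor.
Proof. exact: tpair_lact. Qed.
Lemma btensor_ract x y k :
  ract (tpair x y : btensor) k = tpair x (ract y k) :> btensor.
Proof. exact: tpair_ract. Qed.
Lemma btensor_eq x y x' y' :
  tpair x y = tpair x' y' :> btensor <->
  exists h, x' = ract x h^-1 /\ y' = lact h y.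
Proof. exact: tpair_eq. Qed.
Lemma btensor_eqE x y x' y' :
  (tpair x y = tpair x' y' :> btensor) =
  (exists h, x' = ract x h^-1 /\ y' = lact h y).
Proof. exact/propext/btensor_eq. Qed.
End Tensor.
Arguments btensor_eqE {G H K} X Y.

Arguments tpair {G H K X Y}.
Arguments tpair_surj {G H K X Y}.

Section TensorIso.
Local Open Scope group_scope.
Variables G H K L : finGroupType.

Lemma btensor_iso (X X' : biset G H) (Y Y' : biset H K) :
  biso X X' -> biso Y Y' -> biso (btensor X Y) (btensor X' Y').
Proof.
case=> f [[f' fK f'K] fl fr] [k [[k' kK k'K] kl kr]].
apply: (@biso_surj _ _ (X * Y) (fun g p => (lact g p.1, p.2))
  (fun p h => (p.1, ract p.2 h)) (btensor X Y) (btensor X' Y')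
  (fun p => tpair p.1 p.2) (fun p => tpair (f p.1) (k p.2))).
- exact: tpair_surj.
- move=> t; have [p <-] := tpair_surj t.
  by exists (f' p.1, k' p.2); rewrite /= f'K k'K.
- move=> s t; rewrite /= (btensor_eqE X Y) (btensor_eqE X' Y'); split=> -[h [e1 e2]]; exists h.
    by rewrite e1 e2 fr kl.
  by split; [apply: (can_inj fK)|apply: (can_inj kK)]; rewrite ?fr ?kl.
- by move=> g p; rewrite btensor_lact.
- by move=> p h; rewrite btensor_ract.
- by move=> g p /=; rewrite btensor_lact fl.
- by move=> p h /=; rewrite btensor_ract kr.
Qed.

Lemma btensorDl (X X' : biset G H) (Y : biset H K) :
  biso (btensor (bsum X X') Y) (bsum (btensor X Y) (btensor X' Y)).
Proof.
apply: (@biso_surj _ _ (bsum X X' * Y) (fun g p => (lact g p.1, p.2))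
  (fun p h => (p.1, ract p.2 h)) _ _
  (fun p => tpair p.1 p.2 : btensor (bsum X X') Y)
  (fun p => match p.1 with inl x => inl (tpair x p.2) | inr x => inr (tpair x p.2) end
     : bsum (btensor X Y) (btensor X' Y))).
- exact: tpair_surj.
- by case=> t; have [[x y] <-] := tpair_surj t;
     [exists (inl x, y)|exists (inr x, y)].
- move=> [[x|x] y] [[x'|x'] y'] /=; rewrite (btensor_eqE (bsum X X') Y); split.
  + by case=> h [[->] ->]; apply: (congr1 inl); apply/btensor_eq; exists h.
  + by move=> /(@inl_inj _ _ _ _) /btensor_eq[h [-> ->]]; exists h.
  + by case=> h [].
  + by [].
  + by case=> h [].
  + by [].
  + by case=> h [[->] ->]; apply: (congr1 inr); apply/btensor_eq; exists h.
  + by move=> /(@inr_inj _ _ _ _) /btensor_eq[h [-> ->]]; exists h.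
- by move=> g p; rewrite btensor_lact.
- by move=> p h; rewrite btensor_ract.
- by move=> g [[x|x] y] /=; rewrite {2}/lact /=; congr (_ _); rewrite -tpair_lact.
- by move=> [[x|x] y] h /=; rewrite {2}/ract /=; congr (_ _); rewrite -tpair_ract.
Qed.

Lemma btensorDr (X : biset G H) (Y Y' : biset H K) :
  biso (btensor X (bsum Y Y')) (bsum (btensor X Y) (btensor X Y')).
Proof.
apply: (@biso_surj _ _ (X * bsum Y Y') (fun g p => (lact g p.1, p.2))
  (fun p h => (p.1, ract p.2 h)) _ _
  (fun p => tpair p.1 p.2 : btensor X (bsum Y Y'))
  (fun p => match p.2 with inl y => inl (tpair p.1 y) | inr y => inr (tpair p.1 y) end
     : bsum (btensor X Y) (btensor X Y'))).
- exact: tpair_surj.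
- by case=> t; have [[x y] <-] := tpair_surj t;
     [exists (x, inl y)|exists (x, inr y)].
- move=> [x [y|y]] [x' [y'|y']] /=; rewrite (btensor_eqE X (bsum Y Y')); split.
  + by case=> h [-> [->]]; apply: (congr1 inl); apply/btensor_eq; exists h.
  + by move=> /(@inl_inj _ _ _ _) /btensor_eq[h [-> ->]]; exists h.
  + by case=> h [].
  + by [].
  + by case=> h [].
  + by [].
  + by case=> h [-> [->]]; apply: (congr1 inr); apply/btensor_eq; exists h.
  + by move=> /(@inr_inj _ _ _ _) /btensor_eq[h [-> ->]]; exists h.
- by move=> g p; rewrite btensor_lact.
- by move=> p h; rewrite btensor_ract.
- by move=> g [x [y|y]] /=; rewrite {2}/lact /=; congr (_ _); rewrite -tpair_lact.
- by move=> [x [y|y]] h /=; rewrite {2}/ract /=; congr (_ _); rewrite -tpair_ract.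
Qed.

Lemma btensorA (X : biset G H) (Y : biset H K) (Z : biset K L) :
  biso (btensor X (btensor Y Z)) (btensor (btensor X Y) Z).
Proof.
apply: (@biso_surj _ _ (X * Y * Z) (fun g p => (lact g p.1.1, p.1.2, p.2))
  (fun p h => (p.1, ract p.2 h)) _ _
  (fun p => tpair p.1.1 (tpair p.1.2 p.2 : btensor Y Z) : btensor X (btensor Y Z))
  (fun p => tpair (tpair p.1.1 p.1.2 : btensor X Y) p.2
     : btensor (btensor X Y) Z)).
- move=> t; have [[x s] <-] := tpair_surj t.
  by have [[y z] <-] := tpair_surj s; exists (x, y, z).
- move=> t; have [[s z] <-] := tpair_surj t.
  by have [[x y] <-] := tpair_surj s; exists (x, y, z).
- move=> [[x y] z] [[x' y'] z'] /=; rewrite (btensor_eqE X (btensor Y Z)) (btensor_eqE (btensor X Y) Z); split.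
  + case=> h [->]; rewrite btensor_lact => /esym/btensor_eq[k [-> ->]].
    exists k; split=> //; rewrite btensor_ract; apply/esym/btensor_eq.
    by exists h; rewrite lract.
  + case=> k []; rewrite btensor_ract => /esym/btensor_eq[h [-> ->]] ->.
    exists h; split=> //; rewrite btensor_lact; apply/esym/btensor_eq.
    by exists k; rewrite lract.
- by move=> g p; rewrite btensor_lact.
- by move=> p h; rewrite !btensor_ract.
- by move=> g p; rewrite !btensor_lact.
- by move=> p h; rewrite btensor_ract.
Qed.

Lemma btensor_idl (X : biset G H) : biso (btensor (bid G) X) X.
Proof.
apply: (@biso_surj _ _ (G * X) (fun g p => (g * p.1, p.2))
  (fun p h => (p.1, ract p.2 h)) _ _
  (fun p => tpair (p.1 : bid G) p.2 : btensor (bid G) X)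
  (fun p => lact p.1 p.2)).
- exact: tpair_surj.
- by move=> x; exists (1, x); rewrite lact1.
- move=> [g x] [g' x'] /=; rewrite (btensor_eqE (bid G) X); split=> [[h [-> ->]]|e].
    by rewrite /ract /= -lactM mulgKV.
  exists (g'^-1 * g); split; first by rewrite /ract /= invMg invgK mulKVg.
  by rewrite lactM e lactK.
- by move=> g p; rewrite btensor_lact.
- by move=> p h; rewrite !btensor_ract.
- by move=> g p; rewrite lactM.
- by move=> p h /=; rewrite lract.
Qed.

Lemma btensor_idr (X : biset G H) : biso (btensor X (bid H)) X.
Proof.
apply: (@biso_surj _ _ (X * H) (fun g p => (lact g p.1, p.2))
  (fun p h => (p.1, p.2 * h)) _ _
  (fun p => tpair p.1 (p.2 : bid H) : btensor X (bid H))
  (fun p => ract p.1 p.2)).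
- exact: tpair_surj.
- by move=> x; exists (x, 1); rewrite ract1.
- move=> [x g] [x' g'] /=; rewrite (btensor_eqE X (bid H)); split=> [[h [-> ->]]|e].
    by rewrite /lact /= -ractM mulKg.
  exists (g' * g^-1); split; last by rewrite /lact /= mulgKV.
  by rewrite invMg invgK ractM e ractK.
- by move=> g p; rewrite btensor_lact.
- by move=> p h; rewrite !btensor_ract.
- by move=> g p /=; rewrite lract.
- by move=> p h /=; rewrite ractM.
Qed.

Lemma bopp_tensor (X : biset G H) (Y : biset H K) :
  biso (bopp (btensor X Y)) (btensor (bopp Y) (bopp X)).
Proof.
apply: (@biso_surj _ _ (X * Y) (fun k p => (p.1, ract p.2 k^-1))
  (fun p g => (lact g^-1 p.1, p.2)) _ _
  (fun p => tpair p.1 p.2 : bopp (btensor X Y))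
  (fun p => tpair (p.2 : bopp Y) (p.1 : bopp X) : btensor (bopp Y) (bopp X))).
- exact: tpair_surj.
- by move=> t; have [[y x] <-] := tpair_surj t; exists (x, y).
- move=> [x y] [x' y'] /=; rewrite (btensor_eqE X Y) (btensor_eqE (bopp Y) (bopp X)); split=> -[h [-> ->]]; exists h.
    by rewrite /lact /ract /= ?invgK.
  by rewrite /lact /ract /= ?invgK.
- by move=> k p; rewrite -btensor_ract.
- by move=> p g; rewrite -btensor_lact.
- by move=> k p; rewrite btensor_lact.
- by move=> p g; rewrite btensor_ract.
Qed.
End TensorIso.

Section Classes.
Local Open Scope ring_scope.
Variables G H : finGroupType.

Definition sbiso (s t : sbiset G H) : bool := `[< biso (unskel s) (unskel t) >].

Lemma sbiso_refl : reflexive sbiso.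
Proof. by move=> s; apply/asboolP/biso_refl. Qed.
Lemma sbiso_sym : symmetric sbiso.
Proof. by move=> s t; apply/asboolP/asboolP; apply: biso_sym. Qed.
Lemma sbiso_trans : transitive sbiso.
Proof. by move=> t s u /asboolP st /asboolP tu; apply/asboolP/(biso_trans st). Qed.
Canonical sbiso_equiv := EquivRel sbiso sbiso_refl sbiso_sym sbiso_trans.

Definition bclass : Type := {eq_quot sbiso}%qT.
HB.instance Definition _ := Choice.on bclass.
HB.instance Definition _ := EqQuotient.on bclass.

Definition cls (X : biset G H) : bclass := (\pi_bclass (skel X))%qT.
Definition cls_rep (u : bclass) : biset G H := unskel (repr u).

Lemma cls_eq X Y : cls X = cls Y <-> biso X Y.
Proof.
rewrite /cls; split=> [/eqmodP/asboolP e|e].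
  apply: biso_trans (skel_iso X) (biso_trans e _).
  exact/biso_sym/skel_iso.
apply/eqmodP/asboolP; apply: biso_trans (biso_trans e (skel_iso Y)).
exact/biso_sym/skel_iso.
Qed.

Lemma cls_repK u : cls (cls_rep u) = u.
Proof.
rewrite -[RHS]reprK; apply/eqmodP/asboolP.
exact/biso_sym/skel_iso.
Qed.

Lemma cls_rep_iso X : biso (cls_rep (cls X)) X.
Proof. by apply/cls_eq; rewrite cls_repK. Qed.

Lemma clsP u : exists X, u = cls X.
Proof. by exists (cls_rep u); rewrite cls_repK. Qed.

Definition cls_add (u v : bclass) : bclass := cls (bsum (cls_rep u) (cls_rep v)).

Lemma cls_addE X Y : cls_add (cls X) (cls Y) = cls (bsum X Y).
Proof. by apply/cls_eq/bsum_iso; apply: cls_rep_iso. Qed.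

Lemma cls_addA : associative cls_add.
Proof.
move=> u v w; have [X ->] := clsP u; have [Y ->] := clsP v.
by have [Z ->] := clsP w; rewrite !cls_addE; apply/cls_eq/bsumA.
Qed.

Lemma cls_addC : commutative cls_add.
Proof.
move=> u v; have [X ->] := clsP u; have [Y ->] := clsP v.
by rewrite !cls_addE; apply/cls_eq/bsumC.
Qed.

Lemma cls_add0 : left_id (cls (bempty G H)) cls_add.
Proof.
by move=> u; have [X ->] := clsP u; rewrite cls_addE; apply/cls_eq/bsum0.
Qed.

HB.instance Definition _ := GRing.isNmodule.Build bclass cls_addA cls_addC cls_add0.

Lemma clsD X Y : cls X + cls Y = cls (bsum X Y).
Proof. exact: cls_addE. Qed.

Definition burnside : Type := groth bclass.
HB.instance Definition _ := GRing.Zmodule.on burnside.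

Definition bcls (X : biset G H) : burnside := gclass (cls X).

Lemma bclsD X Y : bcls (bsum X Y) = bcls X + bcls Y.
Proof. by rewrite /bcls -clsD; apply: gclassD. Qed.

Lemma bcls_iso X Y : biso X Y -> bcls X = bcls Y.
Proof. by move=> e; congr gclass; apply/cls_eq. Qed.

Lemma burnside_ind (P : burnside -> Prop) :
  (forall X, P (bcls X)) -> (forall u v, P u -> P v -> P (u - v)) ->
  forall u, P u.
Proof.
move=> PX PB u; have [x [y ->]] := gclassB u.
by have [X ->] := clsP x; have [Y ->] := clsP y; apply: PB; apply: PX.
Qed.
End Classes.

Definition cls_tensor (G H K : finGroupType) (u : bclass G H) (v : bclass H K) :
  bclass G K := cls (btensor (cls_rep u) (cls_rep v)).

Definition cls_opp (G H : finGroupType) (u : bclass G H) : bclass H G :=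
  cls (bopp (cls_rep u)).

(* The biadditive map sending [X], [Y] to [X x_H Y]; see bcomp_cls.          *)
HB.lock Definition bcomp (G H K : finGroupType)
    (u : burnside G H) (v : burnside H K) : burnside G K :=
  glift (fun x => glift (fun y => gclass (cls_tensor x y) : burnside G K) v) u.

(* The additive map sending [X] to the class of the opposite of X; see bop_cls. *)
HB.lock Definition bop (G H : finGroupType) (u : burnside G H) : burnside H G :=
  glift (fun x => gclass (cls_opp x) : burnside H G) u.

Section Operations.
Local Open Scope ring_scope.
Variables G H K : finGroupType.

Implicit Types (X : biset G H) (Y : biset H K).
Implicit Types (u : bclass G H) (v : bclass H K).

Lemma cls_tensorE X Y : cls_tensor (cls X) (cls Y) = cls (btensor X Y).
Proof. by apply/cls_eq/btensor_iso; apply: cls_rep_iso. Qed.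

Lemma cls_tensorDl u u' v :
  cls_tensor (u + u') v = cls_tensor u v + cls_tensor u' v.
Proof.
have [X ->] := clsP u; have [X' ->] := clsP u'; have [Y ->] := clsP v.
by rewrite clsD !cls_tensorE clsD; apply/cls_eq/btensorDl.
Qed.

Lemma cls_tensorDr u v v' :
  cls_tensor u (v + v') = cls_tensor u v + cls_tensor u v'.
Proof.
have [X ->] := clsP u; have [Y ->] := clsP v; have [Y' ->] := clsP v'.
by rewrite clsD !cls_tensorE clsD; apply/cls_eq/btensorDr.
Qed.

Lemma cls_oppE X : cls_opp (cls X) = cls (bopp X).
Proof. by apply/cls_eq/bopp_iso; apply: cls_rep_iso. Qed.

Lemma cls_oppD u (u' : bclass G H) : cls_opp (u + u') = cls_opp u + cls_opp u'.
Proof.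
have [X ->] := clsP u; have [X' ->] := clsP u'.
by rewrite clsD !cls_oppE clsD; apply/cls_eq/bopp_sum.
Qed.

Let tensorr_morph (x : bclass G H) :
  {morph (fun y : bclass H K => gclass (cls_tensor x y) : burnside G K) : y y' / y + y'}.
Proof. by move=> y y'; rewrite cls_tensorDr; apply: gclassD. Qed.

Let tensorl_morph (v : burnside H K) :
  {morph (fun x : bclass G H => glift (fun y => gclass (cls_tensor x y) : burnside G K) v)
     : x x' / x + x'}.
Proof.
move=> x x'; rewrite /glift !cls_tensorDl.
by rewrite !(@gclassD (bclass G K)) opprD addrACA.
Qed.

Let opp_morph :
  {morph (fun x : bclass G H => gclass (cls_opp x) : burnside H G) : y y' / y + y'}.
Proof. by move=> y y'; rewrite cls_oppD; apply: gclassD. Qed.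

Lemma bcomp_cls X Y : bcomp (bcls X) (bcls Y) = bcls (btensor X Y).
Proof.
rewrite bcomp.unlock (glift_class (tensorl_morph _)) (glift_class (tensorr_morph _)).
by rewrite cls_tensorE.
Qed.

Implicit Types (a : burnside G H) (b : burnside H K).

Lemma bcompDl a a' b : bcomp (a + a') b = bcomp a b + bcomp a' b.
Proof. rewrite bcomp.unlock; exact: (gliftD (tensorl_morph b)). Qed.
Lemma bcompBl a a' b : bcomp (a - a') b = bcomp a b - bcomp a' b.
Proof. rewrite bcomp.unlock; exact: (gliftB (tensorl_morph b)). Qed.
Lemma bcompDr a b b' : bcomp a (b + b') = bcomp a b + bcomp a b'.
Proof.
pose f x (y : bclass H K) : burnside G K := gclass (cls_tensor x y).
have E x : glift (f x) (b + b') = glift (f x) b + glift (f x) b'.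
  exact: (gliftD (tensorr_morph x)).
have B c : bcomp a c = glift (f (repr a).1) c - glift (f (repr a).2) c.
  by rewrite bcomp.unlock.
by rewrite !B !E opprD addrACA.
Qed.
Lemma bcompBr a b b' : bcomp a (b - b') = bcomp a b - bcomp a b'.
Proof. by have := bcompDr a (b - b') b'; rewrite subrK => ->; rewrite addrK. Qed.

Lemma bop_cls X : bop (bcls X) = bcls (bopp X).
Proof. by rewrite bop.unlock (glift_class opp_morph) cls_oppE. Qed.
Lemma bopD : {morph @bop G H : u v / u + v}.
Proof. by rewrite bop.unlock; apply: (gliftD opp_morph). Qed.
Lemma bopB : {morph @bop G H : u v / u - v}.
Proof. by rewrite bop.unlock; apply: (gliftB opp_morph). Qed.
End Operations.

Section Identities.
Local Open Scope ring_scope.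
Variables G H K L : finGroupType.

Lemma bcompA (u : burnside G H) (v : burnside H K) (w : burnside K L) :
  bcomp u (bcomp v w) = bcomp (bcomp u v) w.
Proof.
elim/burnside_ind: u => [X|u u' IH IH']; last by rewrite !bcompBl IH IH'.
elim/burnside_ind: v => [Y|v v' IH IH']; last by rewrite bcompBl !bcompBr bcompBl IH IH'.
elim/burnside_ind: w => [Z|w w' IH IH']; last by rewrite !bcompBr IH IH'.
by rewrite !bcomp_cls; apply/bcls_iso/btensorA.
Qed.

Lemma bcomp1u (u : burnside G H) : bcomp (bcls (bid G)) u = u.
Proof.
elim/burnside_ind: u => [X|u u' IH IH']; last by rewrite !bcompBr IH IH'.
by rewrite bcomp_cls; apply/bcls_iso/btensor_idl.
Qed.

Lemma bcompu1 (u : burnside G H) : bcomp u (bcls (bid H)) = u.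
Proof.
elim/burnside_ind: u => [X|u u' IH IH']; last by rewrite !bcompBl IH IH'.
by rewrite bcomp_cls; apply/bcls_iso/btensor_idr.
Qed.

Lemma bopK (u : burnside G H) : bop (bop u) = u.
Proof.
elim/burnside_ind: u => [X|u u' IH IH']; last by rewrite !bopB IH IH'.
by rewrite !bop_cls; apply/bcls_iso/boppK.
Qed.

Lemma bop_comp (u : burnside G H) (v : burnside H K) :
  bop (bcomp u v) = bcomp (bop v) (bop u).
Proof.
elim/burnside_ind: u => [X|u u' IH IH'].
  elim/burnside_ind: v => [Y|v v' IH IH'].
    by rewrite bcomp_cls !bop_cls bcomp_cls; apply/bcls_iso/bopp_tensor.
  by rewrite bcompBr !bopB bcompBl IH IH'.
by rewrite bcompBl !bopB bcompBr IH IH'.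
Qed.

Lemma bop1 : bop (bcls (bid G)) = bcls (bid G).
Proof. by rewrite bop_cls; apply/bcls_iso/bopp_id. Qed.

Lemma bid_neq0 : bcls (bid G) != 0.
Proof.
apply/eqP => /gdiff_eq[z]; rewrite !addr0 add0r.
have [Z ->] := clsP z; rewrite clsD => /cls_eq[f [fb _ _]].
have := bij_eq_card fb; rewrite card_sum => /eqP.
by rewrite -[X in _ == X]add0n eqn_add2r eqn0Ngt; case/negP; apply/card_gt0P; exists 1%g.
Qed.
End Identities.

Section DoubleBurnside.
Local Open Scope ring_scope.
Variable G : finGroupType.

Definition double_burnside : Type := burnside G G.
HB.instance Definition _ := GRing.Zmodule.on double_burnside.

HB.instance Definition _ := GRing.Zmodule_isNzRing.Build double_burnside
  (@bcompA G G G G) (@bcomp1u G G) (@bcompu1 G G)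
  (fun u v w => bcompDl u v w) (fun u v w => bcompDr u v w) (@bid_neq0 G).

Definition db_unit : pred double_burnside :=
  fun u => `[< exists v, v * u = 1 /\ u * v = 1 >].

Definition db_inv (u : double_burnside) : double_burnside :=
  if pselect (exists v, v * u = 1 /\ u * v = 1) is left e then sval (cid e) else u.

Lemma db_mulVu : {in db_unit, left_inverse 1 db_inv *%R}.
Proof.
move=> u; rewrite unfold_in => /asboolP e; rewrite /db_inv.
by case: pselect => // e'; case: cid => v [].
Qed.

Lemma db_muluV : {in db_unit, right_inverse 1 db_inv *%R}.
Proof.
move=> u; rewrite unfold_in => /asboolP e; rewrite /db_inv.
by case: pselect => // e'; case: cid => v [].
Qed.

Lemma db_unitP u v : v * u = 1 /\ u * v = 1 -> db_unit u.
Proof. by move=> e; apply/asboolP; exists v. Qed.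

Lemma db_inv_out : {in [predC db_unit], db_inv =1 id}.
Proof.
move=> u; rewrite inE unfold_in => /asboolP e; rewrite /db_inv.
by case: pselect.
Qed.

HB.instance Definition _ := GRing.NzRing_hasMulInverse.Build double_burnside
  db_mulVu db_muluV db_unitP db_inv_out.

Definition dbop (u : double_burnside) : double_burnside := bop u.

Lemma dbop1 : dbop 1 = 1. Proof. exact: bop1. Qed.
Lemma dbopM u v : dbop (u * v) = dbop v * dbop u. Proof. exact: bop_comp. Qed.
Lemma dbopK : involutive dbop. Proof. exact: bopK. Qed.

Definition is_orthogonal (u : double_burnside) : bool :=
  [&& u \is a GRing.unit, u * dbop u == 1 & dbop u * u == 1].

Definition orthogonal_units : Type := {u : double_burnside | is_orthogonal u}.
HB.instance Definition _ := SubChoice.on orthogonal_units.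

Lemma is_orthogonal1 : is_orthogonal 1.
Proof. by rewrite /is_orthogonal dbop1 unitr1 mulr1 eqxx. Qed.

Lemma is_orthogonalM u v :
  is_orthogonal u -> is_orthogonal v -> is_orthogonal (u * v).
Proof.
move=> /and3P[Uu /eqP u1 /eqP u2] /and3P[Uv /eqP v1 /eqP v2].
rewrite /is_orthogonal unitrMl // Uu dbopM.
by rewrite mulrA -(mulrA u) v1 mulr1 u1 mulrA -(mulrA _ _ u) u2 mulr1 v2 eqxx.
Qed.

Lemma is_orthogonalV u : is_orthogonal u -> is_orthogonal (dbop u).
Proof.
move=> /and3P[Uu /eqP u1 /eqP u2]; rewrite /is_orthogonal dbopK u1 u2 eqxx.
by rewrite !andbT; apply/unitrP; exists u.
Qed.

Definition ortho_mul (u v : orthogonal_units) : orthogonal_units :=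
  exist _ (val u * val v) (is_orthogonalM (valP u) (valP v)).
Definition ortho_one : orthogonal_units := exist _ 1 is_orthogonal1.
Definition ortho_inv (u : orthogonal_units) : orthogonal_units :=
  exist _ (dbop (val u)) (is_orthogonalV (valP u)).

Lemma ortho_mulA : associative ortho_mul.
Proof. by move=> u v w; apply: val_inj; rewrite /= mulrA. Qed.
Lemma ortho_mul1 : left_id ortho_one ortho_mul.
Proof. by move=> u; apply: val_inj; rewrite /= mul1r. Qed.
Lemma ortho_mulu1 : right_id ortho_one ortho_mul.
Proof. by move=> u; apply: val_inj; rewrite /= mulr1. Qed.
Lemma ortho_mulV : left_inverse ortho_one ortho_inv ortho_mul.
Proof. by move=> u; apply: val_inj; have /and3P[_ _ /eqP] := valP u. Qed.
Lemma ortho_mulVr : right_inverse ortho_one ortho_inv ortho_mul.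
Proof. by move=> u; apply: val_inj; have /and3P[_ /eqP] := valP u. Qed.

HB.instance Definition _ := isGroup.Build orthogonal_units
  ortho_mulA ortho_mul1 ortho_mulu1 ortho_mulV ortho_mulVr.
End DoubleBurnside.

Section Groups.
Local Open Scope group_scope.

Definition Inn (gT : finGroupType) (A : {group gT}) : {group {perm gT}} :=
  (conj_aut A @* A)%G.

Definition Out (gT : finGroupType) (A : {group gT}) :
    {group coset_of (Inn A)} := (Aut A / Inn A)%G.

Definition elem2 (k : nat) : {group {dffun 'I_k -> 'Z_2}} :=
  [group of setXn (fun _ : 'I_k => Zp 2)].

(* A is not assumed to be finite, so isog does not apply to it. *)
Definition group_iso (A : groupType) (rT : finGroupType) (B : {group rT}) : Prop :=
  exists f : A -> rT,
    [/\ {morph f : x y / x * y}, injective f & forall y, y \in B <-> exists x, f x = y].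
End Groups.

(* Main.v *)
Require Import Defs.
From HB Require Import structures.
From mathcomp Require Import all_boot all_order all_algebra.
From mathcomp Require Import all_fingroup all_solvable.
From mathcomp Require Import boolp zify ring.

Set Implicit Arguments.
Unset Strict Implicit.
Unset Printing Implicit Defensive.

Import GRing.Theory Num.Theory Order.TTheory Defs.

(** Let G be abelian. For a subgroup L of G x H, the pairs (g, h) acting by
    t |-> g t h^-1 turn the cosets of L into a transitive (G, H)-biset [L]; these
    bisets form a basis of B(G, H) ([tcoefE]), the coefficient of [L] being the
    number of orbits of points with stabilizer L. In this basis composition is the
    composition of L and M as relations, up to the index in H of the product of the
    two projections ([bcomp_tcls]), and the opposite of [L] is the class of the
    inverse relation ([bop_tcls]).

    Let G be cyclic of order p^n > 1, N its subgroup of order p and u an orthogonal unit.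
    Compare the coefficients of [Delta Q] in u u^op = 1, where Delta Q is the
    diagonal of Q <= G. Only relations L with trivial left kernel contribute, that
    is graphs of homomorphisms from a subgroup of G to G. For Q = G the equation says
    that the squares of the coefficients at the automorphisms of G add up to 1, so u
    is a signed automorphism times a unit 1 + v where v has no coefficient at an
    automorphism ([orth_sgraph]). For 1 < Q < G, by downward induction on Q, it reads
      sum of |G : dom f| v_f^2 over the f with image Q, plus 2 v_(Delta Q), = 0,
    and as |G : Q| >= 3 for odd p all these v_f vanish ([tcoef_layer_eq0]). For Q = 1
    there remain the coefficients at 1 x P; writing |G : P P'| as an average over G
    turns the left-hand side into a sum of squares ([sum_beta]), and the coefficient
    b at 1 x 1 satisfies (p - 1) p^(n-1) b^2 + 2 b <= 0. If p > 3 or n > 1 this forces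
    b = 0, and then all the others vanish. Applied to u^op as well, this shows that v
    is supported on relations whose two kernels both contain N, so 1 + v is inflated
    from an orthogonal unit of B(G/N, G/N) ([unipotent_infl]). Signed automorphisms
    are central, hence
      B_o(G) = {1, -1} x Aut G x B_o(G/N)          ([reduction])
    and the result for p > 3 follows by induction from B_o(1) = {1, -1}.

    For |G| = 3 also b = -1 is possible. It is realized by an involution, the
    reflection along the vector [G/1] - [G/G] of B(G, 1), which accounts for the
    extra factor C_2 ([reduction3]). For |G| = 2 the vectors [G/1] - [G/G] and [G/G]
    are orthonormal, and the matrix units that they define give an isomorphism of
    rings with involution between B(G, G) and Z x M_2(Z); the orthogonal units are
    {1, -1} x O_2(Z), and O_2(Z) is dihedral of order 8. *)

(** * Stabilizers and transitive bisets *)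
Section Transitive.
Local Open Scope group_scope.
Variables G H : finGroupType.
Implicit Types (X : biset G H) (L : {group G * H}).

Definition stab X (x : X) : {set G * H} :=
  [set gh | lact gh.1 x == ract x gh.2].

Lemma mulg_pair (u v : G * H) : u * v = (u.1 * v.1, u.2 * v.2).
Proof. by []. Qed.
Lemma invg_pair (u : G * H) : u^-1 = (u.1^-1, u.2^-1).
Proof. by []. Qed.

Lemma stabP X (x : X) gh : reflect (lact gh.1 x = ract x gh.2) (gh \in stab x).
Proof. by rewrite inE; apply: eqP. Qed.

Lemma stab_group_set X (x : X) : group_set (stab x).
Proof.
apply/group_setP; split=> [|u v /stabP ex /stabP ey]; apply/stabP.
  by rewrite lact1 ract1.
by rewrite lactM ey -lract ex -ractM.
Qed.
Canonical stab_group X (x : X) := Group (stab_group_set x).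

Section Cosets.
Variable L : {group G * H}.

Definition coset_carrier : finType := {A : {set G * H} | A \in lcosets L [set: G * H]}.

Lemma coset_act_in (u : G * H) (t : coset_carrier) : u *: val t \in lcosets L [set: G * H].
Proof.
have /lcosetsP[v _ ->] := valP t.
by apply/lcosetsP; exists (u * v); rewrite ?inE // lcosetM.
Qed.
Definition coset_act u (t : coset_carrier) : coset_carrier :=
  exist _ (u *: val t) (coset_act_in u t).

Lemma coset_act1 t : coset_act 1 t = t.
Proof. by apply: val_inj; rewrite /= mul1g. Qed.
Lemma coset_actM u v t : coset_act (u * v) t = coset_act u (coset_act v t).
Proof. by apply: val_inj; rewrite /= lcosetM. Qed.

Local Obligation Tactic := intros.
Program Definition coset_biset : biset G H :=
  @Biset G H coset_carrier (@BisetOn G H coset_carrier (fun g t => coset_act (g, 1) t)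
    (fun t h => coset_act (1, h^-1) t) _ _ _ _ _).
Next Obligation. exact: (coset_act1 x). Qed.
Next Obligation.
by rewrite /= -coset_actM; congr coset_act; congr (_, _); rewrite /= mul1g.
Qed.
Next Obligation. by rewrite /= invg1 coset_act1. Qed.
Next Obligation.
by rewrite /= -coset_actM invMg; congr coset_act; congr (_, _); rewrite /= mul1g.
Qed.
Next Obligation.
by rewrite /= -!coset_actM; congr coset_act; congr (_, _); rewrite /= ?mul1g ?mulg1.
Qed.

Lemma coset_point_in (u : G * H) : u *: L \in lcosets L [set: G * H].
Proof. by apply/lcosetsP; exists u; rewrite ?inE. Qed.
Definition coset_point u : coset_biset := exist _ (u *: L) (coset_point_in u).

Lemma coset_point_surj (t : coset_biset) : exists u, coset_point u = t.
Proof.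
have /lcosetsP[u _ e] := valP t.
by exists u; apply: val_inj.
Qed.

Lemma coset_point_eq u v : coset_point u = coset_point v <-> u^-1 * v \in L.
Proof.
have -> : (u^-1 * v \in L) = (v \in u *: L) by rewrite mem_lcoset.
split=> [/(congr1 val)/= ->|/lcoset_eqP e]; first exact: lcoset_refl.
by apply: val_inj.
Qed.

Lemma coset_point_lact g u : lact g (coset_point u) = coset_point (g * u.1, u.2).
Proof.
apply: val_inj; rewrite /= -lcosetM.
by rewrite mulg_pair /= mul1g.
Qed.

Lemma coset_point_ract u h : ract (coset_point u) h = coset_point (u.1, h^-1 * u.2).
Proof.
apply: val_inj; rewrite /= -lcosetM.
by rewrite mulg_pair /= mul1g.
Qed.

Lemma card_coset_biset : #|coset_biset| = #|[set: G * H] : L|.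
Proof. by rewrite card_sig -card_lcosets; apply: eq_card => A; rewrite inE. Qed.

End Cosets.

Section SubBiset.
Variables (X : biset G H) (S : {set X}).
Hypotheses (Sl : forall g x, x \in S -> lact g x \in S)
  (Sr : forall x h, x \in S -> ract x h \in S).
Local Obligation Tactic := intros.
Program Definition bsub : biset G H :=
  @Biset G H {x | x \in S} (@BisetOn G H {x | x \in S}
    (fun g x => exist _ (lact g (val x)) (Sl g (valP x)))
    (fun x h => exist _ (ract (val x) h) (Sr h (valP x))) _ _ _ _ _).
Next Obligation. by apply: val_inj; rewrite /= lact1. Qed.
Next Obligation. by apply: val_inj; rewrite /= lactM. Qed.
Next Obligation. by apply: val_inj; rewrite /= ract1. Qed.
Next Obligation. by apply: val_inj; rewrite /= ractM. Qed.
Next Obligation. by apply: val_inj; rewrite /= lract. Qed.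
End SubBiset.

(** The orbit of a point is the coset space of its stabilizer, and the complement of
    the orbit is again a biset. *)
Lemma biset_split X (x : X) :
  exists Y, biso X (bsum (coset_biset (stab_group x)) Y).
Proof.
pose mv (u : G * H) := lact u.1 (ract x u.2^-1).
pose S := ~: [set mv u | u : G * H].
have mvl g u : lact g (mv u) = mv (g * u.1, u.2) by rewrite /mv lactM.
have mvr u h : ract (mv u) h = mv (u.1, h^-1 * u.2).
  by rewrite /mv lract /= invMg invgK ractM.
have Sl g y : y \in S -> lact g y \in S.
  rewrite !inE; apply: contra => /imsetP[u _ e].
  by apply/imsetP; exists (g^-1 * u.1, u.2); rewrite // -mvl -e lactK.
have Sr y h : y \in S -> ract y h \in S.
  rewrite !inE; apply: contra => /imsetP[u _ e].
  by apply/imsetP; exists (u.1, h^-1^-1 * u.2); rewrite // -mvr -e ractK.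
exists (bsub Sl Sr); set Y := bsub Sl Sr; set T := coset_biset _.
apply: (@biso_surj _ _ ((G * H) + Y)%type
  (fun g t => match t with inl u => inl (g * u.1, u.2) | inr y => inr (lact g y) end)
  (fun t h => match t with inl u => inl (u.1, h^-1 * u.2) | inr y => inr (ract y h) end)
  X (bsum T Y)
  (fun t => match t with inl u => mv u | inr y => val (y : {x | x \in S}) end)
  (fun t => match t with inl u => inl (coset_point (stab_group x) u) | inr y => inr y end)).
- move=> y; case: (boolP (y \in S)) => [yS|].
    by exists (inr (exist _ y yS : Y)).
  by rewrite inE negbK => /imsetP[u _ ->]; exists (inl u).
- case=> [t|y]; last by exists (inr y).
  by have [u <-] := coset_point_surj t; exists (inl u).
- case=> [u|y] [v|z].
  + transitivity (coset_point (stab_group x) u = coset_point (stab_group x) v); last first.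
      by split=> [->|/(@inl_inj _ _ _ _)].
    rewrite coset_point_eq; split=> [e|/stabP /= e].
      have := congr1 (fun y => lact u.1^-1 (ract y v.2)) e.
      rewrite /mv !lract ractVK lactK => {}e.
      by apply/stabP; rewrite /= lactM ractM.
    have {}e : ract x u.2^-1 = lact u.1^-1 (mv v).
      by rewrite -lactM -lract e -ractM mulgK.
    by rewrite {1}/mv e lactVK.
  + split=> // e; have := valP (z : {x | x \in S}); rewrite -e inE.
    by rewrite imset_f.
  + split=> // e; have := valP (y : {x | x \in S}); rewrite e inE.
    by rewrite imset_f.
  + split; first by move=> /val_inj ->.
    by move=> /(@inr_inj _ _ _ _) ->.
- by move=> g [u|y]; rewrite ?mvl.
- by move=> [u|y] h; rewrite ?mvr.
- by move=> g [u|y] //; rewrite /lact /=; congr inl; rewrite -coset_point_lact.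
- by move=> [u|y] h //; rewrite /ract /=; congr inl; rewrite -coset_point_ract.
Qed.

End Transitive.

(** * The basis of transitive bisets *)
Lemma index_neq0 (gT : finGroupType) (A : {group gT}) :
  (#|[set: gT] : A|%g%:Z != 0)%R.
Proof. by rewrite -lt0n indexg_gt0. Qed.

Section Coefficients.
Local Open Scope group_scope.
Local Open Scope ring_scope.
Variables G H : finGroupType.
Implicit Types (X Y : biset G H) (L N : {group G * H}) (u v : burnside G H).

Definition nb_stab X (L : {set G * H}) : nat := #|[set x : X | stab x == L]|.

Lemma nb_stab_iso X Y L : biso X Y -> nb_stab X L = nb_stab Y L.
Proof.
case=> f [fb fl fr]; have [f' fK f'K] := fb.
rewrite /nb_stab -(card_imset _ (can_inj fK)); apply: eq_card => y.
rewrite -[y]f'K mem_imset ?inE; last exact: can_inj fK.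
congr (_ == _); apply/setP => gh; rewrite !inE -fl -fr.
by rewrite (inj_eq (can_inj fK)).
Qed.

Lemma nb_stab_sum X Y L : nb_stab (bsum X Y) L = (nb_stab X L + nb_stab Y L)%N.
Proof.
have e1 (x : X) : stab (inl x : bsum X Y) = stab x by apply/setP => gh; rewrite !inE.
have e2 (y : Y) : stab (inr y : bsum X Y) = stab y by apply/setP => gh; rewrite !inE.
rewrite /nb_stab -!sum1_card big_sumType /=.
by congr addn; apply: eq_bigl => z; rewrite !inE ?e1 ?e2.
Qed.

Definition cnt L u : int := glift (fun c => (nb_stab (cls_rep c) L)%:Z) u.

Let cnt_morph L :
  {morph (fun c : bclass G H => (nb_stab (cls_rep c) L)%:Z) : x y / x + y >-> x + y}.
Proof.
move=> x y; rewrite -PoszD -nb_stab_sum; congr Posz; apply: nb_stab_iso.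
by apply/cls_eq; rewrite -clsD !cls_repK.
Qed.

Lemma cnt_bcls L X : cnt L (bcls X) = (nb_stab X L)%:Z.
Proof.
rewrite /cnt (glift_class (cnt_morph L)); congr Posz; apply: nb_stab_iso.
exact: cls_rep_iso.
Qed.

Lemma cntB L : {morph cnt L : u v / u - v}.
Proof. exact: gliftB (cnt_morph L). Qed.

HB.instance Definition _ L :=
  GRing.isZmodMorphism.Build (burnside G H) int (cnt L) (cntB L).

Lemma bcls_empty X : #|X| = 0%N -> bcls X = 0.
Proof.
move=> X0; apply: (addrI (bcls X)); rewrite addr0 -bclsD; apply: bcls_iso.
have F (T : Type) (x : X) : T by have := card0_eq X0 x; rewrite inE.
exists (fun z : X + X => match z with inl x => x | inr x => x end); split.
- by exists inl => [[x|x]|x] //; apply: F x.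
- by move=> g [x|x]; apply: F x.
- by move=> [x|x]; apply: F x.
Qed.

(** The class of the coset space of L. *)
Definition tcls L : burnside G H := bcls (coset_biset L).

(** Split off one orbit at a time. *)
Lemma tcls_span u : exists a : {group G * H} -> int, u = \sum_L tcls L *~ a L.
Proof.
elim/burnside_ind: u => [X|u v [a ->] [b ->]]; last first.
  exists (fun L => a L - b L); rewrite -sumrB; apply: eq_bigr => L _.
  by rewrite mulrzBr.
have [m le_m] := ubnP #|X|; elim: m X le_m => // m IH X le_m.
have [X0|/card_gt0P[x _]] := posnP #|X|.
  by exists (fun=> 0); rewrite bcls_empty // big1.
have [Y XY] := biset_split x; rewrite (bcls_iso XY) bclsD.
have {}XY : #|X| = (#|coset_biset (stab_group x)| + #|Y|)%N.
  by have [f [fb _ _]] := XY; rewrite (bij_eq_card fb) card_sum.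
have [|a ->] := IH Y.
  move: le_m; rewrite XY card_coset_biset ltnS; apply: leq_trans.
  by rewrite -add1n leq_add2r indexg_gt0.
exists (fun L => (stab_group x == L)%:Z + a L).
under [RHS]eq_bigr do rewrite mulrzDr.
rewrite big_split /=; congr (_ + _).
rewrite (bigD1 (stab_group x)) //= eqxx mulr1z big1 ?addr0 // => L neq.
by rewrite eq_sym (negbTE neq).
Qed.

(** For abelian G and H the stabilizer is constant along an orbit, whose size is its
    index, so the division is exact: this is the number of orbits with stabilizer L. *)
Fact tcoef_key : unit. Proof. exact: tt. Qed.
Definition tcoef := locked_with tcoef_key
  (fun L u => (cnt L u %/ #|[set: G * H] : L|%:Z)%Z).
Lemma tcoef_def L u : tcoef L u = (cnt L u %/ #|[set: G * H] : L|%:Z)%Z.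
Proof. by rewrite /tcoef unlock. Qed.

Hypotheses (cG : commutative (@mulg G)) (cH : commutative (@mulg H)).

Lemma stab_coset_point L t : stab (coset_point L t) = L.
Proof.
apply/setP => -[g h]; rewrite inE coset_point_lact coset_point_ract -groupV.
rewrite (_ : ((g, h)^-1 = (g * t.1, t.2)^-1 * (t.1, h^-1 * t.2))%g).
  by apply/eqP/idP => /coset_point_eq.
by rewrite mulg_pair !invg_pair /= invMg (cG t.1^-1%g) mulgKV (cH h^-1%g) mulKg.
Qed.

Lemma stab_coset_biset L (x : coset_biset L) : stab x = L.
Proof. by have [t <-] := coset_point_surj x; apply: stab_coset_point. Qed.

Lemma cnt_tcls L N : cnt L (tcls N) = (#|[set: G * H] : L| * (L == N))%:Z.
Proof.
rewrite cnt_bcls /nb_stab; congr Posz.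
case: eqP => [->|neq]; rewrite ?muln1 ?muln0.
  by rewrite -card_coset_biset; apply: eq_card => x; rewrite !inE stab_coset_biset eqxx.
apply: eq_card0 => x; rewrite !inE stab_coset_biset; apply/eqP => e.
by case: neq; apply/val_inj.
Qed.

Lemma tcoef_sum_tcls N (a : {group G * H} -> int) :
  tcoef N (\sum_L tcls L *~ a L) = a N.
Proof.
rewrite tcoef_def raddf_sum /= (bigD1 N) //= big1 => [|L neq].
  by rewrite raddfMz /= cnt_tcls eqxx muln1 addr0 mulrzz mulKz ?index_neq0.
by rewrite raddfMz /= cnt_tcls eq_sym (negbTE neq) muln0 mul0rz.
Qed.

Lemma tcoefE u : u = \sum_L tcls L *~ tcoef L u.
Proof.
have [a ->] := tcls_span u.
by apply: eq_bigr => L _; rewrite tcoef_sum_tcls.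
Qed.

Lemma tcoefB L : {morph tcoef L : u v / u - v}.
Proof.
move=> u v; rewrite {1}[u]tcoefE {1}[v]tcoefE -sumrB.
under eq_bigr do rewrite -mulrzBr.
by rewrite tcoef_sum_tcls.
Qed.

Lemma tcoef0 L : tcoef L 0 = 0.
Proof. by rewrite -[X in tcoef _ X](subrr 0) tcoefB subrr. Qed.

Lemma tcoefN L u : tcoef L (- u) = - tcoef L u.
Proof. by rewrite -sub0r tcoefB tcoef0 sub0r. Qed.

Lemma tcoefD L : {morph tcoef L : u v / u + v}.
Proof. by move=> u v; rewrite -[v]opprK tcoefB tcoefN !opprK. Qed.

Lemma tcoef_tcls L N : tcoef L (tcls N) = (L == N)%:Z.
Proof.
rewrite (_ : tcls N = \sum_M tcls M *~ (M == N)%:Z) ?tcoef_sum_tcls //.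
by rewrite (bigD1 N) //= eqxx mulr1z big1 ?addr0 // => M /negbTE ->.
Qed.

Lemma tcoef_sumr L (I : finType) (F : I -> burnside G H) :
  tcoef L (\sum_i F i) = \sum_i tcoef L (F i).
Proof. by apply: (big_morph _ (tcoefD L) (tcoef0 L)). Qed.

Lemma tcoefMz L u (z : int) : tcoef L (u *~ z) = tcoef L u * z.
Proof.
rewrite {1}[u]tcoefE mulrz_suml; under eq_bigr do rewrite -mulrzA.
by rewrite tcoef_sum_tcls.
Qed.

Lemma tcoef_inj u v : (forall L, tcoef L u = tcoef L v) -> u = v.
Proof. by move=> e; rewrite [u]tcoefE [v]tcoefE; apply: eq_bigr => L _; rewrite e. Qed.

(** The tool for all explicit computations of classes: it suffices to find the common
    stabilizer of the points and to count them. *)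
Lemma bcls_uniform_stab X L m : (forall x : X, stab x = L) ->
  #|X| = (m * #|[set: G * H] : L|)%N -> bcls X = tcls L *+ m.
Proof.
move=> sX cX; apply: tcoef_inj => N; rewrite pmulrn tcoefMz tcoef_tcls.
rewrite tcoef_def cnt_bcls /nb_stab; case: eqP => [->|neq].
  have -> : #|[set x : X | stab x == L]| = #|X|.
    by apply: eq_card => x; rewrite !inE sX eqxx.
  by rewrite cX PoszM mulzK ?index_neq0 // mul1r.
rewrite mul0r eq_card0 ?div0z // => x.
rewrite !inE sX; apply/eqP => e.
by case: neq; apply/val_inj.
Qed.

End Coefficients.

(** * Composition of subgroups and the Mackey formula *)
Section Relations.
Local Open Scope group_scope.
Variables G H K : finGroupType.
Implicit Types (L : {group G * H}) (M : {group H * K}).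

Definition rcomp_set L M : {set G * K} :=
  [set u | [exists h, ((u.1, h) \in L) && ((h, u.2) \in M)]].
Lemma rcompP L M u :
  reflect (exists h, (u.1, h) \in L /\ (h, u.2) \in M) (u \in rcomp_set L M).
Proof.
rewrite inE; apply: (iffP existsP) => -[h].
  by case/andP; exists h.
by case=> uL uM; exists h; apply/andP.
Qed.
Lemma rcomp_group_set L M : group_set (rcomp_set L M).
Proof.
apply/group_setP; split=> [|u v]; first by apply/rcompP; exists 1; rewrite !group1.
case/rcompP=> h [uL uM] /rcompP[k [vL vM]]; apply/rcompP; exists (h * k).
by split; [apply: groupM uL vL | apply: groupM uM vM].
Qed.
Canonical rcomp L M := Group (rcomp_group_set L M).

Definition ropp_set L : {set H * G} := [set u | (u.2, u.1) \in L].
Lemma ropp_group_set L : group_set (ropp_set L).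
Proof.
apply/group_setP; split=> [|u v]; rewrite !inE; first exact: group1.
exact: groupM.
Qed.
Canonical ropp L := Group (ropp_group_set L).
Lemma mem_ropp L h g : ((h, g) \in ropp L) = ((g, h) \in L).
Proof. by rewrite inE. Qed.

Definition pr2_set L : {set H} := [set h | [exists g, (g, h) \in L]].
Lemma pr2P L h : reflect (exists g, (g, h) \in L) (h \in pr2_set L).
Proof. by rewrite inE; apply: existsP. Qed.
Lemma pr2_group_set L : group_set (pr2_set L).
Proof.
apply/group_setP; split=> [|u v]; first by apply/pr2P; exists 1; apply: group1.
by case/pr2P=> a aL /pr2P[b bL]; apply/pr2P; exists (a * b); apply: groupM aL bL.
Qed.
Canonical pr2 L := Group (pr2_group_set L).

Definition pr1_set L : {set G} := [set g | [exists h, (g, h) \in L]].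
Lemma pr1P L g : reflect (exists h, (g, h) \in L) (g \in pr1_set L).
Proof. by rewrite inE; apply: existsP. Qed.
Lemma pr1_group_set L : group_set (pr1_set L).
Proof.
apply/group_setP; split=> [|u v]; first by apply/pr1P; exists 1; apply: group1.
by case/pr1P=> a aL /pr1P[b bL]; apply/pr1P; exists (a * b); apply: groupM aL bL.
Qed.
Canonical pr1 L := Group (pr1_group_set L).

End Relations.

(** The orbits of the composite of [L] and [M] correspond to the cosets of this
    subgroup of the middle group. *)
Definition mid (G H K : finGroupType) (L : {group G * H}) (M : {group H * K}) :
  {group H} := (pr2 L <*> pr1 M)%G.

Section Mackey.
Local Open Scope group_scope.
Variables G H K : finGroupType.
Hypotheses (cG : commutative (@mulg G)) (cH : commutative (@mulg H))
  (cK : commutative (@mulg K)).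
Variables (L : {group G * H}) (M : {group H * K}).

Lemma midP h : reflect (exists l m, [/\ l \in pr2 L, m \in pr1 M & h = l * m])
  (h \in mid L M).
Proof.
rewrite /= comm_joingE; last first.
  apply/setP => x; apply/imset2P/imset2P => -[a b aP bP ->];
    by exists b a => //; rewrite cH.
apply: (iffP imset2P) => [[l m lL mM ->]|[l [m [lL mM ->]]]].
  by exists l, m.
by exists l m.
Qed.

Section Copies.
Variables (I : finType) (X : biset G K).
Local Obligation Tactic := intros.
Program Definition bcopies : biset G K :=
  @Biset G K (I * X)%type (@BisetOn G K (I * X)%type
    (fun g t => (t.1, lact g t.2)) (fun t h => (t.1, ract t.2 h)) _ _ _ _ _).
Next Obligation. by case: x => i x; rewrite /= lact1. Qed.
Next Obligation. by rewrite /= lactM. Qed.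
Next Obligation. by case: x => i x; rewrite /= ract1. Qed.
Next Obligation. by rewrite /= ractM. Qed.
Next Obligation. by rewrite /= lract. Qed.
End Copies.

(** Modulo the two actions, the class of ((a, b) L, (c, d) M) only depends on b^-1 c
    modulo [mid L M], whence one copy of the coset space of the composite relation
    for each coset. *)
Lemma tensor_biso :
  biso (btensor (coset_biset L) (coset_biset M))
    (bcopies (coset_of (mid L M)) (coset_biset (rcomp L M))).
Proof.
set R := mid L M; set X := btensor _ _; set Y := bcopies _ _.
have nR h : h \in 'N(R).
  by apply/normP/setP => x; rewrite mem_conjg conjgE invgK (cH x) mulKVg.
have cosetR (h k : H) : coset R h = coset R k <-> h^-1 * k \in R.
  split=> e; last by rewrite -(coset_kerr h e) mulKVg.
  apply: coset_idr; first exact: nR.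
  by rewrite morphM ?morphV ?nR // (_ : coset_morphism R k = coset R h) ?mulVg.
have tens (a a' : G) (b b' c c' : H) (d d' : K) :
  tpair (coset_point L (a, b)) (coset_point M (c, d)) =
  tpair (coset_point L (a', b')) (coset_point M (c', d'))
    :> X <->
  exists h, (a'^-1 * a, b'^-1 * (h * b)) \in L /\ (c'^-1 * (h * c), d'^-1 * d) \in M.
  rewrite (btensor_eqE (coset_biset L) (coset_biset M)); split=> -[h [e1 e2]]; exists h.
    move: e1 e2; rewrite coset_point_ract coset_point_lact invgK.
    move=> /coset_point_eq e1 /coset_point_eq e2.
    by split.
  by rewrite coset_point_ract coset_point_lact invgK; split; apply/coset_point_eq.
apply: (@biso_surj _ _ (coset_of R * (G * K))
  (fun g t => (t.1, (g * t.2.1, t.2.2))) (fun t k => (t.1, (t.2.1, k^-1 * t.2.2))) X Y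
  (fun t => tpair (coset_point L (t.2.1, 1)) (coset_point M (repr t.1, t.2.2)))
  (fun t => (t.1, coset_point (rcomp L M) t.2))).
- move=> t; have [[x y] <-] := tpair_surj t.
  have [[a b] <-] := coset_point_surj x; have [[c d] <-] := coset_point_surj y.
  pose i := coset R (b^-1 * c).
  have /cosetR/midP[l2 [m1 [/pr2P[l1 lL] /pr1P[m2 mM] e]]] :
    coset R (b^-1 * c) = coset R (repr i) by rewrite coset_reprK.
  exists (i, (a * l1^-1, d * m2)); apply/tens; exists (b * l2^-1); split.
    by rewrite !mulKg mulg1 mulKg; move: lL; rewrite -groupV.
  rewrite mulKg /= (cH b) -(mulgA l2^-1) (cH c^-1) -mulgA (cH _ c^-1).
  by move: e; rewrite invMg invgK -!mulgA => ->; rewrite mulKg.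
- case=> i t; have [u <-] := coset_point_surj t.
  by exists (i, u).
- case=> i [g k] [i' [g' k']] /=; rewrite tens; split.
    case=> h [hL hM].
    have ii' : i = i'.
      rewrite -[i]coset_reprK -[i']coset_reprK; apply/esym/cosetR/midP.
      exists h^-1, ((repr i')^-1 * (h * repr i)); split.
      - by rewrite groupV; apply/pr2P; exists (g'^-1 * g); rewrite invg1 mul1g mulg1 in hL.
      - by apply/pr1P; exists (k'^-1 * k).
      by rewrite mulgA (cH h^-1) -!mulgA mulKg.
    subst i'; congr (_, _); apply/esym/coset_point_eq/rcompP; exists h.
    split; first by rewrite invg1 mul1g mulg1 in hL.
    by rewrite (cH h) mulKg in hM.
  move=> e; have /esym/coset_point_eq/rcompP[h [hL hM]] := congr1 snd e.
  have /= <- := congr1 fst e; exists h; split; first by rewrite invg1 mul1g mulg1.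
  by rewrite (cH h) mulKg.
- by move=> g [i [g' k]]; rewrite btensor_lact coset_point_lact.
- by move=> [i [g' k]] h; rewrite btensor_ract coset_point_ract.
- by move=> g [i u]; rewrite /lact /=; congr (_, _); rewrite -coset_point_lact.
- by move=> [i u] h; rewrite /ract /=; congr (_, _); rewrite -coset_point_ract.
Qed.

Theorem bcomp_tcls :
  bcomp (tcls L) (tcls M) = (tcls (rcomp L M) *+ #|[set: H] : mid L M|)%R.
Proof.
rewrite bcomp_cls (bcls_iso tensor_biso).
apply: (bcls_uniform_stab cG cK) => [[i x]|].
  by rewrite -(stab_coset_biset cG cK x); apply/setP => u; rewrite !inE -pair_eqE /= eqxx.
rewrite card_prod card_coset_biset; congr muln.
rewrite -cardsT -quotientT card_quotient //; apply/subsetP => h _.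
by apply/normP/setP => x; rewrite mem_conjg conjgE invgK (cH x) mulKVg.
Qed.
End Mackey.

Lemma roppK (G H : finGroupType) (L : {group G * H}) : ropp (ropp L) = L.
Proof. by apply/val_inj/setP => -[g h]; rewrite !mem_ropp. Qed.

Lemma card_ropp (G H : finGroupType) (L : {group G * H}) : #|ropp L| = #|L|.
Proof.
pose swap (t : G * H) := (t.2, t.1).
rewrite -(card_imset L (can_inj (_ : cancel swap (fun t => (t.2, t.1))))); last by case.
apply: eq_card => -[h g]; rewrite mem_ropp.
by apply/idP/imsetP => [gh|[[g' h'] gh [-> ->]]] //; exists (g, h).
Qed.

Lemma mem_stab_bopp (G H : finGroupType) (X : biset G H) (x : X) g h :
  ((h, g) \in stab (x : bopp X)) = ((g, h) \in stab x).
Proof.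
apply/stabP/stabP => [|/= e].
  change (ract x h^-1 = lact g^-1 x -> lact g x = ract x h) => e.
  by rewrite -[in RHS](lactVK g x) lract -e ractVK.
change (ract x h^-1 = lact g^-1 x).
by rewrite -[in LHS](lactK g x) lract e ractK.
Qed.

Lemma bop_tcls (G H : finGroupType) (cG : commutative (@mulg G))
    (cH : commutative (@mulg H)) (L : {group G * H}) :
  bop (tcls L) = tcls (ropp L).
Proof.
rewrite bop_cls -[RHS]mulr1n; apply: bcls_uniform_stab => // [x|].
  by apply/setP => -[h g]; rewrite mem_stab_bopp (stab_coset_biset cG cH) mem_ropp.
rewrite mul1n (_ : #|bopp (coset_biset L)| = #|coset_biset L|) // card_coset_biset.
by rewrite -!divgS ?subsetT // !cardsT !card_prod mulnC card_ropp.
Qed.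

(** * Coefficients of a product *)
Section Additivity.
Variables G H K : finGroupType.

HB.instance Definition _ (u : burnside G H) :=
  GRing.isZmodMorphism.Build (burnside H K) (burnside G K) (bcomp u)
    (fun v w => bcompBr u v w).

Definition bcompr (v : burnside H K) (u : burnside G H) := bcomp u v.
HB.instance Definition _ (v : burnside H K) :=
  GRing.isZmodMorphism.Build (burnside G H) (burnside G K) (bcompr v)
    (fun u w => bcompBl u w v).

HB.instance Definition _ :=
  GRing.isZmodMorphism.Build (burnside G H) (burnside H G) (@bop G H) (@bopB G H).
End Additivity.

Section Product.
Local Open Scope group_scope.
Local Open Scope ring_scope.
Variables G H K : finGroupType.
Hypotheses (cG : commutative (@mulg G)) (cH : commutative (@mulg H))
  (cK : commutative (@mulg K)).

Lemma bcomp_sum (I J : finType) (F : I -> burnside G H) (E : J -> burnside H K) :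
  bcomp (\sum_i F i) (\sum_j E j) = \sum_i \sum_j bcomp (F i) (E j).
Proof.
rewrite [LHS](raddf_sum (bcompr (\sum_j E j))); apply: eq_bigr => i _.
exact: (raddf_sum (bcomp (F i))).
Qed.

Lemma bcompMz (u : burnside G H) (v : burnside H K) (y z : int) :
  bcomp (u *~ y) (v *~ z) = bcomp u v *~ (y * z).
Proof.
transitivity (bcomp u (v *~ z) *~ y); first exact: (raddfMz (bcompr (v *~ z))).
rewrite (_ : bcomp u (v *~ z) = bcomp u v *~ z); last exact: (raddfMz (bcomp u)).
by rewrite mulrC mulrzA.
Qed.

Lemma tcoef_bcomp N (u : burnside G H) (v : burnside H K) :
  tcoef N (bcomp u v) = \sum_L \sum_M tcoef L u * tcoef M v *
     (#|[set: H] : mid L M|%:Z * (rcomp L M == N)%:Z).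
Proof.
rewrite {1}(tcoefE cG cH u) {1}(tcoefE cH cK v) bcomp_sum tcoef_sumr //.
apply: eq_bigr => L _; rewrite tcoef_sumr //; apply: eq_bigr => M _.
rewrite bcompMz bcomp_tcls // pmulrn -mulrzA tcoefMz // tcoef_tcls // eq_sym.
by rewrite mulrC [X in X * _]mulrC -mulrA.
Qed.

Lemma bopMz (u : burnside G H) (z : int) : bop (u *~ z) = bop u *~ z.
Proof. exact: (raddfMz (@bop G H)). Qed.

Lemma bop_sum (I : finType) (F : I -> burnside G H) :
  bop (\sum_i F i) = \sum_i bop (F i).
Proof. exact: (raddf_sum (@bop G H)). Qed.

Lemma tcoef_bop N (u : burnside G H) : tcoef N (bop u) = tcoef (ropp N) u.
Proof.
have -> : bop u = \sum_L tcls L *~ tcoef (ropp L) u.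
  rewrite [u in LHS](tcoefE cG cH u) bop_sum.
  rewrite (reindex_onto (@ropp H G) (@ropp G H)) => [|L _]; last exact: roppK.
  by apply: eq_big => [L|L _]; rewrite ?roppK ?eqxx // bopMz (bop_tcls cG cH) roppK.
by rewrite (tcoef_sum_tcls cH cG).
Qed.

End Product.

Section Ring.
Local Open Scope group_scope.
Variable G : finGroupType.
Hypothesis (cG : commutative (@mulg G)).
Implicit Types (L M : {group G * G}) (Q P : {group G}).

(** The left kernel of L is trivial: L is the inverse graph of a homomorphism from
    [pr2 L] to G. *)
Definition injl L := [forall g, ((g, 1) \in L) ==> (g == 1)].
Lemma injlP L : reflect (forall g, (g, 1) \in L -> g = 1) (injl L).
Proof.
apply: (iffP forallP) => inj g; first by have /implyP i := inj g; move/i/eqP.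
by apply/implyP => /inj ->.
Qed.
Lemma injl_eq L g g' h : injl L -> (g, h) \in L -> (g', h) \in L -> g = g'.
Proof.
move=> /injlP inj gL g'L; apply/eqP; rewrite eq_mulgV1; apply/eqP/inj.
by have := groupM gL (groupVr g'L); rewrite mulg_pair invg_pair /= mulgV.
Qed.

Definition rdiag_set Q := [set u : G * G | (u.1 == u.2) && (u.1 \in Q)].
Lemma rdiag_group_set Q : group_set (rdiag_set Q).
Proof.
apply/group_setP; split=> [|u v]; rewrite !inE /=; first by rewrite eqxx group1.
by case/andP=> /eqP <- uQ /andP[/eqP <- vQ]; rewrite eqxx groupM.
Qed.
Canonical rdiag Q := Group (rdiag_group_set Q).
Lemma rdiagP Q g h : reflect (g = h /\ g \in Q) ((g, h) \in rdiag Q).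
Proof. by rewrite inE /=; apply: (iffP andP) => -[/eqP]. Qed.

Lemma rdiag_inj Q P : rdiag Q = rdiag P -> Q = P.
Proof.
move=> e; apply/val_inj/setP => g.
by have /setP/(_ (g, g)) := congr1 val e; rewrite /= !inE eqxx.
Qed.
Lemma pr1_rdiag Q : pr1 (rdiag Q) = Q.
Proof.
apply/val_inj/setP => g; apply/pr1P/idP => [[h /rdiagP[]]|gQ] //.
by exists g; apply/rdiagP.
Qed.
Lemma pr2_rdiag Q : pr2 (rdiag Q) = Q.
Proof.
apply/val_inj/setP => g; apply/pr2P/idP => [[h /rdiagP[->]]|gQ] //.
by exists g; apply/rdiagP.
Qed.
Lemma ropp_rdiag Q : ropp (rdiag Q) = rdiag Q.
Proof.
apply/val_inj/setP => -[g h]; rewrite mem_ropp.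
by apply/rdiagP/rdiagP => -[->].
Qed.
Lemma injl_rdiag Q : injl (rdiag Q).
Proof. by apply/injlP => g /rdiagP[]. Qed.

Lemma db1E : (1%R : double_burnside G) = tcls (rdiag [set: G]).
Proof.
rewrite -[RHS]mulr1n; apply: (@bcls_uniform_stab _ _ cG cG) => [x|].
  apply/setP => -[g h]; rewrite !inE andbT /= /lact /ract /=.
  by rewrite (cG g) (inj_eq (mulgI _)).
rewrite mul1n -divgS ?subsetT // cardsT card_prod.
have -> : #|rdiag [set: G]| = #|G|.
  have inj : injective (fun g : G => (g, g)) by move=> ? ? [].
  rewrite -cardsT -(card_imset _ inj); apply: eq_card => -[g h].
  apply/rdiagP/imsetP => [[-> _]|[k _ [-> ->]]]; last by rewrite inE.
  by exists h.
by rewrite mulnK // -cardsT cardG_gt0.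
Qed.

Lemma tcoef1 L : tcoef L (1%R : double_burnside G) = ((L == rdiag [set: G])%:Z)%R.
Proof. by rewrite db1E tcoef_tcls. Qed.

(** On the smaller domain the two homomorphisms agree. *)
Lemma rcomp_diag_sub L M Q : rcomp L (ropp M) = rdiag Q -> pr2 L \subset pr2 M ->
  L \subset M.
Proof.
move=> e /subsetP sLM; apply/subsetP => -[g h] gL.
have /sLM/pr2P[g' g'M] : h \in pr2 L by apply/pr2P; exists g.
have : (g, g') \in rcomp L (ropp M).
  by apply/rcompP; exists h; rewrite mem_ropp.
by rewrite e => /rdiagP[-> _].
Qed.

(** The left kernels of L and of M are contained in the two kernels of the
    composite, which are trivial for a diagonal. *)
Lemma rcomp_diag_injl L M Q : rcomp L (ropp M) = rdiag Q ->
  [/\ injl L, injl M, Q \subset pr1 L & Q \subset pr1 M].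
Proof.
move=> e.
have QP g : g \in Q -> exists h, (g, h) \in L /\ (g, h) \in M.
  move=> gQ; have : (g, g) \in rdiag Q by apply/rdiagP.
  by rewrite -e => /rcompP[h []] /=; rewrite mem_ropp; exists h.
split.
- apply/injlP => g gL; have : (g, 1) \in rcomp L (ropp M).
    by apply/rcompP; exists 1; rewrite mem_ropp group1.
  by rewrite e => /rdiagP[].
- apply/injlP => g gL; have : (1, g) \in rcomp L (ropp M).
    by apply/rcompP; exists 1; rewrite mem_ropp group1.
  by rewrite e => /rdiagP[].
- by apply/subsetP => g /QP[h [? _]]; apply/pr1P; exists h.
- by apply/subsetP => g /QP[h [_ ?]]; apply/pr1P; exists h.
Qed.

Lemma rcomp_self L : injl L -> rcomp L (ropp L) = rdiag (pr1 L).
Proof.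
move=> inj; apply/val_inj/setP => -[g h]; apply/rcompP/rdiagP => /=.
  case=> k [gL]; rewrite mem_ropp => hL; have e := injl_eq inj gL hL.
  by split=> //; apply/pr1P; exists k.
by case=> <- /pr1P[k gk]; exists k; rewrite mem_ropp.
Qed.

Lemma card_injl L : injl L -> #|L| = #|pr2 L|.
Proof.
move=> inj; rewrite -(card_in_imset (f := @snd G G) (D := mem L)).
  apply: eq_card => h; apply/imsetP/pr2P => [[[g k] gk ->]|[g gh]].
    by exists g.
  by exists (g, h).
by move=> [g h] [g' h'] gL g'L /= e; rewrite -e in g'L *; rewrite (injl_eq inj gL g'L).
Qed.

Lemma pr2_full L : injl L -> pr1 L = [set: G]%G -> pr2 L = [set: G]%G.
Proof.
move=> inj p1; apply/val_inj/eqP; rewrite /= eqEcard subsetT /=.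
rewrite -(card_injl inj) cardsT.
have : #|[set: G]%G| = #|[set u.1 | u in L]|.
  rewrite -p1; apply: eq_card => g; apply/pr1P/imsetP => [[h gh]|[[g' h] gh ->]].
    by exists (g, h).
  by exists h.
by rewrite /= cardsT => ->; apply: leq_imset_card.
Qed.

Lemma rcomp_diag_full L M : rcomp L (ropp M) = rdiag [set: G] -> L = M.
Proof.
move=> e; have [iL iM sL sM] := rcomp_diag_injl e.
have pT (A : {group G}) : [set: G] \subset A -> A = [set: G]%G.
  by move=> sA; apply/val_inj/eqP; rewrite eqEsubset subsetT sA.
have pL := pr2_full iL (pT _ sL); have pM := pr2_full iM (pT _ sM).
apply/val_inj/eqP; rewrite eqEcard (rcomp_diag_sub e) ?pL ?pM //=.
by rewrite !card_injl // pL pM.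
Qed.

Local Open Scope ring_scope.
Lemma tcoef_mul_op N (u v : double_burnside G) :
  tcoef N (u * dbop v) = \sum_L \sum_M tcoef L u * tcoef M v *
    (#|[set: G] : pr2 L <*> pr2 M|%:Z * (rcomp L (ropp M) == N)%:Z).
Proof.
rewrite [LHS](tcoef_bcomp cG cG cG); apply: eq_bigr => L _.
rewrite [LHS](reindex_onto (@ropp G G) (@ropp G G)) => [|M _]; last exact: roppK.
apply: eq_big => [M|M _]; first by rewrite roppK eqxx.
rewrite (tcoef_bop cG cG) roppK; congr (_ * (_ * _)); congr (#|_ : _|%:Z).
rewrite /mid; congr (_ <*> _); apply/setP => h.
by apply/pr1P/pr2P => -[g gM]; exists g; [rewrite -mem_ropp|rewrite mem_ropp].
Qed.

Lemma sum_sqr1 (I : finType) (F : I -> int) : \sum_i F i ^+ 2 = 1 ->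
  exists2 i, F i ^+ 2 = 1 & forall j, j != i -> F j = 0.
Proof.
move=> s1; have [i Fi] : exists i, F i != 0.
  apply/existsP; apply: contraPT s1; rewrite negb_exists => /forallP F0.
  by rewrite big1 // => i _; have := F0 i; rewrite negbK => /eqP ->.
have ge0 j : 0 <= F j ^+ 2 by apply: sqr_ge0.
have Fi1 : 1 <= F i ^+ 2 by rewrite -gtz0_ge1 lt_def ge0 sqrf_eq0 Fi.
move: s1; rewrite (bigD1 i) //= => s1.
have r0 : 0 <= \sum_(j | j != i) F j ^+ 2 by apply: sumr_ge0 => j _.
have r1 : \sum_(j | j != i) F j ^+ 2 = 0.
  apply/eqP; rewrite eq_le r0 andbT -(lerD2l (F i ^+ 2)) s1 addr0.
  exact: Fi1.
exists i; first by rewrite -s1 r1 addr0.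
move=> j ji; apply/eqP; rewrite -sqrf_eq0; apply/eqP.
exact: (psumr_eq0P _ r1).
Qed.

End Ring.

(** * Graphs of automorphisms *)
Section Graphs.
Local Open Scope group_scope.
Variable G : finGroupType.
Hypothesis (cG : commutative (@mulg G)).
Implicit Types (L M : {group G * G}) (Q P : {group G}) (f : {perm G}).

(** Generated, so as to be a group for any f; [autgraphP] describes it when f is an
    automorphism. *)
Definition autgraph f := <<[set (g, f g) | g : G]>>%G.

Lemma AutM f x y : f \in Aut [set: G] -> f (x * y) = f x * f y.
Proof. by move/Aut_morphic/morphicP; apply; rewrite inE. Qed.

Lemma autgraphP f g h : f \in Aut [set: G] -> reflect (h = f g) ((g, h) \in autgraph f).
Proof.
move=> fA; suff gP : group_set [set (g, f g) | g : G].
  rewrite /autgraph /= -[[set _ | _ in _]]/(gval (Group gP)) genGid.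
  by apply: (iffP imsetP) => [[k _ [-> ->]]|->] //; exists g.
apply/group_setP; split=> [|_ _ /imsetP[x _ ->] /imsetP[y _ ->]].
  apply/imsetP; exists 1 => //; congr (_, _); apply: (mulgI (f 1)).
  by rewrite -AutM // !mulg1.
by apply/imsetP; exists (x * y) => //; rewrite mulg_pair AutM.
Qed.

(** By [fullE] these are exactly the graphs of the automorphisms of G. *)
Definition full L := injl L && (pr1 L == [set: G]%G).
Lemma fullP L : reflect (injl L /\ pr1 L = [set: G]%G) (full L).
Proof. by apply: (iffP andP) => -[i /eqP]. Qed.

Lemma full_autgraph f : f \in Aut [set: G] -> full (autgraph f).
Proof.
move=> fA; apply/fullP; split.
  apply/injlP => g /(autgraphP _ _ fA) e; apply: (@perm_inj _ f); rewrite -e.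
  by apply: (mulgI (f 1)); rewrite -AutM // !mulg1.
apply/val_inj/setP => g; rewrite [RHS]inE; apply/pr1P; exists (f g).
exact/autgraphP.
Qed.

Lemma fullE L : full L -> exists2 f, f \in Aut [set: G] & L = autgraph f.
Proof.
case/fullP=> iL p1L; have p2L := pr2_full iL p1L.
have inj' g h h' : (g, h) \in L -> (g, h') \in L -> h = h'.
  suff inj : {in L &, injective (@fst G G)}.
    by move=> gh gh'; have [] := inj _ _ gh gh' erefl.
  apply/imset_injP; rewrite card_injl // p2L eqn_leq; apply/andP; split.
    by rewrite subset_leq_card ?subsetT.
  rewrite -p1L; apply/subset_leq_card/subsetP => x /pr1P[y xy].
  by apply/imsetP; exists (x, y).
have tot g : exists h, (g, h) \in L by apply/pr1P; have : g \in pr1 L by rewrite p1L inE.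
pose f g := xchoose (tot g); have fP g : (g, f g) \in L := xchooseP (tot g).
have f_inj : injective f.
  by move=> x y e; apply: (injl_eq iL (fP x)); rewrite e.
have fA : perm f_inj \in Aut [set: G].
  rewrite inE; apply/andP; split; first by apply/subsetP => x; rewrite inE.
  apply/morphicP => x y _ _; rewrite !permE; apply: inj' (fP (x * y)) _.
  exact: (groupM (fP x) (fP y)).
exists (perm f_inj) => //; apply/val_inj/setP => -[g h].
apply/idP/autgraphP => // [gh|->]; rewrite permE //.
exact: inj' gh (fP g).
Qed.

Lemma autgraph_inj f f' : f \in Aut [set: G] -> f' \in Aut [set: G] ->
  autgraph f = autgraph f' -> f = f'.
Proof.
move=> fA fA' e; apply/permP => x; apply/(autgraphP _ _ fA'); rewrite -e.
exact/autgraphP.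
Qed.

Lemma autgraph1 : autgraph 1 = rdiag [set: G].
Proof.
apply/val_inj/setP => -[g h]; apply/(autgraphP _ _ (group1 _))/rdiagP.
  by rewrite perm1 inE.
by case=> -> _; rewrite perm1.
Qed.

Lemma rcomp_autgraph f f' : f \in Aut [set: G] -> f' \in Aut [set: G] ->
  rcomp (autgraph f) (autgraph f') = autgraph (f * f').
Proof.
move=> fA fA'; apply/val_inj/setP => -[g h].
apply/rcompP/(autgraphP _ _ (groupM fA fA')); rewrite permM => /=.
  by case=> k [/(autgraphP _ _ fA) -> /(autgraphP _ _ fA')].
by move=> ->; exists (f g); split; apply/autgraphP.
Qed.

Lemma ropp_autgraph f : f \in Aut [set: G] -> ropp (autgraph f) = autgraph f^-1.
Proof.
move=> fA; apply/val_inj/setP => -[g h]; rewrite mem_ropp.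
apply/(autgraphP _ _ fA)/(autgraphP _ _ (groupVr fA)) => ->; by rewrite ?permK ?permKV.
Qed.

Local Open Scope ring_scope.

Lemma tcls_autgraphM f f' : f \in Aut [set: G] -> f' \in Aut [set: G] ->
  (tcls (autgraph f) : double_burnside G) * tcls (autgraph f') = tcls (autgraph (f * f')%g).
Proof.
move=> fA fA'; rewrite -rcomp_autgraph //.
rewrite [LHS](bcomp_tcls cG cG cG) (_ : #|_ : _| = 1%N) ?mulr1n //.
have /fullP[i p] := full_autgraph fA.
by rewrite /mid pr2_full //; apply/eqP; rewrite indexg_eq1 joing_subl.
Qed.

Lemma dbop_tcls L : dbop (tcls L) = tcls (ropp L).
Proof. exact: bop_tcls. Qed.

(** A product of L with the inverse of M is the diagonal of G only if L = M is the
    graph of an automorphism. *)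
Lemma tcoef_diag_op (u v : double_burnside G) :
  tcoef (rdiag [set: G]) (u * dbop v) = \sum_(L | full L) tcoef L u * tcoef L v.
Proof.
rewrite tcoef_mul_op // [RHS]big_mkcond; apply: eq_bigr => L _.
rewrite (bigD1 L) //= big1 ?addr0 => [|M neq]; last first.
  case: eqP => [/rcomp_diag_full e|_]; first by rewrite e eqxx in neq.
  by rewrite !mulr0.
case: ifPn => [/fullP[i p]|nf].
  rewrite rcomp_self // p eqxx joingE setUid genGid (pr2_full i p) /=.
  by rewrite indexgg mulr1.
case: eqP => [e|_]; last by rewrite !mulr0.
have [i _ s _] := rcomp_diag_injl e.
case/negP: nf; apply/fullP; split=> //.
by apply/val_inj/eqP; rewrite eqEsubset subsetT s.
Qed.

Lemma tcoef_orth_full (u : double_burnside G) : u * dbop u = 1 ->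
  exists L, [/\ full L, tcoef L u ^+ 2 = 1 &
    forall M, full M -> M != L -> tcoef M u = 0].
Proof.
move=> u1; pose F L := if full L then tcoef L u else 0.
have /sum_sqr1[L FL FM] : \sum_L F L ^+ 2 = 1.
  transitivity (tcoef (rdiag [set: G]) (1 : double_burnside G)); last first.
    by rewrite tcoef1 // eqxx.
  rewrite -u1 tcoef_diag_op [RHS]big_mkcond; apply: eq_bigr => L _.
  by rewrite /F; case: ifP => _; rewrite ?expr2 ?mul0r.
have fL : full L by move: FL; rewrite /F; case: ifP => // _ /eqP; rewrite expr0n.
exists L; split=> //; first by move: FL; rewrite /F fL.
by move=> M fM /FM; rewrite /F fM.
Qed.

End Graphs.

(** * The faithful coefficients of an orthogonal unit *)
Lemma cyclic_mulgC (G : finGroupType) : cyclic [set: G] -> commutative (@mulg G).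
Proof. by move/cyclic_abelian/centsP => c x y; apply: c; rewrite inE. Qed.

Lemma quad_le0 (k a : int) : (3 <= k -> k * (a * a) + 2 * a <= 0 -> a = 0)%R.
Proof. nia. Qed.

(** Here G has order (k + 1) m with k + 1 = p, and s stands for the part of the sum of
    squares coming from the elements of order p; s is eliminated by completing the
    square. *)
Lemma beta_ineq (k m : nat) (b s : int) : (0 < m)%N ->
  (((k.+1 * m)%N%:Z * b + s) ^+ 2 + s ^+ 2 * k%:Z + 2 * (k.+1 * m)%N%:Z * b <= 0 ->
   (k * m)%N%:Z * (b * b) + 2 * b <= 0)%R.
Proof.
rewrite !PoszM -[k.+1]addn1 PoszD; set x : int := k; set y : int := m => m0 le0.
have y0 : (0 < y)%R by [].
have x0 : (0 < x + 1)%R by rewrite ltr_pwDr // /x.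
rewrite -(pmulr_rle0 _ (mulr_gt0 (mulr_gt0 x0 x0) y0)).
have := sqr_ge0 ((x + 1) * y * b + (x + 1) * s)%R.
rewrite -(pmulr_rle0 _ x0) in le0; move: le0; set A := (X in (X <= 0)%R).
set B := (X in (0 <= X)%R); set C := (X in _ -> _ -> (X <= 0)%R).
have -> : (A = B + C)%R by rewrite /A /B /C; ring.
by move=> h1 h2; apply: le_trans h1; rewrite lerDr.
Qed.

Section CyclicPGroup.
Local Open Scope group_scope.
Variables (p : nat) (G : finGroupType).
Hypotheses (p_prime : prime p) (cycG : cyclic [set: G]) (pG : p.-group [set: G]).
Implicit Types (L M : {group G * G}) (Q P A B : {group G}).
Let cG := cyclic_mulgC cycG.

Lemma subgroup_chain A B : (A \subset B) || (B \subset A).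
Proof.
rewrite -(cardSg_cyclic cycG (subsetT A) (subsetT B)).
rewrite -(cardSg_cyclic cycG (subsetT B) (subsetT A)).
have [a ->] := p_natP (pgroupS (subsetT A) pG).
have [b ->] := p_natP (pgroupS (subsetT B) pG).
by have [ab|/ltnW ba] := leqP a b; rewrite ?(dvdn_exp2l _ ab) ?(dvdn_exp2l _ ba) ?orbT.
Qed.

Lemma ker2_group_set M : group_set [set h | (1, h) \in M].
Proof.
apply/group_setP; split=> [|x y]; rewrite !inE; first exact: group1.
by move=> xM yM; have := groupM xM yM; rewrite mulg_pair /= mulg1.
Qed.

(** Two homomorphisms that agree on the smaller of their domains, and map both the
    smaller and the larger domain onto the nontrivial Q, have the same domain: as the
    subgroups form a chain, the kernel of the one with the larger domain is
    contained in the smaller domain. *)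
Lemma rcomp_diag_eq_pr1 L M Q : Q != 1%G -> rcomp L (ropp M) = rdiag Q ->
  pr1 L = Q -> pr1 M = Q -> L = M.
Proof.
move=> Q1.
wlog sLM : L M / pr2 L \subset pr2 M => [wl|] e pL pM.
  have [s|s] := orP (subgroup_chain (pr2 L) (pr2 M)); first exact: wl.
  apply/esym/wl => //; rewrite -ropp_rdiag -e.
  apply/val_inj/setP => -[g h]; rewrite mem_ropp.
  by apply/rcompP/rcompP => -[k []] /=; rewrite !mem_ropp => ? ?; exists k; rewrite mem_ropp.
have /subsetP sL := rcomp_diag_sub e sLM.
have [iL iM _ _] := rcomp_diag_injl e.
pose K := Group (ker2_group_set M).
have [/subsetP s|/subsetP s] := orP (subgroup_chain (pr2 L) K).
  case/negP: Q1; rewrite -pL; apply/eqP/val_inj/trivgP/subsetP => g /pr1P[h gh].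
  have : h \in K by apply: s; apply/pr2P; exists g.
  by rewrite !inE => h1; rewrite (injl_eq iM (sL _ gh) h1).
apply/val_inj/eqP; rewrite eqEsubset; apply/andP; split; apply/subsetP => -[g h] gh.
  exact: sL.
have : g \in pr1 L by rewrite pL -pM; apply/pr1P; exists h.
case/pr1P=> h' gh'.
have hL : h \in pr2 L.
  rewrite -(mulKVg h' h) groupM //; first by apply/pr2P; exists g.
  apply: s; rewrite inE; have := groupM (groupVr (sL _ gh')) gh.
  by rewrite mulg_pair invg_pair /= mulVg.
by have /pr2P[g' g'h] := hL; rewrite (injl_eq iM gh (sL _ g'h)).
Qed.

Local Open Scope ring_scope.
Variable v : double_burnside G.
Hypothesis v_orth : v * dbop v + v + dbop v = 0.

Lemma tcoef_orth_diag Q :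
  tcoef (rdiag Q) (v * dbop v) + 2 * tcoef (rdiag Q) v = 0.
Proof.
have := congr1 (tcoef (rdiag Q)) v_orth; rewrite tcoef0 // !tcoefD //.
by rewrite (tcoef_bop cG cG) ropp_rdiag mulr_natl mulr2n addrA.
Qed.

(** The hypothesis leaves only relations with first projection Q, and for those
    [rcomp_diag_eq_pr1] kills the mixed terms. *)
Lemma tcoef_diag_layer Q : Q != 1%G ->
  (forall L, injl L -> Q \proper pr1 L -> tcoef L v = 0) ->
  tcoef (rdiag Q) (v * dbop v) =
    \sum_(L | injl L && (pr1 L == Q)) tcoef L v ^+ 2 * #|[set: G] : pr2 L|%:Z.
Proof.
move=> Q1 v0; rewrite tcoef_mul_op // [RHS]big_mkcond; apply: eq_bigr => L _.
have pr1_eq M : injl M -> Q \subset pr1 M -> tcoef M v != 0 -> pr1 M = Q.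
  move=> iM sQ; apply: contraNeq => neq; rewrite v0 // properEneq sQ andbT.
  by rewrite eq_sym.
rewrite (bigD1 L) //= big1 ?addr0 => [|M neq]; last first.
  case: eqP => [e|_]; last by rewrite !mulr0.
  have [iL iM sL sM] := rcomp_diag_injl e.
  have [->|aL] := eqVneq (tcoef L v) 0; first by rewrite !mul0r.
  have [->|aM] := eqVneq (tcoef M v) 0; first by rewrite mulr0 mul0r.
  case/eqP: neq; apply/esym/(rcomp_diag_eq_pr1 Q1 e); exact: pr1_eq.
case: ifPn => [/andP[iL /eqP pL]|nL].
  by rewrite rcomp_self // pL eqxx joingE setUid genGid expr2 mulr1.
case: eqP => [e|_]; last by rewrite !mulr0.
have [iL _ sL _] := rcomp_diag_injl e.
rewrite iL /= in nL; move: e; rewrite rcomp_self // => /rdiag_inj pL.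
by rewrite pL eqxx in nL.
Qed.

Hypothesis p_odd : odd p.

Lemma index_ge3 Q : Q != [set: G]%G -> (3 <= #|[set: G] : Q|)%N.
Proof.
move=> QT; have : #|[set: G] : Q| != 1%N.
  by rewrite indexg_eq1 -val_eqE eqEsubset subsetT /= in QT *.
have : odd #|[set: G] : Q|.
  have [a ->] := p_natP (pnat_dvd (dvdn_indexg _ Q) pG).
  by rewrite oddX p_odd orbT.
by case: #|_ : _| => [|[|[|]]].
Qed.

Lemma tcoef_layer_eq0 Q : Q != 1%G -> Q != [set: G]%G ->
  (forall L, injl L -> Q \proper pr1 L -> tcoef L v = 0) ->
  forall L, injl L -> pr1 L = Q -> tcoef L v = 0.
Proof.
move=> Q1 QT v0; have := tcoef_orth_diag Q; rewrite tcoef_diag_layer //.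
pose D := rdiag Q; pose a := tcoef D v; rewrite -/D -/a.
have ge0 L : 0 <= tcoef L v ^+ 2 * #|[set: G] : pr2 L|%:Z by rewrite mulr_ge0 ?sqr_ge0.
have PD : injl D && (pr1 D == Q) by rewrite injl_rdiag pr1_rdiag eqxx.
rewrite (bigD1 D) //=; set S := \sum_(L | _) _ => s0.
have S0 : 0 <= S by apply: sumr_ge0 => L _.
have a0 : a = 0.
  apply: (@quad_le0 #|[set: G] : Q|%:Z); first exact: index_ge3.
  rewrite -expr2 mulrC -{1}[Q]pr2_rdiag -(lerD2r S) add0r.
  by rewrite addrAC s0.
have S1 : S = 0 by move: s0; rewrite -/a a0 expr0n mul0r mulr0 add0r addr0.
move=> L iL pL; have [->//|neq] := eqVneq L D.
have := psumr_eq0P (fun L _ => ge0 L) S1 (i := L).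
rewrite iL pL eqxx neq => /(_ isT) /eqP.
by rewrite mulf_eq0 sqrf_eq0 (negbTE (index_neq0 _)) orbF => /eqP.
Qed.

Hypothesis v_full : forall L, full L -> tcoef L v = 0.

Lemma tcoef_pr1_neq1 L : injl L -> pr1 L != 1%G -> tcoef L v = 0.
Proof.
have [m le_m] := ubnP (#|G| - #|pr1 L|)%N; elim: m L le_m => // m IH L le_m iL L1.
have [pT|pT] := eqVneq (pr1 L) [set: G]%G; first by apply/v_full/fullP.
apply: tcoef_layer_eq0 iL erefl => // M iM ltM; apply: IH => //.
  rewrite ltnS in le_m; apply: leq_trans le_m.
  by apply: ltn_sub2l (proper_card ltM); apply: leq_trans (proper_card ltM) (max_card _).
apply: contraNneq L1 => M1; rewrite M1 in ltM.
by rewrite -val_eqE eqEsubset sub1G andbT proper_sub.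
Qed.

(** The value at g of the permutation character of the virtual G-set
    formed by the coefficients of v at the relations 1 x P. *)
Definition beta (g : G) : int :=
  \sum_(L | pr1 L == 1%G) tcoef L v * (#|[set: G] : pr2 L| * (g \in pr2 L))%:Z.

Lemma rcomp_pr1_1 L M : pr1 L = 1%G -> pr1 M = 1%G -> rcomp L (ropp M) = rdiag 1.
Proof.
move=> pL pM; have p1 (A : {group G * G}) g h : pr1 A = 1%G -> (g, h) \in A -> g = 1%g.
  by move=> pA gh; apply/set1P; have : g \in pr1 A by [apply/pr1P; exists h]; rewrite pA.
apply/val_inj/setP => -[g h]; apply/rcompP/rdiagP => /= [[k []]|[<- /set1P ->]].
  by rewrite mem_ropp => /(p1 _ _ _ pL) -> /(p1 _ _ _ pM) ->; rewrite inE.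
by exists 1%g; rewrite mem_ropp !group1.
Qed.

(** Both sides count the points of G/A x G/B fixed by elements of G; this is the
    orbit-counting formula for G/A x G/B, which has |G : AB| orbits. *)
Lemma index_joing (A B : {group G}) : (#|G| * #|[set: G] : A <*> B| =
  \sum_g (#|[set: G] : A| * (g \in A)) * (#|[set: G] : B| * (g \in B)))%N.
Proof.
transitivity (#|[set: G] : A| * #|[set: G] : B| * #|A :&: B|)%N; last first.
  rewrite -sum1_card big_distrr [LHS]big_mkcond /=; apply: eq_bigr => g _.
  by rewrite inE; case: (g \in A); case: (g \in B); rewrite /= ?muln0 ?muln1.
have AB : (A <*> B = A * B)%g.
  rewrite comm_joingE //; apply/centC/centsP => x _ y _; exact: cG.
have cAB := mul_cardG A B; rewrite -AB in cAB.
have := (Lagrange (subsetT A), Lagrange (subsetT B), Lagrange (subsetT (A <*> B))).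
rewrite cardsT => -[[]]; move: (cardG_gt0 A) (cardG_gt0 B) cAB.
move: #|_ : A| #|_ : B| #|_ : _ <*> _| #|A| #|B| #|A <*> B| #|A :&: B| #|G|.
move=> a b c x y z t n x0 y0 e ha hb hc.
apply/eqP; rewrite -(eqn_pmul2l x0) -(eqn_pmul2l y0); apply/eqP.
transitivity (n * c * (x * y))%N; first by lia.
rewrite e; transitivity (n * t * (z * c))%N; first by lia.
by rewrite hc -{1}ha -hb; lia.
Qed.

(** The equation at the trivial diagonal, where all pairs of relations 1 x P and
    1 x P' contribute. *)
Lemma sum_beta : \sum_g beta g ^+ 2 + 2 * #|G|%:Z * tcoef (rdiag 1) v = 0.
Proof.
have := congr1 ( *%R #|G|%:Z) (tcoef_orth_diag 1%G); rewrite mulr0 mulrDr => e0.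
rewrite -[RHS]e0; congr (_ + _); last by rewrite mulrCA mulrA.
rewrite tcoef_mul_op // mulr_sumr.
transitivity (\sum_(L | pr1 L == 1%G) \sum_(M | pr1 M == 1%G)
   tcoef L v * tcoef M v * (#|G| * #|[set: G] : pr2 L <*> pr2 M|)%:Z).
  under eq_bigr do rewrite /beta expr2 big_distrlr /=.
  rewrite [LHS]exchange_big /=; apply: eq_bigr => L _; rewrite [LHS]exchange_big /=.
  apply: eq_bigr => M _; rewrite index_joing (big_morph Posz PoszD (erefl 0)) mulr_sumr.
  by apply: eq_bigr => g _; rewrite mulrACA -PoszM.
rewrite [LHS]big_mkcond; apply: eq_bigr => L _; rewrite mulr_sumr.
have pr1_neq (M : {group G * G}) : injl M -> pr1 M != 1%G -> tcoef M v = 0.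
  exact: tcoef_pr1_neq1.
case: ifPn => [/eqP pL|pL]; last first.
  rewrite big1 // => M _; case: eqP => [e|_]; last by rewrite !mulr0.
  by have [iL _ _ _] := rcomp_diag_injl e; rewrite pr1_neq // !mul0r mulr0.
rewrite [LHS]big_mkcond; apply: eq_bigr => M _.
case: ifPn => [/eqP pM|pM].
  by rewrite rcomp_pr1_1 // eqxx mulr1 PoszM mulrCA.
case: eqP => [e|_]; last by rewrite !mulr0.
by have [_ iM _ _] := rcomp_diag_injl e; rewrite [tcoef M v]pr1_neq // mulr0 mul0r mulr0.
Qed.

Lemma order_p_sub (z : G) P : #[z]%g = p -> P != 1%G -> <[z]>%g \subset P.
Proof.
move=> oz P1; have [//|sP] := orP (subgroup_chain <[z]>%G P).
apply: prime_meetG; first by rewrite -orderE oz.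
by rewrite (setIidPr sP); apply: contraNneq P1 => e; apply/eqP/val_inj.
Qed.

Lemma beta1 : beta 1 = #|G|%:Z * tcoef (rdiag 1) v +
  \sum_(L | (pr1 L == 1%G) && (L != rdiag 1)) tcoef L v * #|[set: G] : pr2 L|%:Z.
Proof.
rewrite /beta (bigD1 (rdiag 1)) ?pr1_rdiag //; congr (_ + _).
  by rewrite pr2_rdiag group1 muln1 indexg1 cardsT mulrC.
by apply: eq_bigr => L _; rewrite group1 muln1.
Qed.

Lemma pr2_eq1 L : pr1 L = 1%G -> L != rdiag 1 -> pr2 L != 1%G.
Proof.
move=> pL; apply: contraNneq => p2L; apply/eqP/val_inj/setP => -[g h].
have {}pL : pr1 L = 1%g :> {set G} by rewrite pL.
have {}p2L : pr2 L = 1%g :> {set G} by rewrite p2L.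
apply/idP/rdiagP => [gh|[<- /set1P->]]; last exact: group1.
have : h \in pr2 L by apply/pr2P; exists g.
rewrite p2L => /set1P e; move: gh; rewrite e => gh.
have : g \in pr1 L by apply/pr1P; exists 1%g.
by rewrite pL => /set1P ->; rewrite group1.
Qed.

(** An element of order p lies in every nontrivial subgroup. *)
Lemma beta_order_p (z g : G) : #[z]%g = p -> g \in <[z]>%g -> g != 1%g ->
  beta g = \sum_(L | (pr1 L == 1%G) && (L != rdiag 1))
    tcoef L v * #|[set: G] : pr2 L|%:Z.
Proof.
move=> oz gz g1; rewrite /beta (bigD1 (rdiag 1)) ?pr1_rdiag //.
rewrite -[RHS]add0r; congr (_ + _).
  rewrite pr2_rdiag (_ : nat_of_bool _ = 0%N) ?muln0 ?mulr0 //.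
  by apply/eqP; rewrite eqb0; apply: contra g1 => /set1P ->.
apply: eq_bigr => L /andP[/eqP pL L1].
have /subsetP/(_ g gz) := order_p_sub oz (pr2_eq1 pL L1).
by move=> /= ->; rewrite muln1.
Qed.

Hypothesis G1 : [set: G] != 1%g.

Lemma tcoef_diag1_ineq (b := tcoef (rdiag 1) v) :
  (p.-1 * (#|G| %/ p))%N%:Z * (b * b) + 2 * b <= 0.
Proof.
have p_dvd : (p %| #|[set: G]|)%N.
  have [a e] := p_natP pG; rewrite e; case: a e => [|a e]; last exact: dvdn_exp.
  by move=> e; case/eqP: G1; apply: card1_trivg.
have [z _ oz] := Cauchy p_prime p_dvd; rewrite cardsT in p_dvd.
set m := (#|G| %/ p)%N.
have Gm : #|G| = (p * m)%N by rewrite mulnC divnK.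
pose s := \sum_(L | (pr1 L == 1%G) && (L != rdiag 1))
    tcoef L v * #|[set: G] : pr2 L|%:Z.
have sb : (#|G|%:Z * b + s) ^+ 2 + s ^+ 2 * p.-1%:Z <= \sum_g beta g ^+ 2.
  rewrite (bigD1 1%g) //= beta1 lerD2l.
  rewrite (bigID (mem <[z]>%g)) /= ler_wpDr ?sumr_ge0 // => [g _|]; first exact: sqr_ge0.
  rewrite (eq_bigr (fun=> s ^+ 2)) => [|g /andP[g1 gz]]; last by rewrite (beta_order_p oz).
  rewrite sumr_const -mulr_natr natz.
  suff -> : #|[pred g | (g != 1%g) && (g \in <[z]>%g)]| = p.-1 by [].
  rewrite -oz orderE (cardsD1 1%g <[z]>%g) group1 /=.
  by apply: eq_card => g; rewrite !inE.
have := sum_beta; rewrite -/b => e.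
have m0 : (0 < m)%N by rewrite divn_gt0 ?prime_gt0 // dvdn_leq // -cardsT cardG_gt0.
have {sb e} : (#|G|%:Z * b + s) ^+ 2 + s ^+ 2 * p.-1%:Z + 2 * #|G|%:Z * b <= 0.
  by rewrite -e lerD2r.
rewrite Gm -{1 3}(prednK (prime_gt0 p_prime)); exact: beta_ineq.
Qed.

(** Once b = 0, the sum of squares vanishes, so beta = 0. Evaluating beta at a
    generator of P only involves subgroups containing P, so the coefficients vanish by
    downward induction on P. *)
Lemma tcoef_pr1_1 : tcoef (rdiag 1) v = 0 ->
  forall L, injl L -> tcoef L v = 0.
Proof.
move=> b0 L iL; have [pL|/tcoef_pr1_neq1->//] := eqVneq (pr1 L) 1%G.
have S0 : \sum_g beta g ^+ 2 = 0 by have := sum_beta; rewrite b0 mulr0 addr0.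
have beta0 g : beta g = 0.
  apply/eqP; rewrite -sqrf_eq0; apply/eqP.
  exact: (psumr_eq0P (fun g _ => sqr_ge0 (beta g)) S0).
have [m le_m] := ubnP (#|G| - #|pr2 L|)%N; elim: m L pL le_m {iL} => // m IH L pL le_m.
have /cyclicP[g gP] := cyclicS (subsetT (pr2 L)) cycG.
have gL : g \in pr2 L by rewrite gP cycle_id.
suff /eqP : tcoef L v * #|[set: G] : pr2 L|%:Z = 0.
  by rewrite mulf_eq0 (negbTE (index_neq0 _)) orbF => /eqP.
rewrite -[RHS](beta0 g) /beta (bigD1 L) ?pL // [X in _ = _ X]big1.
  by rewrite gL muln1; apply/esym/addr0.
move=> M /andP[/eqP pM neq]; case gM: (g \in pr2 M); last by rewrite muln0 mulr0.
rewrite IH ?mul0r //.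
have sLM : pr2 L \subset pr2 M by rewrite gP cycle_subG.
have ltLM : pr2 L \proper pr2 M.
  rewrite properE sLM; apply: contra neq => sML; apply/eqP/val_inj/eqP.
  by rewrite eqEsubset !(rcomp_diag_sub (rcomp_pr1_1 _ _)).
rewrite ltnS in le_m; apply: leq_trans le_m.
by apply: ltn_sub2l (proper_card ltLM); apply: leq_trans (proper_card ltLM) (max_card _).
Qed.

End CyclicPGroup.

(** * Inflation of units from a quotient *)
Lemma db_mulE (G : finGroupType) (u v : double_burnside G) : (u * v)%R = bcomp u v.
Proof. by []. Qed.

Lemma dbopD (G : finGroupType) : {morph @dbop G : u v / (u + v)%R}.
Proof. exact: bopD. Qed.
Lemma dbopB (G : finGroupType) : {morph @dbop G : u v / (u - v)%R}.
Proof. exact: bopB. Qed.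

Section Inflation.
Local Open Scope group_scope.
Variables (G : finGroupType) (N : {group G}).
Hypothesis (cG : commutative (@mulg G)).
Local Notation H := (coset_of N).
Implicit Types (L M : {group G * G}).

Lemma comm_norm (h : G) : h \in 'N(N).
Proof. by apply/normP/setP => x; rewrite mem_conjg conjgE invgK (cG x) mulKVg. Qed.

Lemma coset_mulgC : commutative (@mulg H).
Proof.
move=> x y; rewrite -[x]coset_reprK -[y]coset_reprK.
by rewrite -(morphM (coset_morphism N)) ?comm_norm // cG morphM ?comm_norm.
Qed.
Let cH := coset_mulgC.

(** The graph of the projection of G onto G/N: the inflation biset. *)
Definition rquo_set := [set u : G * H | coset N u.1 == u.2].
Lemma rquo_group_set : group_set rquo_set.
Proof.
apply/group_setP; split=> [|u v]; rewrite !inE /=; first by rewrite coset_id.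
by move=> /eqP <- /eqP <-; rewrite -(morphM (coset_morphism N)) ?comm_norm.
Qed.
Canonical rquo := Group rquo_group_set.

Lemma rquoP g x : reflect (coset N g = x) ((g, x) \in rquo).
Proof. by rewrite inE; apply: eqP. Qed.

(** Congruence modulo N. Its class is inflation after deflation, an idempotent. *)
Definition rcong := rcomp rquo (ropp rquo).

Lemma rcongP g h : reflect (coset N g = coset N h) ((g, h) \in rcong).
Proof.
apply: (iffP (rcompP _ _ _)) => /= [[x [/rquoP -> ]]|e].
  by rewrite mem_ropp => /rquoP.
by exists (coset N g); rewrite mem_ropp; split; apply/rquoP.
Qed.

Lemma rcong_ker n : n \in N -> (n, 1) \in rcong.
Proof. by move=> nN; apply/rcongP; rewrite !coset_id. Qed.

Lemma pr1_rquo : pr1 rquo = [set: G]%G.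
Proof.
apply/val_inj/setP => g; rewrite [RHS]inE; apply/pr1P.
by exists (coset N g); apply/rquoP.
Qed.
Lemma pr2_rquo : pr2 rquo = [set: H]%G.
Proof.
apply/val_inj/setP => x; rewrite [RHS]inE; apply/pr2P.
by exists (repr x); apply/rquoP; rewrite coset_reprK.
Qed.

Lemma mid_fulll (A B C : finGroupType) (L : {group A * B}) (M : {group B * C}) :
  pr2 L = [set: B]%G -> #|[set: B] : mid L M| = 1%N.
Proof. by move=> e; rewrite /mid e; apply/eqP; rewrite indexg_eq1 joing_subl. Qed.

Lemma mid_fullr (A B C : finGroupType) (L : {group A * B}) (M : {group B * C}) :
  pr1 M = [set: B]%G -> #|[set: B] : mid L M| = 1%N.
Proof. by move=> e; rewrite /mid e; apply/eqP; rewrite indexg_eq1 joing_subr. Qed.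

Definition binf : burnside G H := tcls rquo.
Definition bdef : burnside H G := bop binf.

Lemma bdefE : bdef = tcls (ropp rquo).
Proof. exact: bop_tcls. Qed.

Lemma bdef_inf : bcomp bdef binf = bcls (bid H).
Proof.
rewrite bdefE (bcomp_tcls cH cG cH) mid_fullr ?pr1_rquo // mulr1n.
rewrite -[RHS]/(1%R : double_burnside H) db1E //; congr tcls.
apply/val_inj/setP => -[x y]; apply/rcompP/rdiagP => /= [[g []]|[-> _]].
  by rewrite mem_ropp => /rquoP <- /rquoP <-; rewrite inE.
by exists (repr y); rewrite mem_ropp; split; apply/rquoP; rewrite coset_reprK.
Qed.

Lemma binf_def : bcomp binf bdef = tcls rcong.
Proof. by rewrite bdefE (bcomp_tcls cG cH cG) mid_fulll ?pr2_rquo // mulr1n. Qed.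

Lemma rcong_comp L : (forall n, n \in N -> (n, 1) \in L) -> rcomp rcong L = L.
Proof.
move=> NL; apply/val_inj/setP => -[g h]; apply/rcompP/idP => /= [[k []]|gh].
  move=> /rcongP e kh; rewrite -(mulgKV k g) -(mul1g h).
  apply: (groupM (NL _ _) kh); apply: coset_idr; first exact: comm_norm.
  rewrite (morphM (coset_morphism N)) ?comm_norm //.
  by rewrite morphV ?comm_norm //= e mulgV.
by exists g; split=> //; apply/rcongP.
Qed.

Local Open Scope ring_scope.

(** The idempotent fixes the classes of the relations whose left kernel contains N. *)
Lemma rcong_mul (v : double_burnside G) :
  (forall L, tcoef L v != 0 -> forall n, n \in N -> (n, 1%g) \in L) ->
  (tcls rcong : double_burnside G) * v = v.
Proof.
move=> vN; rewrite {1}[v](tcoefE cG cG) mulr_sumr [RHS](tcoefE cG cG).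
apply: eq_bigr => L _.
have [->|aL] := eqVneq (tcoef L v) 0; first by rewrite mulr0z mulr0.
have pr2T : pr2 rcong = [set: G]%G.
  by apply/val_inj/setP => g; rewrite [RHS]inE; apply/pr2P; exists g; apply/rcongP.
have e : (tcls rcong : double_burnside G) * (tcls L : double_burnside G) = tcls L.
  rewrite [LHS](bcomp_tcls cG cG cG) (rcong_comp (vN L aL)).
  by rewrite (mid_fulll _ pr2T) mulr1n.
by rewrite [LHS]mulrzAr e.
Qed.

(** Conversely, the left kernel of a relation composed on the left with [rcong]
    contains N. *)
Lemma tcoef_rcong_mul L (x : double_burnside G) : N :!=: 1%g -> injl L ->
  tcoef L ((tcls rcong : double_burnside G) * x) = 0.
Proof.
move=> N1 /injlP iL; rewrite [LHS](tcoef_bcomp cG cG cG) big1 // => A _.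
rewrite big1 // => B _; rewrite tcoef_tcls //.
case: eqP => [->|_]; last by rewrite !mul0r.
case: eqP => [e|_]; last by rewrite !mulr0.
case/negP: N1; apply/eqP/trivgP/subsetP => n nN; apply/set1P/iL.
rewrite -e; apply/rcompP; exists 1%g; split; last exact: group1.
exact: rcong_ker.
Qed.

Definition ext (x : double_burnside H) : double_burnside G := bcomp binf (bcomp x bdef).

Lemma extM : {morph ext : x y / x * y}.
Proof.
move=> x y; rewrite !db_mulE /ext -[RHS]bcompA -(bcompA x bdef) (bcompA bdef).
by rewrite bdef_inf bcomp1u (bcompA x).
Qed.
Lemma extD : {morph ext : x y / x + y}.
Proof. by move=> x y; rewrite /ext bcompDl bcompDr. Qed.
Lemma ext_op x : ext (dbop x) = dbop (ext x).
Proof. by rewrite /ext /dbop !bop_comp bopK -bcompA. Qed.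
Lemma rcong_ext x : (tcls rcong : double_burnside G) * ext x = ext x.
Proof.
rewrite db_mulE -binf_def /ext -(bcompA binf) (bcompA bdef) bdef_inf.
by rewrite bcomp1u.
Qed.
Definition res (x : double_burnside G) : double_burnside H := bcomp bdef (bcomp x binf).
Lemma extK : cancel ext res.
Proof.
move=> x; rewrite /res /ext -(bcompA binf) -(bcompA x) bdef_inf bcompu1.
by rewrite bcompA bdef_inf bcomp1u.
Qed.
Lemma resK x : (tcls rcong : double_burnside G) * x = x ->
  x * (tcls rcong : double_burnside G) = x -> ext (res x) = x.
Proof.
move=> e1 e2; rewrite -[RHS]e1 -[in RHS]e2 !db_mulE -binf_def /ext /res.
by rewrite !bcompA.
Qed.

(** Unlike [ext], this maps 1 to 1: on the corner cut out by the idempotent [rcong] it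
    is given by w, and on the complementary corner by the identity. *)
Definition infl (w : double_burnside H) : double_burnside G := 1 + ext (w - 1).

Lemma inflM : {morph infl : x y / x * y}.
Proof.
move=> x y; rewrite /infl (_ : x * y - 1 = (x - 1) + (y - 1) + (x - 1) * (y - 1)).
  rewrite (extD (x - 1 + (y - 1))) (extD (x - 1)) extM.
  move: (ext (x - 1)) (ext (y - 1)) => a b.
  by rewrite mulrDl mul1r mulrDr mulr1 [RHS]addrACA -!addrA.
rewrite mulrBr mulr1 [_ + (y - 1)]addrC -addrA [x - 1 + _]addrC subrK.
by rewrite mulrBl mul1r addrC addrA subrK.
Qed.
Lemma infl1 : infl 1 = 1.
Proof. 
by rewrite /infl subrr; apply: (addrI (ext 0)); rewrite addrCA -extD addr0 addrC.
Qed.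
Lemma infl_op x : infl (dbop x) = dbop (infl x).
Proof.
by rewrite /infl dbopD dbop1 -ext_op dbopB dbop1.
Qed.
Lemma infl_inj : injective infl.
Proof. by move=> x y /addrI /(can_inj extK) /addIr. Qed.

End Inflation.
Arguments infl {G N} cG w.
Arguments res {G N} cG x.

(** * Isomorphisms onto products of finite groups *)
Section GroupIso.
Local Open Scope group_scope.

Lemma group_iso_isog (A : groupType) (rT rT' : finGroupType) (B : {group rT})
    (B' : {group rT'}) :
  group_iso A B -> B \isog B' -> group_iso A B'.
Proof.
case=> f [fM f_inj fP] /isogP[h h_inj hB].
have fB x : f x \in B by apply/fP; exists x.
exists (h \o f); split=> [x y|x y /=|y] /=.
- by rewrite fM morphM.
- by move/(injmP h_inj); rewrite !fB => /(_ isT isT); apply: f_inj.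
rewrite -hB; split=> [/morphimP[z zB _ ->]|[x <-]].
  by have [x <-] := (fP z).1 zB; exists x.
exact: mem_morphim.
Qed.

(** A is the internal direct product of the images of C and of A'. *)
Lemma group_iso_prod (A A' : groupType) (cT bT : finGroupType) (C : {group cT})
    (B : {group bT}) (j : cT -> A) (k : A' -> A) :
  {in C &, {morph j : x y / x * y}} -> {morph k : x y / x * y} ->
  (forall c a', c \in C -> j c * k a' = k a' * j c) ->
  (forall a, exists c a', c \in C /\ a = j c * k a') ->
  (forall c a', c \in C -> j c = k a' -> c = 1 /\ a' = 1) ->
  group_iso A' B -> group_iso A (setX_group C B).
Proof.
move=> jM kM jkC dec uniq [f [fM f_inj fP]].
have jkinj c a c1 a1 : c \in C -> c1 \in C -> j c * k a = j c1 * k a1 ->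
    c = c1 /\ a = a1.
  move=> cC c1C e.
  have j1 : j 1 = 1 by apply: (mulgI (j 1)); rewrite -jM ?group1 // !mulg1.
  have k1 : k 1 = 1 by apply: (mulgI (k 1)); rewrite -kM !mulg1.
  have jV x : x \in C -> j x^-1 = (j x)^-1.
    by move=> xC; apply: (mulgI (j x)); rewrite -jM ?groupV // !mulgV.
  have kV x : k x^-1 = (k x)^-1 by apply: (mulgI (k x)); rewrite -kM !mulgV.
  have [] := uniq (c1^-1 * c) (a1 * a^-1); first by rewrite groupM ?groupV.
    rewrite jM ?groupV // jV // kM kV; apply: (mulgI (j c1)).
    by rewrite mulKVg mulgA -e mulgK.
  move/(congr1 (mulg c1)); rewrite mulKVg mulg1 => -> /(congr1 (mulg^~ a)).
  by rewrite mulgKV mul1g.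
have /choice[d dP] a : exists x : cT * A', x.1 \in C /\ a = j x.1 * k x.2.
  by have [c [a' ?]] := dec a; exists (c, a').
pose c a := (d a).1; pose a' a := (d a).2.
have da a : c a \in C /\ a = j (c a) * k (a' a) := dP a.
have daE x y : x \in C -> c (j x * k y) = x /\ a' (j x * k y) = y.
  by move=> xC; have [cC e] := da (j x * k y); apply: jkinj (esym e).
exists (fun a => (c a, f (a' a))); split=> [a b|a b|[x y]].
- have [ca ea] := da a; have [cb eb] := da b.
  have e : a * b = j (c a * c b) * k (a' a * a' b).
    rewrite {1}ea {1}eb jM // kM -!mulgA; congr (_ * _).
    by rewrite !mulgA jkC.
  have [] := daE (c a * c b) (a' a * a' b); first exact: groupM.
  by rewrite -e => -> ->; rewrite fM.
- case=> e1 /f_inj e2; have [_ ->] := da a; have [_ ->] := da b.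
  by rewrite e1 e2.
rewrite inE /=; split=> [/andP[xC /fP[z <-]]|[a [<- <-]]].
  by exists (j x * k z); have [-> ->] := daE x z xC.
by have [-> _] := da a; apply/fP; exists (a' a).
Qed.

Lemma group_iso_fin (A : groupType) (cT : finGroupType) (C : {group cT}) (j : cT -> A) :
  {in C &, {morph j : x y / x * y}} -> (forall a, exists2 c, c \in C & a = j c) ->
  (forall c, c \in C -> j c = 1 -> c = 1) -> group_iso A C.
Proof.
move=> jM sur inj.
have jinj c c1 : c \in C -> c1 \in C -> j c = j c1 -> c = c1.
  move=> cC c1C e; have j1 : j 1 = 1 by apply: (mulgI (j 1)); rewrite -jM ?group1 // !mulg1.
  have jV x : x \in C -> j x^-1 = (j x)^-1.
    by move=> xC; apply: (mulgI (j x)); rewrite -jM ?groupV // !mulgV.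
  have := inj (c1^-1 * c); rewrite jM ?groupM ?groupV // jV // e mulVg.
  by move=> /(_ isT erefl) /(congr1 (mulg c1)); rewrite mulKVg mulg1.
have /choice[d dP] a : exists c, c \in C /\ j c = a.
  by have [c cC ->] := sur a; exists c.
have dC a : d a \in C by have [] := dP a.
have dE a : j (d a) = a by have [] := dP a.
exists d; split=> [a b|a b e|y].
- by apply: jinj; rewrite ?groupM // jM // !dE.
- by rewrite -[a]dE e dE.
by split=> [yC|[x <-]//]; exists (j y); apply: jinj; rewrite ?dE.
Qed.

Lemma isog_of_bij (aT rT : finGroupType) (A : {group aT}) (B : {group rT}) (f : aT -> rT) :
  {in A &, {morph f : x y / x * y}} -> {in A &, injective f} ->
  f @: A = B -> A \isog B.
Proof.
move=> fM f_inj fB; apply/isogP; exists (Morphism fM).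
  by apply/injmP.
by rewrite morphimEdom.
Qed.

Lemma setX_isog (aT bT cT dT : finGroupType) (A : {group aT}) (B : {group bT})
    (C : {group cT}) (D : {group dT}) :
  A \isog C -> B \isog D -> setX_group A B \isog setX_group C D.
Proof.
move=> /isogP[f f_inj fC] /isogP[h h_inj hD].
apply: (@isog_of_bij _ _ _ _ (fun x => (f x.1, h x.2))).
- move=> [a b] [a1 b1]; rewrite !inE /= => /andP[aA bB] /andP[aA1 bB1].
  by congr (_, _); rewrite morphM.
- move=> [a b] [a1 b1]; rewrite !inE /= => /andP[aA bB] /andP[aA1 bB1] [e1 e2].
  by congr (_, _); [apply: (injmP f_inj)|apply: (injmP h_inj)].
apply/setP => -[c d]; rewrite inE /= -fC -hD.
apply/imsetP/andP => [[[a b]]|[/morphimP[a aA _ ->] /morphimP[b bB _ ->]]].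
  by rewrite inE /= => /andP[aA bB] [-> ->]; split; apply: mem_morphim.
by exists (a, b); rewrite // inE aA.
Qed.

Lemma setX_swap_isog (aT bT cT dT : finGroupType) (A : {group aT}) (B : {group bT})
    (C : {group cT}) (D : {group dT}) :
  setX_group (setX_group A B) (setX_group C D) \isog
  setX_group (setX_group A C) (setX_group B D).
Proof.
apply: (@isog_of_bij _ _ _ _ (fun x => ((x.1.1, x.2.1), (x.1.2, x.2.2)))).
- by [].
- by move=> [[a b] [c d]] [[a1 b1] [c1 d1]] _ _ [-> -> -> ->].
apply/setP => -[[a c] [b d]]; rewrite !inE /=; apply/imsetP/idP.
  by case=> -[[a1 b1] [c1 d1]]; rewrite !inE /= andbACA => ? [-> -> -> ->].
by rewrite andbACA => h; exists ((a, b), (c, d)); rewrite // !inE.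
Qed.

Lemma setX_assoc_isog (aT bT cT : finGroupType) (A : {group aT}) (B : {group bT})
    (C : {group cT}) :
  setX_group (setX_group A B) C \isog setX_group A (setX_group B C).
Proof.
apply: (@isog_of_bij _ _ _ _ (fun x => (x.1.1, (x.1.2, x.2)))).
- by [].
- by move=> [[a b] c] [[a1 b1] c1] _ _ [-> -> ->].
apply/setP => -[a [b c]]; rewrite !inE /=; apply/imsetP/idP.
  by case=> -[[a1 b1] c1]; rewrite !inE /= -andbA => ? [-> -> ->].
by rewrite andbA => h; exists (a, b, c); rewrite // !inE.
Qed.

Lemma setXn_succ_isog n (gT : 'I_n.+1 -> finGroupType) (A : forall i, {group gT i}) :
  setX_group (A ord_max) (setXn_group (fun i : 'I_n => A (widen_ord (leqnSn n) i)))
    \isog setXn_group A.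
Proof.
rewrite isog_sym.
pose f (x : {dffun forall i, gT i}) :
    gT ord_max * {dffun forall i : 'I_n, gT (widen_ord (leqnSn n) i)} :=
   (x ord_max, [ffun i : 'I_n => x (widen_ord (leqnSn n) i)]).
have f_inj : injective f.
  move=> x y [e1 /ffunP e2]; apply/ffunP => i.
  have [->//|neq] := eqVneq i ord_max.
  have lt : (i < n)%N by rewrite ltn_neqAle -ltnS ltn_ord andbT -val_eqE in neq *.
  have -> : i = widen_ord (leqnSn n) (Ordinal lt) by apply: val_inj.
  by have := e2 (Ordinal lt); rewrite !ffunE.
apply: (@isog_of_bij _ _ _ _ f).
- move=> x y _ _; congr (_, _); first by rewrite ffunE.
  by apply/ffunP => i; rewrite !ffunE.
- exact: in2W f_inj.
apply/eqP; rewrite eqEcard card_imset //; apply/andP; split.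
  apply/subsetP => _ /imsetP[x /setXnP xA ->]; rewrite inE /= xA.
  by apply/setXnP => i; rewrite ffunE.
by rewrite cardsX !cardsXn big_ord_recr mulnC.
Qed.
End GroupIso.

(** * Signed automorphisms *)
Local Notation dcls L := (tcls L : double_burnside _).

Lemma dbopN (G : finGroupType) : {morph @dbop G : x / (- x)%R}.
Proof.
move=> x; apply: (addrI (dbop x)); rewrite -dbopD !subrr.
by rewrite -[X in dbop X](subrr 0%R) dbopB subrr.
Qed.

Lemma dbop_sign (G : finGroupType) n : (dbop ((-1) ^+ n : double_burnside G) = (-1) ^+ n)%R.
Proof. by rewrite -signr_odd; case: odd; rewrite /= ?expr0 ?expr1 ?dbopN dbop1. Qed.

Section SignedAut.
Local Open Scope group_scope.
Local Open Scope ring_scope.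
Variable G : finGroupType.
Hypothesis cycG : cyclic [set: G].
Let cG := cyclic_mulgC cycG.
Implicit Types (L : {group G * G}) (f : {perm G}) (u v : double_burnside G).

Lemma is_orthogonalP u :
  reflect (u * dbop u = 1 /\ dbop u * u = 1) (is_orthogonal u).
Proof.
apply: (iffP and3P) => [[_ /eqP ? /eqP ?]|[e1 e2]] //.
by rewrite e1 e2 eqxx; split=> //; apply/unitrP; exists (dbop u).
Qed.

Lemma Aut_power f : f \in Aut [set: G] -> exists k, forall x, (f x = x ^+ k)%g.
Proof.
move=> fA; have /cyclicP[z zG] := cycG.
have zP x : exists i, x = (z ^+ i)%g.
  by apply/cycleP; rewrite -zG inE.
have [k fz] := zP (f z); exists k => x; have [i ->] := zP x.
rewrite -expgM mulnC expgM -fz; elim: i => [|i IH].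
  by rewrite !expg0; apply: (mulgI (f 1%g)); rewrite -AutM // !mulg1.
by rewrite !expgS AutM // IH.
Qed.

Lemma Aut_rel L f g h : f \in Aut [set: G] -> (g, h) \in L -> (f g, f h) \in L.
Proof.
move=> fA gh; have [k fk] := Aut_power fA; rewrite !fk.
suff -> : ((g ^+ k, h ^+ k) = (g, h) ^+ k)%g by apply: groupX.
by elim: k {fk} => // k IH; rewrite !expgS -IH.
Qed.

(** An automorphism of a cyclic group is a power map, so it preserves every subgroup
    of G x G; this is why signed automorphisms are central. *)
Lemma rcomp_autgraphC L f : f \in Aut [set: G] -> rcomp (autgraph f) L = rcomp L (autgraph f).
Proof.
move=> fA; have fA' := groupVr fA.
apply/val_inj/setP => -[g h]; apply/rcompP/rcompP => -[k [/= gk kh]].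
  move: gk kh => /(autgraphP _ _ fA) -> gh; exists ((f^-1)%g h).
  split; last by apply/autgraphP; rewrite // permKV.
  by rewrite -[g](permK f); apply: Aut_rel.
exists (f g); split; first exact/autgraphP.
by move/(autgraphP _ _ fA): kh => ->; apply: Aut_rel.
Qed.

Lemma pr1_autgraph f : f \in Aut [set: G] -> pr1 (autgraph f) = [set: G]%G.
Proof. by move/full_autgraph/fullP => []. Qed.
Lemma pr2_autgraph f : f \in Aut [set: G] -> pr2 (autgraph f) = [set: G]%G.
Proof. by move/full_autgraph/fullP => [? ?]; apply: pr2_full. Qed.

Lemma tcls_autgraphC f u : f \in Aut [set: G] ->
  dcls (autgraph f) * u = u * tcls (autgraph f).
Proof.
move=> fA; rewrite [u](tcoefE cG cG) mulr_sumr mulr_suml; apply: eq_bigr => L _.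
have e : dcls (autgraph f) * dcls L =
    dcls L * tcls (autgraph f).
  rewrite [LHS](bcomp_tcls cG cG cG) [RHS](bcomp_tcls cG cG cG).
  by rewrite mid_fulll ?pr2_autgraph // mid_fullr ?pr1_autgraph // rcomp_autgraphC.
by rewrite [LHS]mulrzAr [RHS]mulrzAl e.
Qed.

Definition sgraph (c : 'Z_2 * {perm G}) : double_burnside G :=
  (-1) ^+ c.1 * dcls (autgraph c.2).

Definition sgroup := setX_group (Zp_group 2) (Aut_group [set: G]).

Lemma sgroupP c : reflect (c.2 \in Aut [set: G]) (c \in sgroup).
Proof. case: c => s f; rewrite in_setX [s \in _]inE; exact: idP. Qed.

Lemma sgraphM : {in sgroup &, {morph sgraph : c d / (c * d)%g >-> c * d}}.
Proof.
move=> [s f] [t h] /sgroupP /= fA /sgroupP /= hA; rewrite /sgraph /=.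
rewrite -tcls_autgraphM //; move: (dcls (autgraph f)) (dcls (autgraph h)) => F H.
rewrite -[RHS]mulrA (mulrA F) commr_sign -mulrA [RHS]mulrA -exprD; congr (_ * _).
by rewrite -signr_odd -[RHS]signr_odd /= -!modn2 modn_mod.
Qed.

Lemma sgraph1 : sgraph 1%g = 1.
Proof. by rewrite /sgraph /= autgraph1 -db1E // expr0 mul1r. Qed.

Lemma sgraph_op c : c \in sgroup -> dbop (sgraph c) = sgraph (c^-1)%g.
Proof.
case: c => s f /sgroupP /= fA; rewrite /sgraph /= dbopM (dbop_tcls cG) ropp_autgraph //.
rewrite dbop_sign commr_sign; congr (_ * _).
by case: s => -[|[|//]].
Qed.

Lemma sgraph_orth c : c \in sgroup -> is_orthogonal (sgraph c).
Proof.
move=> cS; apply/is_orthogonalP; rewrite sgraph_op // -!sgraphM ?groupV //.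
by rewrite mulgV mulVg sgraph1.
Qed.

Lemma sgraphC c u : c \in sgroup -> sgraph c * u = u * sgraph c.
Proof.
move=> /sgroupP cA; rewrite /sgraph -mulrA tcls_autgraphC // !mulrA.
by rewrite commr_sign.
Qed.

Lemma tcoef_sign_mul L n u : tcoef L ((-1) ^+ n * u) = (-1) ^+ n * tcoef L u.
Proof.
by rewrite -signr_odd -[in RHS]signr_odd; case: odd; rewrite ?mul1r ?mulN1r ?tcoefN.
Qed.

Lemma tcoef_sgraph L c : tcoef L (sgraph c) = (-1) ^+ c.1 * (L == autgraph c.2)%:Z.
Proof. by rewrite tcoef_sign_mul tcoef_tcls. Qed.

Lemma sgraph_diag_eq1 c : c \in sgroup ->
  tcoef (rdiag [set: G]) (sgraph c) = 1 -> c = 1%g.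
Proof.
move=> /sgroupP cA; rewrite tcoef_sgraph; case: eqP => [|_]; last by rewrite mulr0.
rewrite -autgraph1 => /(autgraph_inj (group1 _) cA); rewrite mulr1.
case: c {cA} => s f /= <- s1; suff -> : s = 1%g by [].
by case: s s1 => -[|[|//]] i //= _; apply: val_inj.
Qed.

Lemma tcoef_diag_sgraph_op u c : c \in sgroup ->
  tcoef (rdiag [set: G]) (u * dbop (sgraph c)) = tcoef (autgraph c.2) u * (-1) ^+ c.1.
Proof.
move=> /sgroupP cA; rewrite (tcoef_diag_op cG) (bigD1 (autgraph c.2)) ?full_autgraph //=.
rewrite tcoef_sgraph eqxx mulr1 big1 ?addr0 // => L /andP[_ /negbTE neq].
by rewrite tcoef_sgraph neq !mulr0.
Qed.

(** Modulo the bisets that factor through proper sections, an orthogonal unit is a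
    signed automorphism; dividing by it makes that part trivial. *)
Lemma orth_sgraph u : is_orthogonal u -> exists2 c, c \in sgroup &
  exists y, [/\ u = sgraph c * y, is_orthogonal y,
    tcoef (rdiag [set: G]) y = 1 &
    forall L, full L -> L != rdiag [set: G] -> tcoef L y = 0].
Proof.
move=> uO; have /is_orthogonalP[u1 u2] := uO.
have [L [/fullE[f fA ->] aL aM]] := tcoef_orth_full cG u1.
pose s : 'Z_2 := if tcoef (autgraph f) u == 1 then 0 else 1.
have as1 : tcoef (autgraph f) u = (-1) ^+ s.
  rewrite /s; case: eqP => // ne1; move/eqP: aL; rewrite sqrf_eq1 => /orP[/eqP|/eqP//].
  by move/ne1.
pose c : 'Z_2 * {perm G} := (s, f).
have cS : c \in sgroup by apply/sgroupP.
have cO := sgraph_orth cS; have cO' := is_orthogonalV cO.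
have yO := is_orthogonalM uO cO'.
have y1 : tcoef (rdiag [set: G]) (u * dbop (sgraph c)) = 1.
  by rewrite tcoef_diag_sgraph_op // as1 -expr2 sqrr_sign.
exists c => //; exists (u * dbop (sgraph c)); split=> //.
  rewrite sgraphC // -mulrA; have /is_orthogonalP[_ ->] := cO.
  by rewrite mulr1.
have /is_orthogonalP[yy _] := yO.
have [M [fM aM1 aN]] := tcoef_orth_full cG yy.
have fD : full (rdiag [set: G]) by rewrite -autgraph1 full_autgraph ?group1.
(* The only full relation with a nonzero coefficient is the diagonal. *)
have MD : M = rdiag [set: G].
  by apply/eqP; apply: contra_eqT y1; rewrite eq_sym => /(aN _ fD) ->.
by move=> N fN neq; apply: aN => //; rewrite MD.
Qed.

End SignedAut.

(** * Reduction to a quotient by the subgroup of order p *)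
Section Reduction.
Local Open Scope group_scope.
Local Open Scope ring_scope.
Variables (p : nat) (G : finGroupType).
Hypotheses (p_prime : prime p) (cycG : cyclic [set: G]) (pG : p.-group [set: G]).
Let cG := cyclic_mulgC cycG.
Implicit Types (L : {group G * G}) (u y v : double_burnside G).

(** The orthogonal units congruent to 1 modulo the bisets that factor through proper
    sections of G. *)
Definition unipotent y := [/\ is_orthogonal y, tcoef (rdiag [set: G]) y = 1 &
    forall L, full L -> L != rdiag [set: G] -> tcoef L y = 0].

Lemma full_ropp L : full L -> full (ropp L).
Proof.
by case/fullE=> f fA ->; rewrite ropp_autgraph // full_autgraph ?groupV.
Qed.

Lemma unipotent_op y : unipotent y -> unipotent (dbop y).
Proof.
case=> yO y1 y0; split; first exact: is_orthogonalV.
  by rewrite (tcoef_bop cG cG) ropp_rdiag.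
move=> L /full_ropp fL neq; rewrite (tcoef_bop cG cG) y0 //.
by apply: contraNneq neq => e; rewrite -[L]roppK e ropp_rdiag.
Qed.

Lemma unipotent_sub1 y v : v = y - 1 -> unipotent y ->
  v * dbop v + v + dbop v = 0 /\ forall L, full L -> tcoef L v = 0.
Proof.
move=> vE [/is_orthogonalP[y1 _] yD y0]; split; last first.
  move=> L fL; rewrite vE tcoefB // tcoef1 //.
  by have [->|neq] := eqVneq L (rdiag [set: G]); rewrite ?yD ?subrr // y0.
have gset_diff : y = 1 + v by rewrite vE addrC subrK.
apply: (addrI 1); rewrite addr0 -[RHS]y1 gset_diff dbopD dbop1.
by rewrite mulrDl mul1r mulrDr mulr1 [X in 1 + X]addrC -!addrA (addrC v).
Qed.

Lemma exists_order_p : [set: G] != 1%g -> exists z : G, #[z]%g = p.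
Proof.
move=> G1; have p_dvd : (p %| #|[set: G]|)%N.
  have [a e] := p_natP pG; rewrite e; case: a e => [|a e]; last exact: dvdn_exp.
  by move=> e; case/eqP: G1; apply: card1_trivg.
by have [z _ oz] := Cauchy p_prime p_dvd; exists z.
Qed.

Variable z : G.
Hypothesis oz : #[z]%g = p.
Let N := <[z]>%G.
Let G1 : [set: G] != 1%g.
Proof.
apply: contraTneq (prime_gt1 p_prime) => e.
rewrite -oz orderE; have : <[z]> \subset [set: G] by apply: subsetT.
by rewrite e => /trivgP ->; rewrite cards1.
Qed.

(** If the coefficients of y - 1 vanish at the relations with trivial left kernel, and
    also at those with trivial right kernel, then all remaining relations have both
    kernels above N, and y - 1 lives in the corner of the idempotent [rcong]. *)
Lemma faithful_eq0_infl y : is_orthogonal y ->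
  (forall L, injl L -> tcoef L (y - 1) = 0) ->
  (forall L, injl L -> tcoef L (dbop y - 1) = 0) ->
  exists2 w : double_burnside (coset_of N), is_orthogonal w & y = infl cG w.
Proof.
move=> /is_orthogonalP[y1 y2].
have eK (x : double_burnside G) : (forall L, injl L -> tcoef L x = 0) ->
    dcls (rcong N cG) * x = x.
  move=> x0; apply: rcong_mul => // L xL n nN.
  have : ~~ injl L by apply: contraNN xL => /x0 ->.
  rewrite negb_forall => /existsP[g]; rewrite negb_imply => /andP[gL g1].
  have kP : group_set [set g | (g, 1%g) \in L].
    apply/group_setP; split=> [|a b]; rewrite !inE; first exact: group1.
    by move=> aL bL; have := groupM aL bL; rewrite mulg_pair /= mulg1.
  have /subsetP/(_ n nN) : <[z]> \subset Group kP.
    apply: (order_p_sub p_prime cycG pG oz); apply: contraNneq g1 => e.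
    by rewrite -in_set1 -[[set 1%g]]/(gval 1%G) -e inE.
  by rewrite inE.
move=> /eK e1 /eK e2.
have e3 : (y - 1) * dcls (rcong N cG) = y - 1.
  have := congr1 (@dbop G) e2; rewrite dbopM dbopB dbop1 dbopK.
  rewrite (_ : dbop (dcls (rcong N cG)) = dcls (rcong N cG)) //.
  by rewrite -(binf_def N cG) /dbop bop_comp bopK.
have yw : y = infl cG (1 + res cG (y - 1) : double_burnside (coset_of N)).
  by rewrite /infl [1 + res _ _]addrC addrK resK // addrC subrK.
exists (1 + res cG (y - 1)) => //; move: (1 + _) yw => w yw.
apply/is_orthogonalP; split; apply: (@infl_inj G N cG).
  by rewrite (inflM cG) (infl_op cG) -yw infl1 y1.
by rewrite (inflM cG) (infl_op cG) -yw infl1 y2.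
Qed.

Lemma is_orthogonal_infl (w : double_burnside (coset_of N)) : is_orthogonal w ->
  is_orthogonal (infl cG w : double_burnside G).
Proof.
move=> /is_orthogonalP[w1 w2]; apply/is_orthogonalP.
by rewrite -(infl_op cG) -!(inflM cG) w1 w2 infl1.
Qed.

Lemma tcoef_infl L (w : double_burnside (coset_of N)) : injl L ->
  tcoef L (infl cG w : double_burnside G) = (L == rdiag [set: G])%:Z.
Proof.
move=> iL; rewrite /infl tcoefD // tcoef1 // -rcong_ext // tcoef_rcong_mul ?addr0 //.
by rewrite cycle_eq1 -order_eq1 oz; case: p p_prime => [|[|]].
Qed.

Hypothesis p_odd : odd p.

Lemma unipotent_infl y : unipotent y -> tcoef (rdiag 1) y = 0 ->
  exists2 w : double_burnside (coset_of N), is_orthogonal w & y = infl cG w.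
Proof.
have D1 : 1%G != [set: G]%G by rewrite eq_sym -val_eqE.
have key x : unipotent x -> tcoef (rdiag 1) x = 0 ->
    forall L, injl L -> tcoef L (x - 1) = 0.
  move=> ux x0; have [vO vF] := unipotent_sub1 erefl ux.
  apply: (tcoef_pr1_1 p_prime cycG pG vO p_odd vF).
  rewrite tcoefB // tcoef1 // x0 sub0r; case: eqP => // /rdiag_inj/eqP.
  by rewrite (negbTE D1).
move=> uy y0; have [yO _ _] := uy; apply: faithful_eq0_infl => //; first exact: key.
by apply: key; rewrite ?(tcoef_bop cG cG) ?ropp_rdiag //; apply: unipotent_op.
Qed.

Lemma unipotent_ineq y (b := tcoef (rdiag 1) y) : unipotent y ->
  (p.-1 * (#|G| %/ p))%N%:Z * (b * b) + 2 * b <= 0.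
Proof.
have D1 : 1%G != [set: G]%G by rewrite eq_sym -val_eqE.
move=> uy; have [vO vF] := unipotent_sub1 erefl uy.
have -> : b = tcoef (rdiag 1) (y - 1).
  rewrite tcoefB // tcoef1 //; case: eqP => [/rdiag_inj/eqP|_]; last by rewrite subr0.
  by rewrite (negbTE D1).
exact: (tcoef_diag1_ineq p_prime cycG pG vO p_odd vF G1).
Qed.

(** The default value 1 only serves pairs whose second component is not an
    automorphism. *)
Definition osgraph c : orthogonal_units G := insubd (ortho_one G) (sgraph c).
Lemma val_osgraph c : c \in sgroup G -> val (osgraph c) = sgraph c.
Proof. by move=> cS; rewrite insubdK // [_ \in _]sgraph_orth. Qed.

Definition oinfl (w : orthogonal_units (coset_of N)) : orthogonal_units G :=
  exist _ (infl cG (val w)) (is_orthogonal_infl (valP w)).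

Lemma osgraphM : {in sgroup G &, {morph osgraph : c d / (c * d)%g}}.
Proof.
move=> c d cS dS; apply: val_inj; rewrite val_osgraph ?groupM //.
by rewrite sgraphM // -!val_osgraph.
Qed.

Lemma oinflM : {morph oinfl : x y / (x * y)%g}.
Proof. by move=> x y; apply: val_inj; rewrite /= inflM. Qed.

Lemma osgraph_oinfl c w : c \in sgroup G -> osgraph c = oinfl w -> c = 1%g /\ w = 1%g.
Proof.
move=> cS e; have {}e : sgraph c = infl cG (val w) by rewrite -val_osgraph // e.
have c1 : c = 1%g.
  by apply: (sgraph_diag_eq1 cycG) => //; rewrite e tcoef_infl ?injl_rdiag ?eqxx.
split=> //; apply: val_inj; apply: (@infl_inj G N cG); rewrite infl1 -e c1.
exact: sgraph1.
Qed.

(** The numerical hypothesis rules out a nonzero coefficient at 1 x 1; for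
    odd p it holds unless |G| = 3. *)
Lemma reduction (bT : finGroupType) (B : {group bT}) :
  (3 <= p.-1 * (#|G| %/ p))%N ->
  group_iso (orthogonal_units (coset_of N)) B ->
  group_iso (orthogonal_units G) (setX_group (sgroup G) B).
Proof.
move=> q3; apply: group_iso_prod oinflM _ _ _; first exact: osgraphM.
- by move=> c w cS; apply: val_inj; rewrite /= val_osgraph // sgraphC.
- move=> u; have [c cS [y [ucy yO yD y0]]] := orth_sgraph cycG (valP u).
  have uy : unipotent y by [].
  have b0 := @quad_le0 (p.-1 * (#|G| %/ p))%N%:Z _ q3 (unipotent_ineq uy).
  have [w wO yw] := unipotent_infl uy b0.
  exists c, (exist _ w wO); split=> //; apply: val_inj.
  by rewrite /= val_osgraph // ucy yw.
exact: osgraph_oinfl.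
Qed.

End Reduction.

(** * Groups of prime order *)
Section Rectangles.
Local Open Scope group_scope.
Variables G H : finGroupType.
Implicit Types (A : {group G}) (B : {group H}).

Lemma pr1_setX A B : pr1 (setX_group A B) = A.
Proof.
apply/val_inj/setP => g; apply/pr1P/idP => [[h]|gA]; first by rewrite in_setX => /andP[].
by exists 1; rewrite in_setX gA group1.
Qed.
Lemma pr2_setX A B : pr2 (setX_group A B) = B.
Proof.
apply/val_inj/setP => h; apply/pr2P/idP => [[g]|hB]; first by rewrite in_setX => /andP[].
by exists 1; rewrite in_setX hB group1.
Qed.
Lemma ropp_setX A B : ropp (setX_group A B) = setX_group B A.
Proof. by apply/val_inj/setP => -[h g]; rewrite mem_ropp !in_setX andbC. Qed.
Lemma rcomp_setX (K : finGroupType) A B B' (C : {group K}) :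
  rcomp (setX_group A B) (setX_group B' C) = setX_group A C.
Proof.
apply/val_inj/setP => -[g k]; apply/rcompP/idP; rewrite in_setX /=.
  by case=> h; rewrite !in_setX => -[/andP[/= -> _] /andP[_ ->]].
by case/andP=> gA kC; exists 1; rewrite !in_setX gA kC !group1.
Qed.
End Rectangles.

Lemma setX_group_inj (G H : finGroupType) (A A' : {group G}) (B B' : {group H}) :
  setX_group A B = setX_group A' B' -> A = A' /\ B = B'.
Proof.
move=> e; have := congr1 (@pr1 G H) e; have := congr1 (@pr2 G H) e.
by rewrite !pr1_setX !pr2_setX.
Qed.

Section PrimeOrder.
Local Open Scope group_scope.
Local Open Scope ring_scope.
Variable G : finGroupType.
Hypothesis prG : prime #|[set: G]|.
Let cycG := prime_cyclic prG.
Let cG := cyclic_mulgC cycG.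
Implicit Types (L : {group G * G}) (A B C D : {group G}) (u y : double_burnside G).
Local Notation GG := [set: G]%G.

Lemma oneG_neq : (1%G == GG) = false.
Proof.
apply/eqP => e; have := prG; rewrite -[[set: G]]/(gval GG) -e cards1.
by [].
Qed.

Lemma subgroupP A : A = 1%G \/ A = GG.
Proof.
have [s|e] := prime_subgroupVti A prG; [right|left]; apply/val_inj.
  by apply/eqP; rewrite eqEsubset subsetT.
by rewrite /= -e setIT.
Qed.

Lemma sum_subgroups (V : nmodType) (F : {group G} -> V) : \sum_A F A = F 1%G + F GG.
Proof.
rewrite (bigD1 1%G) // (bigD1 GG) 1?eq_sym ?oneG_neq //= big1 ?addr0 //.
by move=> A /andP[A1 AG]; case: (subgroupP A) A1 AG => ->; rewrite eqxx.
Qed.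

Lemma full_or_setX L : full L \/ L = setX_group (pr1 L) (pr2 L).
Proof.
have LX : L \subset setX_group (pr1 L) (pr2 L).
  apply/subsetP => -[g h] gh; rewrite in_setX; apply/andP; split.
    by apply/pr1P; exists h.
  by apply/pr2P; exists g.
have [iL|] := boolP (injl L); last first.
  rewrite negb_forall => /existsP[g]; rewrite negb_imply => /andP[gL g1]; right.
  apply/val_inj/eqP; rewrite eqEsubset LX; apply/subsetP => -[a h].
  rewrite in_setX => /andP[_ /pr2P[b bh]].
  have /cycleP[i e] : (a * b^-1)%g \in <[g]>%g.
    have [|e] := subgroupP <[g]>%G.
      by move/(congr1 val)/eqP; rewrite /= cycle_eq1 (negbTE g1).
    by rewrite -[<[g]>%g]/(gval <[g]>%G) e inE.
  have iL : ((a * b^-1)%g, 1%g) \in L.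
    rewrite e; suff -> : ((g ^+ i, 1 : G) = (g, 1) ^+ i)%g by apply: groupX.
    by elim: i {e} => // i IH; rewrite !expgS -IH mulg_pair /= mulg1.
  by have := groupM iL bh; rewrite mulg_pair /= mulgKV mul1g.
have [p1|p1] := subgroupP (pr1 L); last by left; apply/fullP.
right; apply/val_inj/eqP; rewrite eqEsubset LX p1; apply/subsetP => -[a h].
rewrite in_setX => /andP[/set1P -> /pr2P[b bh]].
have : b \in pr1 L by apply/pr1P; exists h.
by rewrite p1 => /set1P e; rewrite -e.
Qed.

Lemma not_full_setX A B : full (setX_group A B) = false.
Proof.
apply/fullP => -[/injlP i p1]; move: p1 i; rewrite pr1_setX => -> i.
have /cyclicP[g gG] := cycG; have := i g; rewrite in_setX inE group1 => /(_ isT) g1.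
by have := prG; rewrite gG g1 cycle1 cards1.
Qed.

Lemma rect_sum u (a : int) : (forall L, full L -> tcoef L u = a * (L == rdiag [set: G])%:Z) ->
  u = a%:~R + \sum_A \sum_B dcls (setX_group A B) *~ tcoef (setX_group A B) u.
Proof.
move=> uF; apply: (tcoef_inj cG cG) => L; rewrite tcoefD //.
rewrite tcoefMz // tcoef1 // mulrC tcoef_sumr //.
have rectE A : tcoef L (\sum_B dcls (setX_group A B) *~ tcoef (setX_group A B) u) =
   \sum_B (L == setX_group A B)%:Z * tcoef (setX_group A B) u.
  by rewrite tcoef_sumr //; apply: eq_bigr => C _; rewrite tcoefMz // tcoef_tcls.
rewrite (eq_bigr _ (fun A _ => rectE A)) {rectE}.
case: (full_or_setX L) => [fL|eL].
  rewrite uF // big1 ?addr0 // => A _; rewrite big1 // => B _.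
  by case: eqP => [e|]; rewrite ?mul0r //; rewrite e not_full_setX in fL.
have -> : (L == rdiag [set: G]) = false.
  apply/eqP => e; have := full_autgraph (group1 (Aut_group [set: G])).
  by rewrite autgraph1 -e eL not_full_setX.
rewrite mulr0 add0r.
pose F A B : int := (L == setX_group A B)%:Z * tcoef (setX_group A B) u.
rewrite -[RHS]/(\sum_A \sum_B F A B).
have F1 : F (pr1 L) (pr2 L) = tcoef L u by rewrite /F -eL eqxx mul1r.
rewrite (bigD1 (pr1 L)) //= (bigD1 (pr2 L)) //= F1.
rewrite big1 => [|B neB]; last first.
  rewrite /F; case: eqP => [e|]; rewrite ?mul0r //.
  by rewrite e pr2_setX eqxx in neB.
rewrite addr0 big1 ?addr0 // => A neA; rewrite big1 // => B _.
rewrite /F; case: eqP => [e|]; rewrite ?mul0r //.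
by rewrite e pr1_setX eqxx in neA.
Qed.

Local Notation T := 'I_1.
Let cT : commutative (@mulg T).
Proof. by move=> x y; rewrite [x]ord1 [y]ord1. Qed.

(** The class of the G-set G/A, viewed as a biset for the trivial group. *)
Definition gset A : burnside G T := tcls (setX_group A 1%G).

(** The number of orbits on G/A x G/B. *)
Lemma gset_form A B : bcomp (bop (gset A)) (gset B) = bcls (bid T) *+ #|[set: G] : A <*> B|.
Proof.
rewrite /gset (bop_tcls cG cT) ropp_setX (bcomp_tcls cT cG cT) rcomp_setX /mid.
rewrite pr1_setX pr2_setX; congr (_ *+ _).
rewrite -[RHS]/(1%R : double_burnside T) (db1E cT); congr tcls.
apply/val_inj/setP => -[x y]; rewrite [x]ord1 [y]ord1.
have -> : (0, 0) \in rdiag [set: T] by apply/rdiagP; rewrite inE.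
by rewrite in_setX !group1.
Qed.

Lemma gset_rect A B : bcomp (gset A) (bop (gset B)) = tcls (setX_group A B).
Proof.
rewrite /gset (bop_tcls cG cT) ropp_setX (bcomp_tcls cG cT cG) rcomp_setX /mid.
rewrite (_ : #|_ : _| = 1%N) // ; apply/eqP; rewrite indexg_eq1; apply/subsetP => x _.
by rewrite [x]ord1 group1.
Qed.

(** Orthogonal to [G/G] for the form of [gset_form], of norm |G| - 1. *)
Definition gset_diff : burnside G T := gset 1%G - gset GG.

Lemma gdiff_form_gset A :
  bcomp (bop gset_diff) (gset A) = bcls (bid T) *+ ((A == 1%G) * #|G|.-1).
Proof.
rewrite /gset_diff bopB bcompBl !gset_form.
have iG (B : {group G}) : #|[set: G] : GG <*> B|%g = 1%N.
  by apply/eqP; rewrite indexg_eq1 joing_subl.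
rewrite iG; have [->|->] := subgroupP A; last first.
  by rewrite eq_sym oneG_neq (_ : #|_ : _|%g = 1%N) ?subrr // joingC iG.
rewrite eqxx mul1n (_ : #|_ : _|%g = #|G|); last first.
  by rewrite joingE setUid genGid indexg1 cardsT.
by rewrite -mulrnBr ?subn1 // -cardsT cardG_gt0.
Qed.

Lemma gset_diff_form : bcomp (bop gset_diff) gset_diff = bcls (bid T) *+ #|G|.-1.
Proof. by rewrite {2}/gset_diff bcompBr !gdiff_form_gset eqxx eq_sym oneG_neq mul1n subr0. Qed.

(** The rank one endomorphism x |-> <y, x> y for y = [gset_diff]. *)
Definition diff_sqr : double_burnside G := bcomp gset_diff (bop gset_diff).

Lemma bcompMn (A B C : finGroupType) (u : burnside A B) (v : burnside B C) n :
  bcomp u (v *+ n) = bcomp u v *+ n.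
Proof. exact: (raddfMn (bcomp u)). Qed.
Lemma bcompMnl (A B C : finGroupType) (u : burnside A B) (v : burnside B C) n :
  bcomp (u *+ n) v = bcomp u v *+ n.
Proof. exact: (raddfMn (bcompr v)). Qed.

Lemma diff_sqr_op : dbop diff_sqr = diff_sqr.
Proof. by rewrite /dbop /diff_sqr bop_comp bopK. Qed.

Lemma diff_sqrM : diff_sqr * diff_sqr = diff_sqr *+ #|G|.-1.
Proof.
rewrite db_mulE /diff_sqr -bcompA (bcompA (bop gset_diff)) gset_diff_form bcompMnl bcompMn.
by rewrite bcomp1u.
Qed.

Definition diff_gset B : double_burnside G := bcomp gset_diff (bop (gset B)).

Lemma diff_gsetE B : diff_gset B = dcls (setX_group 1%G B) - dcls (setX_group GG B).
Proof. by rewrite /diff_gset /gset_diff bcompBl !gset_rect. Qed.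

Lemma diff_sqrE : diff_sqr = diff_gset 1%G - diff_gset GG.
Proof. by rewrite /diff_sqr {2}/gset_diff bopB bcompBr. Qed.

Lemma diff_sqr_rect A B :
  diff_sqr * dcls (setX_group A B) = diff_gset B *+ ((A == 1%G) * #|G|.-1).
Proof.
rewrite db_mulE /diff_sqr -gset_rect -bcompA (bcompA (bop gset_diff)) gdiff_form_gset.
by rewrite bcompMnl bcompMn bcomp1u.
Qed.

Lemma diff_sqr_rectz A B (c : int) : diff_sqr * (dcls (setX_group A B) *~ c) =
  diff_gset B *~ (((A == 1%G) * #|G|.-1)%N%:Z * c).
Proof. by rewrite [LHS]mulrzAr diff_sqr_rect pmulrn -mulrzA. Qed.

Lemma tcoef_rect_full A B L x : full L -> tcoef L (dcls (setX_group A B) * x) = 0.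
Proof.
move=> /fullP[/injlP iL p1L]; rewrite [LHS](tcoef_bcomp cG cG cG) big1 // => M _.
rewrite big1 // => M' _; rewrite tcoef_tcls //.
case: eqP => [->|_]; last by rewrite !mul0r.
case: eqP => [e|_]; last by rewrite !mulr0.
have /cyclicP[g gG] := cycG; have g1 : g != 1%g.
  by apply: contraTneq prG => g1; rewrite gG g1 cycle1 cards1.
case/eqP: g1; apply: iL.
have : g \in pr1 L by rewrite p1L inE.
rewrite -e => /pr1P[h /rcompP[k []]] /=; rewrite in_setX => /andP[gA _] _.
by apply/rcompP; exists 1%g; rewrite in_setX gA !group1.
Qed.

Lemma tcoef_diff_sqr_full L x : full L -> tcoef L (diff_sqr * x) = 0.
Proof.
move=> fL; rewrite diff_sqrE !diff_gsetE !mulrBl !(tcoefB cG cG).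
by rewrite !(tcoef_rect_full _ _ _ fL) !subrr.
Qed.

Lemma rdiag1_setX : rdiag 1 = setX_group 1%G 1%G :> {group G * G}.
Proof.
apply/val_inj/setP => -[g h]; rewrite in_setX; apply/rdiagP/andP.
  by case=> -> /set1P ->; rewrite group1.
by case=> /set1P -> /set1P ->; rewrite group1.
Qed.

Lemma tcoef_setX A B C D :
  tcoef (setX_group A B) (dcls (setX_group C D)) = ((A == C) && (B == D))%:Z.
Proof.
rewrite tcoef_tcls //; case: eqP => [/setX_group_inj[-> ->]|neq]; first by rewrite !eqxx.
by case: eqP => // e; case: eqP => // e'; case: neq; rewrite e e'.
Qed.

Lemma tcoef_diff_gset B : tcoef (rdiag 1) (diff_gset B) = (B == 1%G)%:Z.
Proof.
by rewrite rdiag1_setX diff_gsetE tcoefB // !tcoef_setX eqxx oneG_neq subr0 eq_sym.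
Qed.

Lemma tcoef_diff_sqr : tcoef (rdiag 1) diff_sqr = 1.
Proof. by rewrite diff_sqrE tcoefB // !tcoef_diff_gset eqxx eq_sym oneG_neq. Qed.

(** The left factor only sees the rectangles 1 x B of y, each of which is multiplied by
    the norm |G| - 1 of [gset_diff]. *)
Lemma tcoef_diff_sqr_unipotent y : unipotent y ->
  tcoef (rdiag 1) (diff_sqr * y) = 1 + (#|G|.-1)%:Z * tcoef (rdiag 1) y.
Proof.
case=> yO yD y0; have fy L : full L -> tcoef L y = 1 * (L == rdiag [set: G])%:Z.
  by move=> fL; rewrite mul1r; case: eqP => [->//|/eqP]; apply: y0.
rewrite {1}(rect_sum fy) mulrDr mulr1 tcoefD // tcoef_diff_sqr; congr (_ + _).
rewrite mulr_sumr tcoef_sumr //.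
rewrite (eq_bigr (fun A => \sum_B (B == 1%G)%:Z *
    (((A == 1%G) * #|G|.-1)%N%:Z * tcoef (setX_group A B) y))).
  rewrite !sum_subgroups eqxx [GG == _]eq_sym oneG_neq rdiag1_setX.
  by rewrite mul1n mul0n !mul0r !mulr0 !addr0 mul1r.
move=> A _; rewrite mulr_sumr tcoef_sumr //; apply: eq_bigr => B _.
by rewrite diff_sqr_rectz tcoefMz // tcoef_diff_gset.
Qed.

End PrimeOrder.

(** * The group of order three *)
Section OrderThree.
Local Open Scope group_scope.
Local Open Scope ring_scope.
Variable G : finGroupType.
Hypothesis card3 : #|[set: G]| = 3%N.
Let prG : prime #|[set: G]|. Proof. by rewrite card3. Qed.
Let cycG := prime_cyclic prG.
Let cG := cyclic_mulgC cycG.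
Let pG : 3.-group%N [set: G]. Proof. by rewrite /pgroup card3. Qed.
Variable z : G.
Hypothesis oz : #[z]%g = 3%N.
Let N := <[z]>%G.
Implicit Types (L : {group G * G}) (A B C D : {group G}) (u y : double_burnside G).
Local Notation GG := [set: G]%G.
Local Notation w := (diff_sqr G).

Let NG : N = GG.
Proof.
have [e|//] := subgroupP prG N; have := oz; rewrite orderE -[<[z]>%g]/(gval N) e cards1.
by [].
Qed.

Let cardG : #|G| = 3%N. Proof. by rewrite -cardsT. Qed.

(** As [gset_diff] has norm 2, this is the reflection along it. *)
Definition reflection : double_burnside G := 1 - w.

Lemma reflection_diff : reflection * w = - w.
Proof. by rewrite /reflection mulrBl mul1r diff_sqrM // cardG mulr2n opprD addNKr. Qed.

Lemma reflectionM : reflection * reflection = 1.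
Proof. by rewrite {2}/reflection mulrBr mulr1 reflection_diff opprK subrK. Qed.

Lemma reflection_op : dbop reflection = reflection.
Proof. by rewrite dbopB dbop1 diff_sqr_op. Qed.

Lemma reflection_orth : is_orthogonal reflection.
Proof. by apply/is_orthogonalP; rewrite reflection_op reflectionM. Qed.

Lemma reflection_unipotent y : unipotent y -> unipotent (reflection * y).
Proof.
case=> yO yD y0; have tE L : full L -> tcoef L (reflection * y) = tcoef L y.
  by move=> fL; rewrite mulrBl mul1r tcoefB // tcoef_diff_sqr_full // subr0.
have fD : full (rdiag [set: G]) by rewrite -autgraph1 full_autgraph ?group1.
split; first exact: is_orthogonalM reflection_orth yO.
  by rewrite tE.
by move=> L fL neq; rewrite tE // y0.
Qed.

Lemma rcong_setX : rcong N cG = setX_group GG GG.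
Proof.
apply/val_inj/setP => -[g h]; have -> : (g, h) \in rcong N cG.
  by apply/rcongP; rewrite !coset_id // NG inE.
by rewrite in_setX !inE.
Qed.

Lemma diff_sqr_infl (x : double_burnside (coset_of N)) : w * infl cG x = w.
Proof.
rewrite /infl mulrDr mulr1 -rcong_ext mulrA rcong_setX diff_sqr_rect //.
by rewrite eq_sym oneG_neq // mul0n mulr0n mul0r addr0.
Qed.

Lemma infl_diff_sqr (x : double_burnside (coset_of N)) : infl cG x * w = w.
Proof.
by rewrite -[LHS]dbopK dbopM diff_sqr_op -infl_op diff_sqr_infl diff_sqr_op.
Qed.

(** The inequality on b allows b = 0 and b = -1, and the reflection changes b to
    -1 - b. *)
Lemma unipotent_order3 y : unipotent y ->
  tcoef (rdiag 1) y = 0 \/ tcoef (rdiag 1) (reflection * y) = 0.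
Proof.
move=> uy; have := unipotent_ineq (p := 3) isT cycG pG oz isT uy.
rewrite cardG mulrBl mul1r tcoefB // tcoef_diff_sqr_unipotent // cardG /=.
rewrite (_ : (2 * (3 %/ 3))%N%:Z = 2) //; move: (tcoef _ y) => b.
nia.
Qed.

Definition sgraph3 (c : ('Z_2 * {perm G}) * 'Z_2) := sgraph c.1 * reflection ^+ c.2.
Definition sgroup3 := setX_group (sgroup G) (Zp_group 2).

Lemma sgroup3P c : reflect (c.1 \in sgroup G) (c \in sgroup3).
Proof.
case: c => c s; rewrite in_setX [X in _ && X]inE andbT; exact: idP.
Qed.

Definition osgraph3 c : orthogonal_units G := insubd (ortho_one G) (sgraph3 c).

Lemma reflection_exp (s t : 'Z_2) :
  reflection ^+ (s * t)%g = reflection ^+ s * reflection ^+ t.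
Proof.
rewrite -exprD; case: s => -[|[|//]] ?; case: t => -[|[|//]] ? //=.
by rewrite expr2 reflectionM.
Qed.

Lemma val_osgraph3 c : c \in sgroup3 -> val (osgraph3 c) = sgraph3 c.
Proof.
move=> /sgroup3P cS; rewrite insubdK // [_ \in _]is_orthogonalM ?sgraph_orth //.
case: c.2 => -[|[|//]] ? /=; first exact: is_orthogonal1.
by rewrite expr1 reflection_orth.
Qed.

Lemma osgraph3M : {in sgroup3 &, {morph osgraph3 : c d / (c * d)%g}}.
Proof.
move=> c d cS dS; apply: val_inj; rewrite /= !val_osgraph3 ?groupM //.
move: cS dS => /sgroup3P cS /sgroup3P dS; rewrite /sgraph3 /= sgraphM // reflection_exp.
have := sgraphC cycG (reflection ^+ c.2) dS.
move: (sgraph c.1) (sgraph d.1) (reflection ^+ c.2) (reflection ^+ d.2) => a b x y bx.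
by rewrite -!mulrA (mulrA b x) bx -!mulrA.
Qed.

Lemma reduction3 (bT : finGroupType) (B : {group bT}) :
  group_iso (orthogonal_units (coset_of N)) B ->
  group_iso (orthogonal_units G) (setX_group sgroup3 B).
Proof.
apply: group_iso_prod (oinflM cycG (z := z)) _ _ _; first exact: osgraph3M.
- move=> c x cS; apply: val_inj; rewrite /= val_osgraph3 //.
  have /sgroup3P cS1 := cS; rewrite /sgraph3 -mulrA [RHS]mulrA -sgraphC // -mulrA.
  congr (_ * _); case: c.2 => -[|[|//]] ? /=; first by rewrite mulr1 mul1r.
  by rewrite expr1 mulrBl mulrBr mul1r mulr1 diff_sqr_infl infl_diff_sqr.
- move=> u; have [c cS [y [ucy yO yD y0]]] := orth_sgraph cycG (valP u).
  have uy : unipotent y by [].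
  have [b0|b0] := unipotent_order3 uy.
    have [x xO yx] := unipotent_infl (p := 3) isT cycG pG oz isT uy b0.
    exists (c, 0), (exist _ x xO); split; first exact/sgroup3P.
    apply: val_inj; rewrite /= val_osgraph3; last exact/sgroup3P.
    by rewrite /sgraph3 /= mulr1 -yx.
  have ry := reflection_unipotent uy.
  have [x xO yx] := unipotent_infl (p := 3) isT cycG pG oz isT ry b0.
  exists (c, 1), (exist _ x xO); split; first exact/sgroup3P.
  apply: val_inj; rewrite /= val_osgraph3; last exact/sgroup3P.
  by rewrite /sgraph3 /= expr1 -yx -mulrA (mulrA reflection) reflectionM mul1r.
move=> c x cS e; have {}e : sgraph3 c = infl cG (val x) by rewrite -val_osgraph3 // e.
have /sgroup3P cS1 := cS.
have fD : full (rdiag [set: G]) by rewrite -autgraph1 full_autgraph ?group1.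
(* The reflection only changes coefficients at rectangles, so the diagonal still
   detects the signed automorphism, and the coefficient at 1 x 1 the reflection. *)
have e1 : tcoef (rdiag [set: G]) (sgraph3 c) = tcoef (rdiag [set: G]) (sgraph c.1).
  rewrite /sgraph3 sgraphC //; case: c.2 => -[|[|//]] ? /=; first by rewrite mul1r.
  by rewrite expr1 mulrBl mul1r tcoefB // tcoef_diff_sqr_full // subr0.
have c1 : c.1 = 1%g.
  apply: (sgraph_diag_eq1 cycG) => //.
  by rewrite -e1 e (@tcoef_infl 3 G isT cycG z oz) ?injl_rdiag ?eqxx.
case: c c1 e {cS cS1 e1} => c s /= -> e; rewrite /sgraph3 /= sgraph1 // mul1r in e.
have := congr1 (tcoef (rdiag 1)) e; rewrite (@tcoef_infl 3 G isT cycG z oz) ?injl_rdiag //.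
have -> : (rdiag 1 == rdiag [set: G] :> {group G * G}) = false.
  by apply: contraFF (oneG_neq prG) => /eqP/rdiag_inj ->.
case: s e => -[|[|//]] i /= e; last first.
  rewrite expr1 tcoefB // tcoef_diff_sqr // tcoef1 //.
  by have -> : (rdiag 1 == rdiag [set: G] :> {group G * G}) = false by
    apply: contraFF (oneG_neq prG) => /eqP/rdiag_inj ->.
split; first by congr (_, _); apply: val_inj.
by apply: val_inj; apply: (@infl_inj _ N cG); rewrite infl1 /= -e.
Qed.

End OrderThree.

(** * The double Burnside ring of the group of order two *)
Section OrderTwo.
Local Open Scope group_scope.
Local Open Scope ring_scope.
Variable G : finGroupType.
Hypothesis card2 : #|[set: G]| = 2%N.
Let prG : prime #|[set: G]|. Proof. by rewrite card2. Qed.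
Let cycG := prime_cyclic prG.
Let cG := cyclic_mulgC cycG.
Implicit Types (L : {group G * G}) (A B C D : {group G}) (u v : double_burnside G).
Implicit Types (s t : int) (M : 'M[int]_2).
Local Notation GG := [set: G]%G.
Local Notation T := 'I_1.
Let cT : commutative (@mulg T).
Proof. by move=> x y; rewrite [x]ord1 [y]ord1. Qed.

(** For |G| = 2 an orthonormal basis of B(G, 1). *)
Definition ortho_vec (i : 'I_2) : burnside G T := if i == 0 then gset_diff G else gset GG.

Lemma ortho_vec_form i j : bcomp (bop (ortho_vec i)) (ortho_vec j) = bcls (bid T) *+ (i == j).
Proof.
have c1 : #|G|.-1 = 1%N by rewrite -cardsT card2.
have yx : bcomp (bop (gset_diff G)) (gset GG) = 0.
  by rewrite gdiff_form_gset // eq_sym oneG_neq // mulr0n.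
rewrite /ortho_vec; case: (unliftP 0 i) => [i' ->|->]; case: (unliftP 0 j) => [j' ->|->] //=.
- rewrite [i']ord1 [j']ord1 ?eqxx gset_form // (_ : #|_ : _|%g = 1%N) //.
  by apply/eqP; rewrite indexg_eq1 joing_subl.
- by rewrite -[LHS]bopK bop_comp bopK yx -[bop 0]/(dbop (0 : double_burnside T))
    -[0 in LHS](subrr 1) dbopB subrr.
by rewrite ?eqxx gset_diff_form // c1.
Qed.

Definition mx_unit i j : double_burnside G := bcomp (ortho_vec i) (bop (ortho_vec j)).

Lemma mx_unitM i j k l : mx_unit i j * mx_unit k l = mx_unit i l *+ (j == k).
Proof.
rewrite db_mulE /mx_unit -bcompA (bcompA (bop _)) ortho_vec_form bcompMnl bcompMn.
by rewrite bcomp1u.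
Qed.

Lemma mx_unit_op i j : dbop (mx_unit i j) = mx_unit j i.
Proof. by rewrite /dbop /mx_unit bop_comp bopK. Qed.

Definition emb_mx M : double_burnside G := \sum_i \sum_j mx_unit i j *~ M i j.

Lemma emb_mxD : {morph emb_mx : M N / M + N}.
Proof.
move=> M N; rewrite /emb_mx -big_split; apply: eq_bigr => i _.
by rewrite -big_split; apply: eq_bigr => j _; rewrite mxE mulrzDr.
Qed.

Lemma mx_unitMz i j k l (a b : int) :
  (mx_unit i j *~ a) * (mx_unit k l *~ b) = mx_unit i l *~ ((j == k)%:Z * (a * b)).
Proof.
rewrite [LHS](bcompMz (mx_unit i j) (mx_unit k l)).
rewrite -[bcomp _ _]/(mx_unit i j * mx_unit k l) mx_unitM.
by rewrite pmulrn -mulrzA.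
Qed.

Lemma emb_mxM M N : emb_mx (M *m N) = emb_mx M * emb_mx N.
Proof.
rewrite /emb_mx mulr_suml; apply: eq_bigr => i _; rewrite mulr_suml.
transitivity (\sum_j \sum_l mx_unit i l *~ (M i j * N j l)).
  rewrite exchange_big; apply: eq_bigr => l _ /=.
  by rewrite mxE mulrz_sumr.
apply: eq_bigr => j _; rewrite mulr_sumr [RHS](bigD1 j) //= [X in _ = _ + X]big1 => [|k kj].
  by rewrite addr0 mulr_sumr; apply: eq_bigr => l _; rewrite mx_unitMz eqxx mul1r.
rewrite mulr_sumr big1 // => l _.
by rewrite mx_unitMz eq_sym (negbTE kj) mul0r mulr0z.
Qed.

Lemma emb_mx_op M : dbop (emb_mx M) = emb_mx M^T.
Proof.
rewrite /emb_mx exchange_big [LHS](bop_sum) /=; apply: eq_bigr => i _.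
rewrite [LHS](bop_sum); apply: eq_bigr => j _.
by rewrite [LHS](bopMz (mx_unit j i)) mxE -[bop _]/(dbop _) mx_unit_op.
Qed.

(** The ring isomorphism from Z x M_2(Z) onto B(G, G): the first component acts on the
    complement of the ideal spanned by the rectangles. *)
Definition Phi s M : double_burnside G := (1 - emb_mx 1%:M) *~ s + emb_mx M.

Lemma PhiM s t M N : Phi s M * Phi t N = Phi (s * t) (M *m N).
Proof.
have e0 X : emb_mx 1%:M * emb_mx X = emb_mx X by rewrite -emb_mxM mul1mx.
have e1 X : emb_mx X * emb_mx 1%:M = emb_mx X by rewrite -emb_mxM mulmx1.
rewrite /Phi; set a := 1 - emb_mx 1%:M.
have a0 X : a * emb_mx X = 0 by rewrite mulrBl mul1r e0 subrr.
have a1 X : emb_mx X * a = 0 by rewrite mulrBr mulr1 e1 subrr.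
have aa : a * a = a by rewrite {2}/a mulrBr mulr1 a0 subr0.
have b0 X k : (a *~ k) * emb_mx X = 0 by rewrite mulrzAl a0 mul0rz.
have b1 X k : emb_mx X * (a *~ k) = 0 by rewrite mulrzAr a1 mul0rz.
rewrite mulrDl !mulrDr b0 b1 addr0 add0r -emb_mxM; congr (_ + _).
by rewrite mulrzAl mulrzAr aa -mulrzA mulrC.
Qed.

Lemma Phi1 : Phi 1 1%:M = 1.
Proof. by rewrite /Phi mulr1z subrK. Qed.

Lemma Phi_op s M : dbop (Phi s M) = Phi s M^T.
Proof.
rewrite /Phi dbopD emb_mx_op; congr (_ + _).
by rewrite [LHS]bopMz -[bop _]/(dbop (1 - emb_mx 1%:M)) dbopB dbop1 emb_mx_op trmx1.
Qed.

Lemma autgraph_order2 f : f \in Aut [set: G] -> f = 1%g.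
Proof.
move=> fA; have [k fk] := Aut_power cycG fA.
have x2 (x : G) : (x ^+ 2 = 1)%g by apply/eqP; rewrite -order_dvdn -card2 order_dvdG ?inE.
apply/permP => x; rewrite perm1 fk -(odd_double_half k) -muln2 mulnC.
rewrite expgD expgM x2 expg1n mulg1.
case: (boolP (odd k)) => [_|ev]; first by rewrite expg1.
have f1 y : f y = 1%g.
  by rewrite fk -(odd_double_half k) (negbTE ev) -muln2 mulnC expgD expgM x2 expg1n mulg1.
by apply: (@perm_inj _ f); rewrite !f1.
Qed.

Definition gset_coord A (i : 'I_2) : int := if i == 0 then (A == 1%G)%:Z else 1.

Lemma gset_coordE A : gset A = \sum_i ortho_vec i *~ gset_coord A i.
Proof.
rewrite big_ord_recl big_ord1 /ortho_vec /gset_coord /= mulr1z.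
have [->|->] := subgroupP prG A; first by rewrite eqxx mulr1z /gset_diff subrK.
by rewrite eq_sym oneG_neq // mulr0z add0r.
Qed.

Lemma rect_emb_mx A B : dcls (setX_group A B) =
  emb_mx (\matrix_(i, j) (gset_coord A i * gset_coord B j)).
Proof.
rewrite -(gset_rect prG) (gset_coordE A) (gset_coordE B) bop_sum bcomp_sum.
apply: eq_bigr => i _; apply: eq_bigr => j _.
by rewrite bopMz bcompMz mxE.
Qed.

Lemma emb_mxZ (a : int) M : emb_mx (a *: M) = emb_mx M *~ a.
Proof.
rewrite /emb_mx mulrz_suml; apply: eq_bigr => i _; rewrite mulrz_suml.
by apply: eq_bigr => j _; rewrite mxE mulrC mulrzA.
Qed.

Lemma tcoef_emb_mx_full L M : full L -> tcoef L (emb_mx M) = 0.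
Proof.
move=> fL; rewrite -[M]mul1mx emb_mxM.
have -> : emb_mx 1%:M = diff_sqr G + dcls (setX_group GG GG).
  rewrite -(gset_rect prG); transitivity (\sum_i mx_unit i i); last first.
    by rewrite big_ord_recl big_ord1.
  apply: eq_bigr => i _; rewrite (bigD1 i) //= big1 => [|k ki].
    by rewrite mxE eqxx addr0.
  by rewrite mxE eq_sym (negbTE ki).
by rewrite mulrDl tcoefD // tcoef_diff_sqr_full // tcoef_rect_full // addr0.
Qed.

Lemma fullD : full (rdiag [set: G]).
Proof. by rewrite -autgraph1 full_autgraph ?group1. Qed.

Lemma tcoef_Phi s M : tcoef (rdiag [set: G]) (Phi s M) = s.
Proof.
rewrite /Phi tcoefD // tcoefMz // tcoefB // !tcoef_emb_mx_full ?fullD // addr0 subr0.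
by rewrite tcoef1 // eqxx mul1r.
Qed.

(** Besides the diagonal all subgroups of G x G are rectangles, which are products of
    combinations of the two basis vectors. *)
Lemma Phi_surj u : exists s M, u = Phi s M.
Proof.
pose s := tcoef (rdiag [set: G]) u.
have uF L : full L -> tcoef L u = s * (L == rdiag [set: G])%:Z.
  case/fullE=> f fA ->; rewrite (autgraph_order2 fA) autgraph1 eqxx mulr1.
  by [].
have [M embE] : exists M,
    emb_mx M = \sum_A \sum_B dcls (setX_group A B) *~ tcoef (setX_group A B) u.
  exists (\sum_A \sum_B (tcoef (setX_group A B) u *:
    \matrix_(i, j) (gset_coord A i * gset_coord B j))).
  have e0 : emb_mx 0 = 0 by apply: (addrI (emb_mx 0)); rewrite -emb_mxD !addr0.
  rewrite (big_morph emb_mx emb_mxD e0); apply: eq_bigr => A _.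
  rewrite (big_morph emb_mx emb_mxD e0); apply: eq_bigr => B _.
  by rewrite emb_mxZ -rect_emb_mx.
have := rect_sum prG uF; rewrite -embE => uE.
exists s, (s *: 1%:M + M); rewrite /Phi emb_mxD emb_mxZ.
move: (emb_mx M) (emb_mx _) uE => m e ->.
by rewrite [RHS]addrA; congr (_ + _); rewrite -[RHS]mulrzDl subrK.
Qed.

Lemma emb_mx_form M i j :
  bcomp (bop (ortho_vec i)) (bcomp (emb_mx M) (ortho_vec j)) = bcls (bid T) *~ M i j.
Proof.
have sl (H K L : finGroupType) (I : finType) (F : I -> burnside H K) (v : burnside K L) :
    bcomp (\sum_i F i) v = \sum_i bcomp (F i) v.
  exact: (raddf_sum (bcompr v)).
have sr (H K L : finGroupType) (I : finType) (u : burnside H K) (F : I -> burnside K L) :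
    bcomp u (\sum_i F i) = \sum_i bcomp u (F i).
  exact: (raddf_sum (bcomp u)).
have ml (H K L : finGroupType) (u : burnside H K) (v : burnside K L) (a : int) :
    bcomp (u *~ a) v = bcomp u v *~ a.
  exact: (raddfMz (bcompr v)).
have mr (H K L : finGroupType) (u : burnside H K) (v : burnside K L) (a : int) :
    bcomp u (v *~ a) = bcomp u v *~ a.
  exact: (raddfMz (bcomp u)).
have E k l : bcomp (bop (ortho_vec i)) (bcomp (mx_unit k l *~ M k l) (ortho_vec j)) =
    bcls (bid T) *~ (((i == k) && (l == j))%:Z * M k l).
  rewrite ml mr /mx_unit -(bcompA (ortho_vec k)) ortho_vec_form.
  rewrite bcompMn bcompu1 bcompMn ortho_vec_form.
  rewrite -mulrnA pmulrn -mulrzA; congr (_ *~ (_ * _)).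
  by case: (i == k); case: (l == j).
transitivity (\sum_k \sum_l bcls (bid T) *~ (((i == k) && (l == j))%:Z * M k l)).
  rewrite /emb_mx sl sr; apply: eq_bigr => k _; rewrite sl sr; apply: eq_bigr => l _.
  exact: E.
move: (bcls (bid T)) => b.
rewrite (bigD1 i) //= [X in _ + X]big1 ?addr0 => [|k ki]; last first.
  by rewrite big1 // => l _; rewrite eq_sym (negbTE ki) mul0r mulr0z.
rewrite (bigD1 j) //= big1 => [|l lj]; first by rewrite !eqxx mul1r addr0.
by rewrite (negbTE lj) andbF mul0r mulr0z.
Qed.

Lemma Phi_inj s M t N : Phi s M = Phi t N -> s = t /\ M = N.
Proof.
move=> e; have st : s = t by rewrite -(tcoef_Phi s M) e tcoef_Phi.
split=> //; move: e; rewrite st => /addrI e; apply/matrixP => i j.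
have := emb_mx_form M i j; rewrite e emb_mx_form => /(congr1 (tcoef (rdiag [set: T]))).
rewrite !tcoefMz // -[bcls _]/(1%R : double_burnside T) tcoef1 // eqxx !mul1r.
by move->.
Qed.

End OrderTwo.

(** * Orthogonal integer matrices of size two *)
Section SignedPermutations.
Local Open Scope ring_scope.
Implicit Types (M N : 'M[int]_2) (t : bool * bool * bool).

Lemma ord2P (i : 'I_2) : i = 0 \/ i = 1.
Proof. by case: i => -[|[|//]] ?; [left|right]; apply: val_inj. Qed.

Lemma mx2P (R : Type) (M N : 'M[R]_2) : M 0 0 = N 0 0 -> M 0 1 = N 0 1 ->
  M 1 0 = N 1 0 -> M 1 1 = N 1 1 -> M = N.
Proof.
by move=> *; apply/matrixP => i j; case: (ord2P i) => ->; case: (ord2P j) => ->.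
Qed.

Lemma mul2E M N i j : (M *m N) i j = M i 0 * N 0 j + M i 1 * N 1 j.
Proof.
rewrite mxE big_ord_recl big_ord1; congr (_ + M i _ * N _ j); exact: val_inj.
Qed.

Lemma sqr_sum_eq1 (a b : int) : a * a + b * b = 1 ->
  (a = 1 /\ b = 0) \/ (a = -1 /\ b = 0) \/ (a = 0 /\ b = 1) \/ (a = 0 /\ b = -1).
Proof.
move=> e; have [a1 a2] : -1 <= a /\ a <= 1 by nia.
have [b1 b2] : -1 <= b /\ b <= 1 by nia.
have [|[|]] : a = -1 \/ a = 0 \/ a = 1 by lia.
all: have [|[|]] : b = -1 \/ b = 0 \/ b = 1 by lia.
all: move=> *; subst; lia.
Qed.

(** The signed permutation matrices: t.2 tells whether the permutation is trivial,
    t.1 are the signs of the two rows. *)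
Definition spmx t : 'M[int]_2 := \matrix_(i, j)
  if (i == j) == t.2 then (-1) ^+ (if i == 0 then t.1.1 else t.1.2) else 0.

Definition orthmx M := M *m M^T = 1%:M.

Lemma spmx_orth t : orthmx (spmx t).
Proof. by case: t => [[[] []] []]; apply: mx2P; rewrite mul2E !mxE. Qed.

Lemma orthmx_sp M : orthmx M -> exists t, M = spmx t.
Proof.
move=> o; have e i j : M i 0 * M j 0 + M i 1 * M j 1 = (i == j)%:R.
  by have := congr1 (fun N : 'M[int]_2 => N i j) o; rewrite mul2E !mxE.
have := e 1 1; have := e 0 1; have := e 0 0; rewrite /= => e00 e01 e11.
have sp t : M 0 0 = spmx t 0 0 -> M 0 1 = spmx t 0 1 -> M 1 0 = spmx t 1 0 ->
    M 1 1 = spmx t 1 1 -> exists t, M = spmx t.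
  by move=> *; exists t; apply: mx2P.
have [[a b]|[[a b]|[[a b]|[a b]]]] := sqr_sum_eq1 e00;
  have [[c d]|[[c d]|[[c d]|[c d]]]] := sqr_sum_eq1 e11;
  rewrite a b c d in e01 => //.
- by apply: (sp (false, false, true)); rewrite !mxE.
- by apply: (sp (false, true, true)); rewrite !mxE.
- by apply: (sp (true, false, true)); rewrite !mxE.
- by apply: (sp (true, true, true)); rewrite !mxE.
- by apply: (sp (false, false, false)); rewrite !mxE.
- by apply: (sp (false, true, false)); rewrite !mxE.
- by apply: (sp (true, false, false)); rewrite !mxE.
- by apply: (sp (true, true, false)); rewrite !mxE.
Qed.

Lemma orthmxM M N : orthmx M -> orthmx N -> orthmx (M *m N).
Proof.
by move=> oM oN; rewrite /orthmx trmx_mul mulmxA -(mulmxA M) oN mulmx1.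
Qed.

Section FiniteImage.
Variables (gT : finGroupType) (h : 'M[int]_2 -> gT).
Hypotheses (hM : forall M N, orthmx M -> orthmx N -> h (M *m N) = (h M * h N)%g)
  (h1 : h 1%:M = 1%g) (h_spmx_inj : injective (h \o spmx)).

(** The image of O_2(Z) in a finite group, under a map that is multiplicative on
    orthogonal matrices and injective on the eight signed permutation matrices. *)
Definition sp_set : {set gT} := [set h (spmx t) | t : bool * bool * bool].

Lemma sp_groupP X : reflect (exists2 M, orthmx M & X = h M) (X \in sp_set).
Proof.
apply: (iffP imsetP) => [[t _ ->]|[M /orthmx_sp[t ->] ->]]; last by exists t.
by exists (spmx t); rewrite //; apply: spmx_orth.
Qed.

Lemma sp_group_set : group_set sp_set.
Proof.
apply/group_setP; split=> [|X Y].
  by apply/sp_groupP; exists 1%:M; rewrite ?h1 // /orthmx trmx1 mulmx1.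
move=> /sp_groupP[M oM ->] /sp_groupP[N oN ->]; apply/sp_groupP.
by exists (M *m N); [apply: orthmxM|rewrite hM].
Qed.
Canonical sp_group := Group sp_group_set.

Lemma card_sp_group : #|sp_group| = 8.
Proof.
rewrite card_imset; last exact: h_spmx_inj.
by rewrite !card_prod card_bool.
Qed.

(** Generated by a diagonal reflection and a transposition, two distinct involutions. *)
Lemma sp_group_isog_D8 : sp_group \isog 'D_8.
Proof.
pose a := (false, true, true); pose b := (false, false, false).
pose X := h (spmx a); pose Y := h (spmx b).
have spM t t' t'' : spmx t *m spmx t' = spmx t'' ->
    (h (spmx t) * h (spmx t'))%g = h (spmx t'').
  by move=> <-; rewrite (hM (spmx_orth t) (spmx_orth t')).
have sq t : spmx t *m spmx t = 1%:M -> h (spmx t) != 1%g -> #[h (spmx t)]%g = 2%N.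
  move=> tt t1; apply: nt_prime_order => //.
  by rewrite expgS expg1 -(hM (spmx_orth t) (spmx_orth t)) tt h1.
(* Every signed permutation matrix is a word in the reflection a and the
   transposition b. *)
have s1 : spmx (false, false, true) = 1%:M by apply: mx2P; rewrite !mxE.
have neq t : t != (false, false, true) -> h (spmx t) != 1%g.
  by apply: contra => /eqP e; apply/eqP/h_spmx_inj; rewrite /= e s1 h1.
have oX : #[X]%g = 2%N by apply: sq; [apply: mx2P; rewrite mul2E !mxE|apply: neq].
have oY : #[Y]%g = 2%N by apply: sq; [apply: mx2P; rewrite mul2E !mxE|apply: neq].
have XY : X != Y by apply/eqP => /h_spmx_inj.
have gen : <<[set X; Y]>>%g = sp_group.
  apply/eqP; rewrite eqEsubset gen_subG; apply/andP; split.
    by apply/subsetP => Z /set2P[] ->; apply: imset_f.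
  apply/subsetP => _ /imsetP[t _ ->].
  have gX : X \in <<[set X; Y]>>%g by apply: mem_gen; apply: set21.
  have gY : Y \in <<[set X; Y]>>%g by apply: mem_gen; apply: set22.
  have m t1 t2 t3 : spmx t1 *m spmx t2 = spmx t3 -> h (spmx t1) \in <<[set X; Y]>>%g ->
     h (spmx t2) \in <<[set X; Y]>>%g -> h (spmx t3) \in <<[set X; Y]>>%g.
    by move=> /spM <-; apply: groupM.
  have XYg : h (spmx (false, true, false)) \in <<[set X; Y]>>%g.
    by apply: (m a b) => //; apply: mx2P; rewrite mul2E !mxE.
  have YXg : h (spmx (true, false, false)) \in <<[set X; Y]>>%g.
    by apply: (m b a) => //; apply: mx2P; rewrite mul2E !mxE.
  case: t => [[[] []] []]; [| | | |exact: gX| | |].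
  - apply: (m (false, true, false) (false, true, false)) => //.
    by apply: mx2P; rewrite mul2E !mxE.
  - by apply: (m (false, true, false) a) => //; apply: mx2P; rewrite mul2E !mxE.
  - by apply: (m b (false, true, false)) => //; apply: mx2P; rewrite mul2E !mxE.
  - exact: YXg.
  - exact: XYg.
  - by rewrite s1 h1 group1.
  exact: gY.
have -> : sp_group = <<[set X; Y]>>%G by apply/val_inj.
have c8 : #|<<[set X; Y]>>%g| = 8 by rewrite gen card_sp_group.
by have := involutions_gen_dihedral oX oY XY; rewrite /= c8.
Qed.
End FiniteImage.

Local Notation gT := {'GL_2['F_3]}.

(** The entries of an orthogonal integer matrix are 0, 1 and -1, so that it is
    determined by its reduction modulo 3. *)
Fact mod3_key : unit. Proof. exact: tt. Qed.
Definition mod3 : 'M[int]_2 -> gT := locked_with mod3_key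
  (fun M => insubd (1%g : gT) (map_mx intr M : 'M['F_3]_2)).

Lemma val_mod3 M : orthmx M -> val (mod3 M) = map_mx intr M.
Proof.
move=> o; rewrite /mod3 unlock insubdK // -topredE /=.
have := map_mxM (intr : int -> 'F_3) M M^T; rewrite o map_mx1.
by move=> /esym e; have [uM _] := mulmx1_unit e; exact: uM.
Qed.

Lemma mod3M M N : orthmx M -> orthmx N -> mod3 (M *m N) = (mod3 M * mod3 N)%g.
Proof.
move=> oM oN; apply: val_inj; rewrite val_mod3; last exact: orthmxM.
by rewrite map_mxM -!val_mod3.
Qed.

Lemma mod3_1 : mod3 1%:M = 1%g.
Proof.
by apply: val_inj; rewrite val_mod3 ?map_mx1 // /orthmx trmx1 mulmx1.
Qed.

Lemma mod3_spmx_inj : injective (mod3 \o spmx).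
Proof.
move=> t t' /= e; have : map_mx intr (spmx t) = map_mx intr (spmx t') :> 'M['F_3]_2.
  by rewrite -(val_mod3 (spmx_orth t)) -(val_mod3 (spmx_orth t')) e.
move=> {e} /matrixP e; move: (e 0 0) (e 0 1) (e 1 0) (e 1 1) => {e}.
by case: t t' => [[[] []] []] [[[] []] []]; rewrite !mxE //= => /eqP + /eqP + /eqP + /eqP.
Qed.


End SignedPermutations.

(** * The groups of orthogonal units *)
Section OrderTwoUnits.
Local Open Scope group_scope.
Local Open Scope ring_scope.
Variable G : finGroupType.
Hypothesis card2 : #|[set: G]| = 2%N.

Lemma sign_inj (s t : 'Z_2) : (-1) ^+ s = (-1) ^+ t :> int -> s = t.
Proof. by case: s => -[|[|//]] i; case: t => -[|[|//]] j //= _; apply: val_inj. Qed.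

Lemma sign_mulg (s t : 'Z_2) : (-1) ^+ (s * t)%g = (-1) ^+ s * (-1) ^+ t :> int.
Proof. by case: s => -[|[|//]] i; case: t => -[|[|//]] j. Qed.

Lemma order2_orth (u : orthogonal_units G) : exists x : 'Z_2 * 'M[int]_2,
  orthmx x.2 /\ val u = Phi G ((-1) ^+ x.1) x.2.
Proof.
have /is_orthogonalP[u1 _] := valP u; have [s [M uE]] := Phi_surj card2 (val u).
move: u1; rewrite uE Phi_op PhiM // -(Phi1 G) => /(Phi_inj card2)[ss MM].
have : s = 1 \/ s = -1 by nia.
by case=> e; [exists (0, M)|exists (1, M)]; split; rewrite //= e.
Qed.

Lemma Phi_orth (s : 'Z_2) M : orthmx M -> is_orthogonal (Phi G ((-1) ^+ s) M).
Proof.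
move=> o; apply/is_orthogonalP; rewrite Phi_op !PhiM // o (mulmx1C o) -expr2 sqrr_sign.
by rewrite Phi1.
Qed.

Lemma order2_iso : group_iso (orthogonal_units G)
  (setX_group (Zp_group 2) (sp_group mod3M mod3_1)).
Proof.
have /choice[d dP] := order2_orth.
have dM u v : d (u * v)%g = ((d u).1 * (d v).1, (d u).2 *m (d v).2)%g.
  have [ou eu] := dP u; have [ov ev] := dP v; have [_] := dP (u * v)%g.
  rewrite /= eu ev PhiM // -sign_mulg => /(Phi_inj card2)[/sign_inj e1 e2].
  by rewrite [LHS]surjective_pairing -e1 -e2.
exists (fun u => ((d u).1, mod3 (d u).2)); split=> [u v|u v [e1 e2]|[s X]].
- by rewrite dM /= mod3M //; [have [] := dP u|have [] := dP v].
- have [/orthmx_sp[t e] eu] := dP u; have [/orthmx_sp[t' e'] ev] := dP v.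
  apply: val_inj; rewrite eu ev e1; congr Phi; rewrite e e' in e2 *.
  by rewrite (mod3_spmx_inj e2).
rewrite in_setX /= [s \in _]inE /=; split=> [/sp_groupP[M oM ->]|[u [_ <-]]]; last first.
  by apply/sp_groupP; exists (d u).2 => //; have [] := dP u.
pose u : orthogonal_units G := 
  exist (fun x : double_burnside G => is_orthogonal x) _ (Phi_orth s oM).
by exists u; have [_ /(Phi_inj card2)[/sign_inj <- <-]] := dP u.
Qed.
End OrderTwoUnits.

Section TrivialGroup.
Local Open Scope group_scope.
Local Open Scope ring_scope.
Variable G : finGroupType.
Hypothesis G1 : [set: G] = 1%g.

Let x1 (x : G) : x = 1%g.
Proof. by apply/set1P; rewrite -[[set 1%g]]G1 inE. Qed.

Let cycG : cyclic [set: G].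
Proof. by rewrite G1 cyclic1. Qed.

Lemma trivial_units : group_iso (orthogonal_units G) (Zp_group 2).
Proof.
have cS s : (s, 1%g) \in sgroup G by apply/sgroupP; apply: group1.
pose j (s : 'Z_2) : orthogonal_units G := osgraph (s, 1%g).
have jE s : val (j s) = sgraph (s, 1%g) := val_osgraph cycG (cS s).
apply: (group_iso_fin (j := j)) => [s t _ _|u|s _ e].
- by rewrite /j -(osgraphM cycG (cS s) (cS t)); congr (osgraph (_, _)); rewrite mulg1.
- have [[s f] _ [y [uE _ y1 _]]] := orth_sgraph cycG (valP u).
  have f1 : f = 1%g by apply/permP => x; rewrite (x1 (f x)) [RHS]x1.
  exists s; first by rewrite inE.
  apply: val_inj; rewrite jE uE f1 (_ : y = 1) ?mulr1 //.
  have cG := cyclic_mulgC cycG; apply: (tcoef_inj cG cG) => L.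
  have -> : L = rdiag [set: G].
    apply/val_inj/setP => -[g h]; rewrite (x1 g) (x1 h) group1.
    by apply/esym; apply/rdiagP; rewrite inE.
  by rewrite y1 tcoef1 // eqxx.
have := sgraph_diag_eq1 cycG (cS s); rewrite -jE e /=.
rewrite (tcoef1 (cyclic_mulgC cycG)) eqxx => /(_ erefl) h.
exact: (congr1 fst h).
Qed.
End TrivialGroup.

Section Target.
Local Open Scope group_scope.

Lemma Inn_abelian (gT : finGroupType) (A : {group gT}) : abelian A -> Inn A = 1%G.
Proof.
move=> cA; apply/val_inj => /=; apply/trivgP; rewrite sub_morphim_pre ?normG //.
by rewrite -kerE ker_conj_aut.
Qed.

Lemma Out_abelian_isog (gT : finGroupType) (A : {group gT}) : abelian A ->
  Aut_group A \isog Out A.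
Proof. by move=> cA; rewrite /Out (Inn_abelian cA) /= quotient1_isog. Qed.

Lemma Aut_isog (aT rT : finGroupType) (A : {group aT}) (B : {group rT}) :
  A \isog B -> Aut_group A \isog Aut_group B.
Proof.
case/isogP=> f f_inj fA; have -> : B = (f @* A)%G by apply: val_inj.
by rewrite isog_sym; apply: injm_Aut.
Qed.

Lemma cyclic_Zp m : (1 < m)%N -> cyclic (Zp m).
Proof. by move=> m1; rewrite /Zp m1 Zp_cycle cycle_cyclic. Qed.

Lemma Aut_cyclic_isog (G : finGroupType) m : cyclic [set: G] -> (1 < m)%N ->
  #|[set: G]| = m -> Aut_group [set: G] \isog Out (Zp_group m).
Proof.
move=> cycG m1 cardG; apply: isog_trans (Out_abelian_isog _); last first.
  exact: cyclic_abelian (cyclic_Zp m1).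
apply: Aut_isog; rewrite isog_cyclic_card // cyclic_Zp //= card_Zp ?cardG //.
exact: ltnW.
Qed.

Definition target (p k n : nat) :=
  setX_group (elem2 k) (setXn_group (fun i : 'I_n => Out (Zp_group (p ^ i.+1)))).

Lemma elem2_succ_isog k : setX_group (Zp_group 2) (elem2 k) \isog elem2 k.+1.
Proof. exact: (setXn_succ_isog (fun _ : 'I_k.+1 => Zp_group 2)). Qed.

(** The factor of signs joins the elementary abelian part, the automorphism group
    becomes the last outer automorphism group. *)
Lemma target_succ_isog p k n (G : finGroupType) : prime p -> cyclic [set: G] ->
  #|[set: G]| = (p ^ n.+1)%N ->
  setX_group (sgroup G) (target p k n) \isog target p k.+1 n.+1.
Proof.
move=> pp cycG cardG; apply: isog_trans (setX_swap_isog _ _ _ _) _.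
apply: setX_isog; first exact: elem2_succ_isog.
apply: isog_trans (setXn_succ_isog (fun i : 'I_n.+1 => Out (Zp_group (p ^ i.+1)))).
apply: setX_isog (isog_refl _); apply: Aut_cyclic_isog => //.
by rewrite -{1}(exp1n n.+1) ltn_exp2r ?prime_gt1.
Qed.

Lemma target0_isog p : Zp_group 2 \isog target p 1 0.
Proof.
have c2 : #|target p 1 0| = 2.
  by rewrite cardsX !cardsXn big_ord_recl !big_ord0 card_Zp.
rewrite isog_cyclic_card; last exact: cyclic_Zp.
by rewrite c2 card_Zp // eqxx andbT prime_cyclic // c2.
Qed.

End Target.

Section Induction.
Local Open Scope group_scope.

Lemma quotient_cyclic_p p n (G : finGroupType) (z : G) : prime p ->
  cyclic [set: G] -> #|[set: G]| = (p ^ n.+1)%N -> #[z] = p ->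
  cyclic [set: (coset_of <[z]>%G)] /\ #|[set: (coset_of <[z]>%G)]| = (p ^ n)%N.
Proof.
move=> pp cycG cardG oz; rewrite -quotientT; split; first exact: quotient_cyclic.
rewrite card_quotient -?divgS ?subsetT // ?cardG -?orderE ?oz.
  by rewrite expnS mulKn ?prime_gt0.
by apply/subsetP => x _; apply: comm_norm; apply: cyclic_mulgC.
Qed.

Lemma units_step p k n (G : finGroupType) : prime p -> odd p ->
  (3 <= p.-1 * p ^ n)%N -> cyclic [set: G] -> #|[set: G]| = (p ^ n.+1)%N ->
  (forall H : finGroupType, cyclic [set: H] -> #|[set: H]| = (p ^ n)%N ->
     group_iso (orthogonal_units H) (target p k n)) ->
  group_iso (orthogonal_units G) (target p k.+1 n.+1).
Proof.
move=> pp podd q3 cycG cardG IH; apply: group_iso_isog (target_succ_isog k pp cycG cardG).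
have pG : p.-group [set: G] by rewrite /pgroup cardG pnatX pnat_id.
have [|z oz] := exists_order_p pp pG.
  by rewrite -cardG_gt1 cardG -(exp1n n.+1) ltn_exp2r ?prime_gt1.
have [cycH cardH] := quotient_cyclic_p pp cycG cardG oz.
apply: (reduction pp cycG pG oz podd); last exact: IH.
by rewrite -cardsT cardG expnS mulKn ?prime_gt0.
Qed.

Lemma units_trivial p (G : finGroupType) : #|[set: G]| = 1%N ->
  group_iso (orthogonal_units G) (target p 1 0).
Proof.
move=> cardG; apply: group_iso_isog (target0_isog p).
by apply: trivial_units; apply: card1_trivg.
Qed.

Lemma units_gt3 p n (G : finGroupType) : prime p -> (3 < p)%N -> cyclic [set: G] ->
  #|[set: G]| = (p ^ n)%N -> group_iso (orthogonal_units G) (target p n.+1 n).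
Proof.
move=> pp p3; have podd : odd p by case: (even_prime pp) p3 => // ->.
elim: n G => [|n IH] G cycG cardG; first exact: units_trivial.
apply: units_step => //; rewrite -(muln1 3) leq_mul ?expn_gt0 ?prime_gt0 //.
by case: p p3 {pp podd IH cardG} => // p; rewrite ltnS.
Qed.

Lemma units_order3 (G : finGroupType) : #|[set: G]| = 3%N ->
  group_iso (orthogonal_units G) (target 3 3 1).
Proof.
move=> card3; have p3 : prime 3 by [].
have cycG : cyclic [set: G] by apply: prime_cyclic; rewrite card3.
have pG : 3.-group [set: G] by rewrite /pgroup card3.
have [|z oz] := exists_order_p p3 pG; first by rewrite -cardG_gt1 card3.
have [_ cardH] := quotient_cyclic_p (n := 0) p3 cycG card3 oz.
apply: group_iso_isog (reduction3 card3 oz (units_trivial 3 cardH)) _.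
apply: isog_trans _ (target_succ_isog (n := 0) 2 p3 cycG card3).
apply: isog_trans (setX_assoc_isog _ _ _) _; apply: setX_isog (isog_refl _) _.
rewrite isog_sym; apply: isog_trans (setX_isog _ (isog_refl _)) _.
  by rewrite isog_sym; apply: elem2_succ_isog.
exact: setX_assoc_isog.
Qed.

Lemma units_3 n (G : finGroupType) : cyclic [set: G] -> #|[set: G]| = (3 ^ n.+1)%N ->
  group_iso (orthogonal_units G) (target 3 n.+3 n.+1).
Proof.
elim: n G => [|n IH] G cycG cardG; first exact: units_order3.
apply: units_step => //; rewrite expnS mulnA -{1}(muln1 3) leq_mul ?expn_gt0 //.
Qed.

End Induction.

Local Open Scope group_scope.

Theorem theorem1p1 (p : nat) (G : finGroupType) (p_prime : prime p)
    (G_cyclic : cyclic [set: G]) (G_pgroup : p.-group [set: G]) :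
  [/\ [set: G] = 1 -> group_iso (orthogonal_units G) (Zp_group 2),
      [set: G] \isog Zp 2 ->
        group_iso (orthogonal_units G) (setX_group (Zp_group 2) 'D_8%G)
    & forall n : nat, odd p -> (1 <= n)%N -> #|[set: G]| = (p ^ n)%N ->
        (p = 3%N ->
           group_iso (orthogonal_units G)
             (setX_group (elem2 n.+2)
                (setXn_group (fun i : 'I_n => Out (Zp_group (p ^ i.+1))))))
        /\
        ((3 < p)%N ->
           group_iso (orthogonal_units G)
             (setX_group (elem2 n.+1)
                (setXn_group (fun i : 'I_n => Out (Zp_group (p ^ i.+1))))))].
Proof.
split=> [|G2|n podd n1 cardG]; first exact: trivial_units.
  have card2 : #|[set: G]| = 2 by rewrite (card_isog G2) card_Zp.
  apply: group_iso_isog (order2_iso card2) _; apply: setX_isog (isog_refl _) _.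
  exact: sp_group_isog_D8 mod3_spmx_inj.
split=> [p3|p3]; last exact: units_gt3.
by case: n n1 cardG => // n _; rewrite p3; apply: units_3.
Qed.
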